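(* Let $n\ge 2$, $m\ge 2$, let $U\subset\mathbb{R}^m$ be open and connected, and let $H_0,H_1,\dots,H_m$ be $n\times n$ Hermitian matrices. Set $H(u)=H_0+u_1H_1+\cdots+u_mH_m$ for $u=(u_1,\dots,u_m)\in U$. Assume that the spectrum of $H(\cdot)$ is conically connected on $U$. Then the Lie algebra generated by $\{iH(u)\mid u\in U\}$ equals $\mathfrak{su}(n)$ if $\operatorname{tr}H(u)=0$ for every $u\in U$, and equals $\mathfrak{u}(n)$ otherwise. Consequently, the system $i\dot g(t)=H(u(t))g(t)$, with controls $u\in L^\infty([0,T],U)$, is exactly controllable in $\mathrm{U}(n)$ in the second case, and is well-posed and exactly controllable in $\mathrm{SU}(n)$ in the first case. In particular, the system $i\dot\psi(t)=H(u(t))\psi(t)$ on the unit sphere $S^{2n-1}\subset\mathbb{C}^n$ is exactly controllable.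
   Context: For $u\in U$ let $\lambda_1(u)\le\cdots\le\lambda_n(u)$ be the eigenvalues of $H(u)$, counted with multiplicity. A point $\bar u\in U$ is a conical intersection between $\lambda_j$ and $\lambda_{j+1}$ if $\lambda_j(\bar u)=\lambda_{j+1}(\bar u)$ is an eigenvalue of multiplicity exactly two and there is a constant $c>0$ such that for every unit vector $v\in\mathbb{R}^m$ and all sufficiently small $t>0$, $\lambda_{j+1}(\bar u+tv)-\lambda_j(\bar u+tv)>ct$. The spectrum of $H(\cdot)$ is conically connected if every eigenvalue intersection (every $u\in U$ with $\lambda_j(u)=\lambda_{j+1}(u)$ for some $j$) is conical, and for every $j=1,\dots,n-1$ there is a conical intersection $\bar u_j\in U$ between $\lambda_j$ and $\lambda_{j+1}$ such that $\lambda_l(\bar u_j)$ is a simple eigenvalue for all $l\ne j,j+1$. A control system $\dot q=f(q,u)$ on a connected manifold $M$ with controls in $U$ is exactly controllable if for every $q_0\in M$ the reachable set from $q_0$ (the set of endpoints $q(T)$, $T\ge0$, of solutions with $q(0)=q_0$ and $L^\infty$ controls $u:[0,T]\to U$) equals $M$. *)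

(* Defs.v *)
From HB Require Import structures.
From mathcomp Require Import all_boot all_order all_algebra.
From mathcomp Require Import complex.
From mathcomp Require Import all_classical all_reals all_analysis.

Set Implicit Arguments.
Unset Strict Implicit.
Unset Printing Implicit Defensive.

Import Order.TTheory GRing.Theory Num.Theory.
Import numFieldNormedType.Exports.
Local Open Scope classical_set_scope.
Local Open Scope ring_scope.

Section Defs.
Variable R : realType.
Local Notation C := (complex R).

Definition cR (x : R) : C := Complex x 0.
Definition iC : C := Complex 0 1.

Definition adj (p q : nat) (A : 'M[C]_(p, q)) : 'M[C]_(q, p) :=
  (map_mx (@conjc R) A)^T.

Definition is_hermitian (n : nat) (A : 'M[C]_n) : Prop := adj A = A.

Definition u_alg (n : nat) : set 'M[C]_n := [set A | adj A = - A].
Definition su_alg (n : nat) : set 'M[C]_n :=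
  [set A | adj A = - A /\ \tr A = 0].

Definition U_grp (n : nat) : set 'M[C]_n := [set g | adj g *m g = 1%:M].
Definition SU_grp (n : nat) : set 'M[C]_n :=
  [set g | adj g *m g = 1%:M /\ \det g = 1].
Definition sphere (n : nat) : set 'cV[C]_n :=
  [set psi : 'cV[C]_n | \sum_(i < n) (complex.Re (psi i 0) ^+ 2 + complex.Im (psi i 0) ^+ 2) = 1].

Definition lie_closed (n : nat) (L : set 'M[C]_n) : Prop :=
  [/\ L 0,
      (forall A B, L A -> L B -> L (A + B)),
      (forall (r : R) A, L A -> L (cR r *: A)) &
      (forall A B, L A -> L B -> L (A *m B - B *m A))].

Definition lie_gen (n : nat) (S : set 'M[C]_n) : set 'M[C]_n :=
  [set X | forall L, lie_closed L -> S `<=` L -> L X].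

Definition Hu (n m : nat) (H0 : 'M[C]_n) (Hs : 'I_m -> 'M[C]_n)
  (u : 'rV[R]_m) : 'M[C]_n := H0 + \sum_(k < m) cR (u 0 k) *: Hs k.

(* the eigenvalues of a (Hermitian) matrix, in nondecreasing order, counted
   with multiplicity: the sorted real sequence s whose associated monic
   polynomial is the characteristic polynomial (unique when it exists) *)
Definition eigseq (n : nat) (A : 'M[C]_n) : seq R :=
  xget [::] [set s : seq R | sorted <=%R s /\
     char_poly A = \prod_(x <- s) ('X - (cR x)%:P)].

(* lambda_{j+1}(A) in 0-based indexing: lam A j, j < n *)
Definition lam (n : nat) (A : 'M[C]_n) (j : nat) : R := nth 0 (eigseq A) j.

Definition eunit (m : nat) (v : 'rV[R]_m) : Prop :=
  \sum_(k < m) v 0 k ^+ 2 = 1.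

Definition conical_int (n m : nat) (H : 'rV[R]_m -> 'M[C]_n) (j : nat)
  (ub : 'rV[R]_m) : Prop :=
  [/\ lam (H ub) j = lam (H ub) j.+1,
      count_mem (lam (H ub) j) (eigseq (H ub)) = 2%N &
      exists2 c : R, 0 < c & forall v, eunit v ->
        exists2 d : R, 0 < d & forall t : R, 0 < t -> t < d ->
          lam (H (ub + t *: v)) j.+1 - lam (H (ub + t *: v)) j > c * t].

Definition conically_connected (n m : nat) (U : set 'rV[R]_m)
  (H : 'rV[R]_m -> 'M[C]_n) : Prop :=
  (forall u j, U u -> (j.+1 < n)%N -> lam (H u) j = lam (H u) j.+1 ->
     conical_int H j u) /\
  (forall j, (j.+1 < n)%N -> exists2 ub, U ub &
     conical_int H j ub /\
     forall l, (l < n)%N -> l != j -> l != j.+1 ->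
       count_mem (lam (H ub) l) (eigseq (H ub)) = 1%N).

Definition I0 (T : R) : set R := `[0, T]%classic.

Definition admissible (m : nat) (U : set 'rV[R]_m) (T : R)
  (u : R -> 'rV[R]_m) : Prop :=
  (forall t, I0 T t -> U (u t)) /\
  (forall k : 'I_m, measurable_fun (I0 T) (fun t => u t 0 k)) /\
  (exists M : R, forall k : 'I_m,
     {ae (@lebesgue_measure R), forall t, I0 T t -> `|u t 0 k| <= M}).

(* Caratheodory solution on [0,T] of  i X'(t) = H(u(t)) X(t),
   i.e. X(t) = X(0) + int_0^t (-i) H(u(s)) X(s) ds, componentwise
   (real and imaginary parts) *)
Definition is_sol (n m q : nat) (H : 'rV[R]_m -> 'M[C]_n) (T : R)
  (u : R -> 'rV[R]_m) (X : R -> 'M[C]_(n, q)) : Prop :=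
  let F := fun s => (- iC) *: (H (u s) *m X s) in
  forall a b,
    (@lebesgue_measure R).-integrable (I0 T) (fun s => (complex.Re (F s a b))%:E) /\
    (@lebesgue_measure R).-integrable (I0 T) (fun s => (complex.Im (F s a b))%:E) /\
    (forall t, I0 T t ->
      (complex.Re (X t a b))%:E = (complex.Re (X 0 a b))%:E +
        (\int[@lebesgue_measure R]_(s in I0 t) (complex.Re (F s a b))%:E)%E /\
      (complex.Im (X t a b))%:E = (complex.Im (X 0 a b))%:E +
        (\int[@lebesgue_measure R]_(s in I0 t) (complex.Im (F s a b))%:E)%E).

Definition reachable (n m q : nat) (U : set 'rV[R]_m)
  (H : 'rV[R]_m -> 'M[C]_n) (X0 : 'M[C]_(n, q)) : set 'M[C]_(n, q) :=
  [set Y | exists T : R, exists u : R -> 'rV[R]_m,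
     exists X : R -> 'M[C]_(n, q),
     [/\ 0 <= T, admissible U T u, X 0 = X0, is_sol H T u X & X T = Y]].

Definition exactly_controllable (n m q : nat) (U : set 'rV[R]_m)
  (H : 'rV[R]_m -> 'M[C]_n) (M : set 'M[C]_(n, q)) : Prop :=
  forall X0, M X0 -> reachable U H X0 = M.

End Defs.

(* Main.v *)
(** Generation. Let g be the complex Lie algebra generated by the H(u). For a spectral plane E(u)
    of H(u) attached to a pair of eigenvalues isolated from the others, Kato's generator of the
    transport of the spectral projection is a Lagrange polynomial in ad H(u) applied to the
    velocity, hence lies in g; so the transport preserves g up to second order and the "defect", the
    squared norm of sl(E(u)) modulo g, has quadratic variation along segments: it is constant. At a
    conical intersection the first order splitting provides three independent elements of
    sl(E), so the defect vanishes there. Since m >= 2, punctured balls around the isolated eigenvalue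
    intersections are connected, and connectedness of U propagates the vanishing to a point with
    simple spectrum, where the planes of consecutive eigenvectors generate sl(n).

    Controllability. A product of flows with piecewise constant controls whose velocities span the
    Lie algebra has open image, by a Newton step at a minimizer of the distance to the target; the
    recurrence of powers of a unitary matrix brings the inverse of the center of the image into the
    reachable set, hence a neighborhood of the identity, and N-th roots yield the whole group.
    Conversely X^* X and, in the traceless case, det X are conserved, since their increments along a
    solution are quadratic in the time step. *)

Require Import Defs.
From HB Require Import structures.
From mathcomp Require Import all_boot all_order all_algebra all_fingroup.
From mathcomp Require Import complex.
From mathcomp Require Import all_classical all_reals all_analysis.
From mathcomp Require Import spectral sesquilinear measurable_realfun.
From mathcomp Require Import ring lra zify.
Require Import Defs.
Import Order.TTheory GRing.Theory Num.Theory.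
Import numFieldNormedType.Exports.
Local Open Scope classical_set_scope.
Local Open Scope ring_scope.
Set Implicit Arguments.
Unset Strict Implicit.
Unset Printing Implicit Defensive.

(** Although the conclusion is real, the work is done in the complexified algebra, where
    interpolation makes every function of ad H(u) available; the real algebra is recovered at the
    end as the skew part. Eigenvectors cannot be followed continuously around a conical
    intersection, so the transported object is the plane of a consecutive pair, whose projection
    stays regular where the two eigenvalues of the pair meet. It is not regular where a member of
    the pair meets a third eigenvalue, and the defect is meaningless there; hence the property
    propagated through U is vanishing on a punctured neighborhood. The scalar defect spares solving
    the transport equation: increments of order h^2 force constancy. The same principle yields the
    conservation laws, where the controls are merely measurable in time. Finally, in a conical
    intersection the range of t may depend on the direction; uniformity comes from the linear
    independence of the directions compressed to the plane. *)

Section QuadraticEstimates.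
Variable R : realType.

(** Bridge to differentiability from explicit second-order remainders, the form in which the
    perturbation estimates below are stated. *)
Lemma quadratic_is_derive (f : R -> R) (x l c e : R) : 0 < e ->
  (forall h, `|h| < e -> `|f (x + h) - f x - h * l| <= c * h ^+ 2) -> is_derive x (1 : R) f l.
Proof.
move=> e0 H.
have cvgl : h^-1 *: ((f \o shift x) (h *: (1 : R)) - f x) @[h --> (0 : R)^'] --> l.
  apply/cvgrPdist_le => /= eps eps0; near=> h.
  have h0 : h != 0 by near: h; exact: nbhs_dnbhs_neq.
  have -> : l - h^-1 *: ((f \o shift x) (h *: (1 : R)) - f x) = - h^-1 * (f (x + h) - f x - h * l).
    have -> : (f \o shift x) (h *: (1 : R)) = f (x + h).
      by rewrite /= /shift /= -[h *: 1]/(h * 1) mulr1 addrC.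
    by rewrite -[h^-1 *: _]/(h^-1 * _); field.
  rewrite normrM normrN normfV ler_pdivrMl ?normr_gt0 //.
  apply: (le_trans (H h _)); first by near: h; exact: dnbhs0_lt.
  apply: (@le_trans _ _ (`|c| * `|h| ^+ 2)).
    by rewrite real_normK ?num_real // ler_wpM2r ?sqr_ge0 // ler_norm.
  rewrite expr2 mulrCA ler_wpM2l //.
  apply: (@le_trans _ _ (`|c| * (eps / (`|c| + 1)))).
    by apply: ler_wpM2l => //; near: h; apply: dnbhs0_le; rewrite divr_gt0 // ltr_wpDl.
  by rewrite mulrCA ler_piMr ?(ltW eps0) // ler_pdivrMr ?ltr_wpDl // mul1r lerDl.
by apply: DeriveDef; [apply/cvg_ex; exists l | exact/cvg_lim].
Unshelve. all: by end_near.
Qed.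

(** The derivative vanishes and the mean value theorem concludes. The hypothesis is two-sided even
    at [a] and [b], so [f] has to be controlled slightly outside the interval; [quadratic_cst]
    arranges this by clamping. *)
Lemma quadratic_variation_cst (f : R -> R) (a b : R) : a <= b ->
  (forall t, a <= t -> t <= b -> exists c e : R, 0 < e /\
    forall h, `|h| < e -> `|f (t + h) - f t| <= c * h ^+ 2) -> f a = f b.
Proof.
rewrite le_eqVlt => /orP [/eqP -> //|ab] H.
have D t : t \in `[a, b] -> is_derive t (1 : R) f 0.
  rewrite in_itv /= => /andP [at_ tb]; have [c [e [e0 h1]]] := H t at_ tb.
  by apply: (@quadratic_is_derive f t 0 c e) => // h he; rewrite mulr0 subr0; exact: h1.
have D1 t : t \in `]a, b[ -> is_derive t (1 : R) f ((fun=> 0 : R) t).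
  by rewrite in_itv /= => /andP [at_ tb]; apply: D; rewrite in_itv /= !ltW.
have C1 : {within `[a, b], continuous f}.
  by apply: derivable_within_continuous => t tab; have [] := D t tab.
have [c _] := MVT ab D1 C1.
by rewrite mul0r => /eqP; rewrite subr_eq0 => /eqP ->.
Qed.
End QuadraticEstimates.

(** * Norms and adjoints of complex matrices *)

Section MatrixNorm.
Variable R : realType.
Local Notation C := (complex R).
Implicit Types (z : C) (p q r : nat).

Lemma cRD (x y : R) : cR (x + y) = cR x + cR y.
Proof. exact: (rmorphD (real_complex R)). Qed.
Lemma cRN (x : R) : cR (- x) = - cR x.
Proof. exact: (rmorphN (real_complex R)). Qed.
Lemma cRB (x y : R) : cR (x - y) = cR x - cR y.
Proof. exact: (rmorphB (real_complex R)). Qed.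
Lemma cRM (x y : R) : cR (x * y) = cR x * cR y.
Proof. exact: (rmorphM (real_complex R)). Qed.
Lemma cR0 : cR 0 = 0 :> C. Proof. by []. Qed.
Lemma cR1 : cR 1 = 1 :> C. Proof. by []. Qed.
Lemma cRV (x : R) : cR x^-1 = (cR x)^-1.
Proof. exact: (fmorphV (real_complex R)). Qed.
Lemma cR_nat k : cR k%:R = k%:R :> C.
Proof. exact: (rmorph_nat (real_complex R)). Qed.
Lemma cR_sum (I : Type) (s : seq I) (P : pred I) (F : I -> R) :
  cR (\sum_(i <- s | P i) F i) = \sum_(i <- s | P i) cR (F i).
Proof. exact: (rmorph_sum (real_complex R)). Qed.
Lemma cR_inj : injective (@cR R).
Proof. by move=> x y []. Qed.
Lemma cR_eq0 (x : R) : (cR x == 0) = (x == 0).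
Proof. exact: (fmorph_eq0 (real_complex R)). Qed.
Lemma conj_cR (x : R) : conjc (cR x) = cR x.
Proof. by rewrite /cR /= oppr0. Qed.
Lemma iC2 : iC R * iC R = -1.
Proof. by apply/eqP; rewrite eq_complex /= !(mul0r, mul1r, sub0r, addr0) oppr0 !eqxx. Qed.
Lemma conj_iC : conjc (iC R) = - iC R.
Proof. by apply/eqP; rewrite eq_complex /= oppr0 !eqxx. Qed.
Lemma conj_NiC : conjc (- iC R) = iC R.
Proof. by rewrite -conj_iC conjcK. Qed.

(** The l1 norm of a complex number: submultiplicative, and real valued without square roots, so
    that estimates stay within the reach of linear arithmetic. *)
Definition cn z : R := `|complex.Re z| + `|complex.Im z|.

Lemma cn_ge0 z : 0 <= cn z.
Proof. by rewrite addr_ge0. Qed.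
Lemma cn0 : cn 0 = 0.
Proof. by rewrite /cn /= normr0 addr0. Qed.
Lemma cn1 : cn 1 = 1.
Proof. by rewrite /cn /= normr0 addr0 normr1. Qed.
Lemma cn_eq0 z : cn z = 0 -> z = 0.
Proof.
case: z => a b; rewrite /cn /= => /eqP; rewrite paddr_eq0 // !normr_eq0.
by case/andP=> /eqP -> /eqP ->.
Qed.
Lemma cnD z z' : cn (z + z') <= cn z + cn z'.
Proof.
case: z z' => a b [c d]; rewrite /cn /=.
have := ler_normD a c; have := ler_normD b d; lra.
Qed.
Lemma cnN z : cn (- z) = cn z.
Proof. by case: z => a b; rewrite /cn /= !normrN. Qed.
Lemma cn_conj z : cn (conjc z) = cn z.
Proof. by case: z => a b; rewrite /cn /= !normrN. Qed.
Lemma cnM z z' : cn (z * z') <= cn z * cn z'.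
Proof.
case: z z' => a b [c d]; rewrite /cn /=.
have := ler_normB (a * c) (b * d); have := ler_normD (a * d) (b * c).
rewrite !normrM; lra.
Qed.
Lemma cn_cRM (x : R) z : cn (cR x * z) = `|x| * cn z.
Proof.
by case: z => a b; rewrite /cn /= !mul0r subr0 addr0 !normrM mulrDr.
Qed.
Lemma cn_iCM z : cn (iC R * z) = cn z.
Proof. by case: z => a b; rewrite /cn /= !mul0r !mul1r sub0r add0r normrN addrC. Qed.
Lemma cn_cR (x : R) : cn (cR x) = `|x|.
Proof. by rewrite /cn /= normr0 addr0. Qed.
Lemma cn_sum (I : Type) (s : seq I) (P : pred I) (F : I -> C) :
  cn (\sum_(i <- s | P i) F i) <= \sum_(i <- s | P i) cn (F i).
Proof.
elim/big_ind2 : _ => //; first by rewrite cn0.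
by move=> x1 x2 y1 y2 h1 h2; apply: (le_trans (cnD _ _)); apply: lerD.
Qed.
Lemma Re_sum (I : Type) (s : seq I) (P : pred I) (F : I -> C) :
  complex.Re (\sum_(i <- s | P i) F i) = \sum_(i <- s | P i) complex.Re (F i).
Proof. by elim/big_rec2: _ => [|i x [a b] _ /= <-] //; case: (F i). Qed.
Lemma Im_sum (I : Type) (s : seq I) (P : pred I) (F : I -> C) :
  complex.Im (\sum_(i <- s | P i) F i) = \sum_(i <- s | P i) complex.Im (F i).
Proof. by elim/big_rec2: _ => [|i x [a b] _ /= <-] //; case: (F i). Qed.
Lemma ReB z z' : complex.Re (z - z') = complex.Re z - complex.Re z'.
Proof. by case: z z' => a b []. Qed.
Lemma ImB z z' : complex.Im (z - z') = complex.Im z - complex.Im z'.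
Proof. by case: z z' => a b []. Qed.
Lemma ReD z z' : complex.Re (z + z') = complex.Re z + complex.Re z'.
Proof. by case: z z' => a b []. Qed.
Lemma Re_le_cn z : `|complex.Re z| <= cn z.
Proof. by rewrite lerDl. Qed.
Lemma Im_le_cn z : `|complex.Im z| <= cn z.
Proof. by rewrite lerDr. Qed.

(** Entrywise l1 norm: submultiplicative for all shapes and invariant under [adj]. It is not
    unitarily invariant; [mn_isometry] makes up for that. *)
Definition mn p q (A : 'M[C]_(p, q)) : R := \sum_i \sum_j cn (A i j).

Lemma mn_ge0 p q (A : 'M[C]_(p, q)) : 0 <= mn A.
Proof. by apply: sumr_ge0 => i _; apply: sumr_ge0 => j _; exact: cn_ge0. Qed.
Hint Resolve mn_ge0 cn_ge0 : core.
Lemma mn_entry p q (A : 'M[C]_(p, q)) i j : cn (A i j) <= mn A.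
Proof.
rewrite /mn (bigD1 i) //= (bigD1 j) //= -addrA lerDl addr_ge0 //.
  by apply: sumr_ge0.
by apply: sumr_ge0 => k _; apply: sumr_ge0.
Qed.
Lemma mxDE p q (A B : 'M[C]_(p, q)) i j : (A + B) i j = A i j + B i j.
Proof. by rewrite mxE. Qed.
Lemma mxNE p q (A : 'M[C]_(p, q)) i j : (- A) i j = - A i j.
Proof. by rewrite mxE. Qed.
Lemma mxZE p q z (A : 'M[C]_(p, q)) i j : (z *: A) i j = z * A i j.
Proof. by rewrite mxE. Qed.
Lemma mn0 p q : mn (0 : 'M[C]_(p, q)) = 0.
Proof. by rewrite /mn big1 // => i _; rewrite big1 // => j _; rewrite mxE cn0. Qed.
Lemma mn_eq0 p q (A : 'M[C]_(p, q)) : mn A = 0 -> A = 0.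
Proof.
move=> A0; apply/matrixP => i j; rewrite mxE; apply: cn_eq0; apply/eqP.
by rewrite eq_le cn_ge0 andbT -A0 mn_entry.
Qed.
Lemma mnD p q (A B : 'M[C]_(p, q)) : mn (A + B) <= mn A + mn B.
Proof.
rewrite /mn -big_split /=; apply: ler_sum => i _.
by rewrite -big_split /=; apply: ler_sum => j _; rewrite mxE cnD.
Qed.
Lemma mnN p q (A : 'M[C]_(p, q)) : mn (- A) = mn A.
Proof. by apply: eq_bigr => i _; apply: eq_bigr => j _; rewrite mxE cnN. Qed.
Lemma mnB p q (A B : 'M[C]_(p, q)) : mn (A - B) <= mn A + mn B.
Proof. by rewrite -(mnN B) mnD. Qed.
Lemma mnBC p q (A B : 'M[C]_(p, q)) : mn (A - B) = mn (B - A).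
Proof. by rewrite -mnN opprB. Qed.
Lemma mn_tri p q (B A D : 'M[C]_(p, q)) : mn (A - D) <= mn (A - B) + mn (B - D).
Proof. by have -> : A - D = (A - B) + (B - D) by [rewrite addrA subrK]; exact: mnD. Qed.
Lemma mn_sum p q (I : Type) (s : seq I) (P : pred I) (F : I -> 'M[C]_(p, q)) :
  mn (\sum_(i <- s | P i) F i) <= \sum_(i <- s | P i) mn (F i).
Proof.
elim/big_ind2 : _ => //; first by rewrite mn0.
by move=> x1 x2 y1 y2 h1 h2; apply: (le_trans (mnD _ _)); apply: lerD.
Qed.
Lemma mnM p q r (A : 'M[C]_(p, q)) (B : 'M[C]_(q, r)) :
  mn (A *m B) <= mn A * mn B.
Proof.
rewrite {1}/mn.
have H i j : cn ((A *m B) i j) <= \sum_k cn (A i k) * cn (B k j).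
  by rewrite mxE; apply: (le_trans (cn_sum _ _ _)); apply: ler_sum => k _; exact: cnM.
apply: (@le_trans _ _ (\sum_i \sum_j \sum_k cn (A i k) * cn (B k j))).
  by apply: ler_sum => i _; apply: ler_sum => j _.
rewrite {1}/mn mulr_suml; apply: ler_sum => i _.
rewrite exchange_big /= mulr_suml; apply: ler_sum => k _.
rewrite -mulr_sumr; apply: ler_wpM2l => //.
rewrite /mn (bigD1 k) //= lerDl.
by apply: sumr_ge0 => l _; apply: sumr_ge0.
Qed.
Lemma mnZ p q (z : C) (A : 'M[C]_(p, q)) : mn (z *: A) <= cn z * mn A.
Proof.
rewrite /mn mulr_sumr; apply: ler_sum => i _; rewrite mulr_sumr.
by apply: ler_sum => j _; rewrite mxE cnM.
Qed.
Lemma mn_cR p q (x : R) (A : 'M[C]_(p, q)) : mn (cR x *: A) = `|x| * mn A.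
Proof.
rewrite /mn mulr_sumr; apply: eq_bigr => i _; rewrite mulr_sumr.
by apply: eq_bigr => j _; rewrite mxE cn_cRM.
Qed.
Lemma mn_iC p q (A : 'M[C]_(p, q)) : mn (iC R *: A) = mn A.
Proof. by apply: eq_bigr => i _; apply: eq_bigr => j _; rewrite mxE cn_iCM. Qed.
Lemma mn_tr p (A : 'M[C]_p) : cn (\tr A) <= mn A.
Proof.
apply: (le_trans (cn_sum _ _ _)); apply: ler_sum => i _.
by rewrite (bigD1 i) //= lerDl sumr_ge0.
Qed.
Lemma adjE p q (A : 'M[C]_(p, q)) : adj A = map_mx Num.conj A^T.
Proof. by apply/matrixP => i j; rewrite !mxE. Qed.
Lemma adjM p q r (A : 'M[C]_(p, q)) (B : 'M[C]_(q, r)) :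
  adj (A *m B) = adj B *m adj A.
Proof. by rewrite /adj map_mxM trmx_mul. Qed.
Lemma adjD p q (A B : 'M[C]_(p, q)) : adj (A + B) = adj A + adj B.
Proof. by rewrite /adj map_mxD linearD. Qed.
Lemma adjN p q (A : 'M[C]_(p, q)) : adj (- A) = - adj A.
Proof. by rewrite /adj map_mxN linearN. Qed.
Lemma adjB p q (A B : 'M[C]_(p, q)) : adj (A - B) = adj A - adj B.
Proof. by rewrite adjD adjN. Qed.
Lemma adjZ p q z (A : 'M[C]_(p, q)) : adj (z *: A) = conjc z *: adj A.
Proof. by rewrite /adj map_mxZ linearZ. Qed.
Lemma adjK p q (A : 'M[C]_(p, q)) : adj (adj A) = A.
Proof. by apply/matrixP => i j; rewrite !mxE conjcK. Qed.
Lemma adj0 p q : adj (0 : 'M[C]_(p, q)) = 0.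
Proof. by apply/matrixP => i j; rewrite !mxE conjc0. Qed.
Lemma adj1 p : adj (1%:M : 'M[C]_p) = 1%:M.
Proof. by rewrite /adj map_mx1 trmx1. Qed.
Lemma adj_sum p q (I : Type) (s : seq I) (P : pred I) (F : I -> 'M[C]_(p, q)) :
  adj (\sum_(i <- s | P i) F i) = \sum_(i <- s | P i) adj (F i).
Proof. by elim/big_rec2: _ => [|i x y _ <-]; rewrite ?adj0 ?adjD. Qed.
Lemma mn_adj p q (A : 'M[C]_(p, q)) : mn (adj A) = mn A.
Proof.
rewrite /mn exchange_big /=; apply: eq_bigr => i _; apply: eq_bigr => j _.
by rewrite !mxE cn_conj.
Qed.
Lemma adj_tr p (A : 'M[C]_p) : \tr (adj A) = conjc (\tr A).
Proof. by rewrite mxtrace_tr rmorph_sum; apply: eq_bigr => i _; rewrite mxE. Qed.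
Lemma det_adj p (A : 'M[C]_p) : \det (adj A) = conjc (\det A).
Proof. by rewrite det_tr det_map_mx. Qed.
Lemma adj_diag p (d : 'rV[C]_p) : adj (diag_mx d) = diag_mx (map_mx (@conjc R) d).
Proof. by rewrite /adj map_diag_mx tr_diag_mx. Qed.

Lemma Rez_cn_sq z : complex.Re (z * conjc z) = complex.Re z ^+ 2 + complex.Im z ^+ 2.
Proof. by case: z => a b /=; ring. Qed.
Lemma Imz_cn_sq z : complex.Im (z * conjc z) = 0.
Proof. by case: z => a b /=; ring. Qed.

Lemma cn_sq_le z : cn z ^+ 2 <= 2 * (complex.Re z ^+ 2 + complex.Im z ^+ 2).
Proof.
rewrite /cn -(real_normK (num_real (complex.Re z))) -(real_normK (num_real (complex.Im z))).
have := sqr_ge0 (`|complex.Re z| - `|complex.Im z|); lra.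
Qed.

(** The columns have unit length, so each entry has [cn] at most sqrt 2, rounded up to 2. *)
Lemma mn_isometry p q (A : 'M[C]_(p, q)) : adj A *m A = 1%:M -> mn A <= (2 * p * q)%:R.
Proof.
move=> AA.
have H i j : cn (A i j) <= 2.
  have : \sum_k (complex.Re (A k j) ^+ 2 + complex.Im (A k j) ^+ 2) = 1.
    have /matrixP /(_ j j) := AA; rewrite !mxE eqxx => /(congr1 (@complex.Re R)) /=.
    rewrite Re_sum => <-; apply: eq_bigr => k _.
    by rewrite !mxE mulrC Rez_cn_sq.
  rewrite (bigD1 i) //= => E.
  have h0 : 0 <= \sum_(k | k != i) (complex.Re (A k j) ^+ 2 + complex.Im (A k j) ^+ 2).
    by apply: sumr_ge0 => k _; rewrite addr_ge0 ?sqr_ge0.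
  have := cn_sq_le (A i j); have := cn_ge0 (A i j); nra.
apply: (@le_trans _ _ (\sum_(i < p) \sum_(j < q) 2)).
  by apply: ler_sum => i _; apply: ler_sum => j _.
by rewrite !sumr_const !card_ord -!mulrnA -mulnA [(p * q)%N]mulnC.
Qed.
Lemma adj_delta p q (i : 'I_p) (j : 'I_q) : adj (delta_mx i j : 'M[C]_(p, q)) = delta_mx j i.
Proof. by apply/matrixP => k l; rewrite /adj !mxE andbC rmorph_nat. Qed.
Lemma skew_trace p (X : 'M[C]_p) : adj X = - X -> \tr X = iC R * cR (complex.Im (\tr X)).
Proof.
move=> hX; have : \tr (adj X) = - \tr X by rewrite hX raddfN.
rewrite adj_tr; case: (\tr X) => x y /eqP; rewrite eq_complex /= => /andP [/eqP x0 _].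
have -> : x = 0 by lra.
by apply/eqP; rewrite eq_complex /=; apply/andP; split; apply/eqP; ring.
Qed.
End MatrixNorm.
#[global] Hint Extern 0 (is_true (_ <= cn _)) => exact: cn_ge0 : core.
#[global] Hint Extern 0 (is_true (_ <= mn _)) => exact: mn_ge0 : core.

(* Additive identities between matrices, entrywise with the matrix products as atoms. *)
Ltac mxadd :=
  let i := fresh "i" in let j := fresh "j" in
  apply/matrixP => i j; rewrite ?(mxDE, mxNE, mxZE);
  first [ (repeat match goal with
    |- context [@fun_of_matrix ?a ?b ?c ?M i j] => generalize (@fun_of_matrix a b c M i j); intro
  end; ring) | ring ].

Definition mxdistr := (@mulmxDl, @mulmxDr, @mulNmx, @mulmxN).

(** * Eigenvalues and spectral projections of Hermitian matrices *)

Section SpectralTheorem.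
Variable R : realType.
Local Notation C := (complex R).

Lemma char_poly_conj (K : comNzRingType) n (W V A : 'M[K]_n) :
  V *m W = 1%:M -> char_poly (W *m A *m V) = char_poly A.
Proof.
move=> VW1; have WV1 := mulmx1C VW1.
rewrite /char_poly /char_poly_mx.
have -> : 'X%:M - map_mx polyC (W *m A *m V) =
   map_mx polyC W *m ('X%:M - map_mx polyC A) *m map_mx polyC V.
  rewrite mulmxBr mulmxBl -!map_mxM; congr (_ - _).
  by rewrite scalar_mxC -mulmxA -map_mxM WV1 map_mx1 mulmx1.
rewrite !det_mulmx mulrAC -det_mulmx -map_mxM WV1 map_mx1 det1.
by rewrite mul1r.
Qed.

Lemma diag_conjE n (W : 'M[C]_n) (d : 'I_n -> C) i j :
  (W *m diag_mx (\row_k d k) *m adj W) i j = \sum_k W i k * d k * conjc (W j k).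
Proof.
rewrite mxE; apply: eq_bigr => k _.
by rewrite mul_mx_diag !mxE.
Qed.

Lemma unitarymx_adj n (W : 'M[C]_n) : (W \is unitarymx) = (adj W *m W == 1%:M).
Proof.
rewrite qualifE /= adjE; apply/eqP/eqP => [|h]; first exact: mulmx1C.
exact: mulmx1C.
Qed.

Lemma normal_diag n (A : 'M[C]_n) : A *m adj A = adj A *m A ->
  exists W : 'M[C]_n, exists d : 'I_n -> C,
  adj W *m W = 1%:M /\ A = W *m diag_mx (\row_k d k) *m adj W.
Proof.
move=> An; have /orthomx_spectralP E : A \is normalmx by apply/normalmxP; rewrite -!adjE.
exists (adj (spectralmx A)), (fun k => spectral_diag A 0 k).
have := spectral_unitarymx A; rewrite unitarymx_adj => /eqP U.
have U' := mulmx1C U.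
rewrite !adjK; split; first exact: U'.
rewrite [LHS]E; congr (_ *m _ *m _).
  by rewrite invmx_unitary ?spectral_unitarymx // adjE.
by congr diag_mx; apply/rowP => k; rewrite mxE.
Qed.

Lemma hermitian_diag n (A : 'M[C]_n) : is_hermitian A ->
  exists W : 'M[C]_n, exists d : 'I_n -> R,
  adj W *m W = 1%:M /\ A = W *m diag_mx (\row_k cR (d k)) *m adj W.
Proof.
move=> hA; have [|W [d [W1 E]]] := @normal_diag n A; first by rewrite hA.
exists W, (fun k => complex.Re (d k)); split; first exact: W1.
rewrite [LHS]E; congr (_ *m _ *m _); congr diag_mx; apply/rowP => k; rewrite !mxE.
have D : diag_mx (\row_k d k) = adj W *m A *m W.
  by rewrite E !mulmxA W1 mul1mx -mulmxA W1 mulmx1.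
have : adj (diag_mx (\row_k d k)) = diag_mx (\row_k d k).
  by rewrite D !adjM hA adjK mulmxA.
move=> /matrixP /(_ k k); rewrite !mxE eqxx !mulr1n.
by case: (d k) => a b [] h; rewrite /cR /=; congr Complex; lra.
Qed.

(** Guarantees that the [xget] in [eigseq] does not return its default value. *)
Lemma eigseqP n (A : 'M[C]_n) : is_hermitian A ->
  sorted <=%R (eigseq A) /\ char_poly A = \prod_(x <- eigseq A) ('X - (cR x)%:P).
Proof.
move=> hA; have [W [d [W1 E]]] := hermitian_diag hA.
apply: (xgetPex [::] (P := [set s : seq R | sorted <=%R s /\
     char_poly A = \prod_(x <- s) ('X - (cR x)%:P)])).
exists (sort <=%R [seq d k | k <- enum 'I_n]); split.
  by apply: sort_sorted; exact: le_total.
rewrite E char_poly_conj // char_poly_trig; last exact/is_diag_mx_is_trig/diag_mx_is_diag.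
rewrite (perm_big [seq d k | k <- enum 'I_n]) /=; last by rewrite perm_sort.
rewrite big_map big_enum /=; apply: eq_bigr => k _.
by rewrite !mxE eqxx mulr1n.
Qed.

(** Uniqueness of the roots of a split polynomial makes [eigseq A] a permutation of the diagonal of
    any diagonalization; the columns of the unitary matrix are permuted accordingly, so that column
    [k] carries the [k]-th eigenvalue in sorted order. *)
Lemma lam_diag n (A : 'M[C]_n) : is_hermitian A ->
  exists W : 'M[C]_n, [/\
    adj W *m W = 1%:M,
    A = W *m diag_mx (\row_k cR (lam A k)) *m adj W,
    size (eigseq A) = n & sorted <=%R (eigseq A)].
Proof.
move=> hA; have [W [d [W1 E]]] := hermitian_diag hA.
have [srt cp] := eigseqP hA.
pose t : n.-tuple R := [tuple d k | k < n].
have pe : perm_eq (eigseq A) t.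
  apply: (perm_map_inj (@cR_inj R)); apply: prod_XsubC_eq.
  rewrite big_map -cp E char_poly_conj // char_poly_trig; last exact/is_diag_mx_is_trig/diag_mx_is_diag.
  rewrite big_map big_tuple; apply: eq_bigr => k _.
  by rewrite tnth_mktuple !mxE eqxx mulr1n.
have /tuple_permP [p pE] := pe.
have lamE (k : 'I_n) : lam A k = d (p k).
  by rewrite /lam pE -tnth_nth tnth_mktuple tnth_mktuple.
exists (col_perm p W); split => //.
- apply/matrixP => i j; rewrite mxE.
  have /matrixP /(_ (p i) (p j)) := W1; rewrite !mxE (inj_eq perm_inj) => <-.
  by apply: eq_bigr => k _; rewrite !mxE.
- apply/matrixP => i j; rewrite [in LHS]E !diag_conjE (reindex_inj (@perm_inj _ p)).
  by apply: eq_bigr => k _; rewrite lamE !mxE.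
- by rewrite (perm_size pe) size_tuple.
Qed.

Lemma quad_diag n (W : 'M[C]_n) (l : 'I_n -> R) (a : 'cV[C]_n) :
  adj W *m W = 1%:M ->
  complex.Re ((adj (W *m a) *m (W *m diag_mx (\row_k cR (l k)) *m adj W) *m (W *m a)) 0 0)
  = \sum_k l k * (complex.Re (a k 0) ^+ 2 + complex.Im (a k 0) ^+ 2).
Proof.
move=> W1; rewrite adjM -!mulmxA [adj W *m (W *m a)]mulmxA W1 mul1mx.
rewrite [adj W *m (W *m _)]mulmxA W1 mul1mx mxE Re_sum; apply: eq_bigr => k _.
rewrite mul_diag_mx !mxE mulrCA.
by case: (a k 0) => x y /=; ring.
Qed.

Lemma mn_quad n (D : 'M[C]_n) (x : 'cV[C]_n) :
  complex.Re ((adj x *m D *m x) 0 0) <=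
    2 * mn D * \sum_k (complex.Re (x k 0) ^+ 2 + complex.Im (x k 0) ^+ 2).
Proof.
set s := \sum_k _.
have xs k : cn (x k 0) ^+ 2 <= 2 * s.
  apply: (le_trans (cn_sq_le _)); rewrite ler_pM2l // /s (bigD1 k) //= lerDl.
  by apply: sumr_ge0 => i _; rewrite addr_ge0 ?sqr_ge0.
have xs2 k j : cn (x k 0) * cn (x j 0) <= 2 * s.
  have := xs k; have := xs j; have := sqr_ge0 (cn (x k 0) - cn (x j 0)); lra.
clearbody s; rewrite mulrAC mxE Re_sum.
apply: (@le_trans _ _ (\sum_j \sum_i cn (D i j) * (2 * s))).
  apply: ler_sum => j _; rewrite mxE mulr_suml Re_sum; apply: ler_sum => i _.
  apply: (le_trans (ler_norm _)); apply: (le_trans (Re_le_cn _)).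
  apply: (le_trans (cnM _ _)).
  apply: (@le_trans _ _ (cn (x i 0) * cn (D i j) * cn (x j 0))).
    apply: ler_wpM2r => //.
    apply: le_trans (cnM _ _) _.
    by rewrite !mxE cn_conj.
  rewrite mulrAC mulrC.
  by apply: ler_wpM2l => //.
rewrite exchange_big /= /mn mulr_sumr; apply: ler_sum => i _.
by rewrite mulr_sumr; apply: ler_sum => j _; rewrite mulrC.
Qed.

Lemma lam_nondecreasing n (A : 'M[C]_n) (i j : nat) : is_hermitian A ->
  (i <= j)%N -> (j < n)%N -> lam A i <= lam A j.
Proof.
move=> hA ij jn; have [W [_ _ sz srt]] := lam_diag hA.
apply: (sorted_leq_nth le_trans le_refl 0 srt) => //; rewrite inE sz //.
exact: leq_ltn_trans jn.
Qed.

(** Weyl's inequality by the Courant-Fischer argument: the eigenvectors of [A] of index at least [k]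
    and those of [B] of index at most [k] span spaces whose dimensions add up to n + 1. A common
    nonzero vector allows the two quadratic forms to be compared. *)
Lemma lam_le n (A B : 'M[C]_n) (k : 'I_n) : is_hermitian A -> is_hermitian B ->
  lam A k <= lam B k + 2 * mn (A - B).
Proof.
move=> hA hB.
have [W [W1 EA _ _]] := lam_diag hA.
have [V [V1 EB _ _]] := lam_diag hB.
have WU : W^T \in unitmx by rewrite unitmx_tr; have [] := mulmx1_unit W1.
have VU : V^T \in unitmx by rewrite unitmx_tr; have [] := mulmx1_unit V1.
(* Subspaces are row spaces, hence the transposes: [S] keeps the columns of [W] of index at least
   [k], [T] the columns of [V] of index at most [k]. *)
pose S := copid_mx k *m W^T; pose T : 'M[C]_n := pid_mx k.+1 *m V^T.
have rS : \rank S = (n - k)%N.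
  by rewrite mxrankMfree ?row_free_unit // rank_copid_mx // ltnW.
have rT : \rank T = k.+1.
  by rewrite mxrankMfree ?row_free_unit // rank_pid_mx.
have cap : (S :&: T)%MS != 0.
  rewrite -mxrank_eq0 -lt0n; have := mxrank_sum_cap S T; rewrite rS rT => E.
  have := rank_leq_col (S + T)%MS; have := ltn_ord k; lia.
have /rowV0Pn [z] := cap.
rewrite sub_capmx => /andP [/submxP [a aE] /submxP [b bE]] z0.
pose x : 'cV[C]_n := z^T.
pose a' := (a *m copid_mx k)^T; pose b' : 'cV[C]_n := (b *m pid_mx k.+1)^T.
have xa : x = W *m a' by rewrite /x /a' aE /S mulmxA trmx_mul trmxK.
have xb : x = V *m b' by rewrite /x /b' bE /T mulmxA trmx_mul trmxK.
have a0 (i : 'I_n) : (i < k)%N -> a' i 0 = 0.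
  move=> ik; rewrite !mxE big1 // => j _; rewrite !mxE -(inj_eq val_inj) /=.
  by case: eqVneq => [->|_]; rewrite ?ik /= subrr mulr0.
have b0 (i : 'I_n) : (k < i)%N -> b' i 0 = 0.
  move=> ik; rewrite !mxE big1 // => j _; rewrite !mxE.
  by case: eqVneq => [->|_]; rewrite /= 1?ltnS 1?leqNgt ?ik mulr0.
pose nq (y : 'cV[C]_n) : R := \sum_k (complex.Re (y k 0) ^+ 2 + complex.Im (y k 0) ^+ 2).
have nqV (V' : 'M[C]_n) y : adj V' *m V' = 1%:M -> nq (V' *m y) = nq y.
  move=> V'1; have := @quad_diag n V' (fun=> 1) y V'1.
  rewrite (_ : diag_mx _ = 1%:M); last first.
    by apply/matrixP => i j; rewrite !mxE.
  rewrite mulmx1 (mulmx1C V'1) mulmx1 mxE Re_sum => E.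
  transitivity (\sum_k 1 * (complex.Re (y k 0) ^+ 2 + complex.Im (y k 0) ^+ 2)); last first.
    by apply: eq_bigr => ? _; rewrite mul1r.
  rewrite -E; apply: eq_bigr => i _; rewrite -Rez_cn_sq mulrC.
  by rewrite [adj _ _ _]mxE [(map_mx _ _) _ _]mxE.
have sq_ge0 (y : 'cV[C]_n) i : 0 <= complex.Re (y i 0) ^+ 2 + complex.Im (y i 0) ^+ 2.
  by rewrite addr_ge0 ?sqr_ge0.
have xpos : 0 < nq x.
  rewrite lt_neqAle sumr_ge0 // andbT eq_sym; apply: contraNneq z0 => nx.
  apply/eqP/rowP => i; rewrite mxE.
  have /eqP : complex.Re (x i 0) ^+ 2 + complex.Im (x i 0) ^+ 2 = 0.
    by apply: (psumr_eq0P (P := xpredT) (fun j _ => sq_ge0 x j) nx).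
  rewrite paddr_eq0 ?sqr_ge0 // !sqrf_eq0 !mxE.
  by case: (z 0 i) => u v /= /andP [/eqP -> /eqP ->].
have lA : lam A k * nq x <= complex.Re ((adj x *m A *m x) 0 0).
  rewrite {1}xa nqV // [in leRHS]EA xa quad_diag // /nq mulr_sumr.
  apply: ler_sum => i _; have [ik|ki] := ltnP i k.
    by rewrite a0 //= expr0n /= addr0 !mulr0.
  by rewrite ler_wpM2r // lam_nondecreasing.
have lB : complex.Re ((adj x *m B *m x) 0 0) <= lam B k * nq x.
  rewrite [in leRHS]xb nqV // [in leLHS]EB xb quad_diag // /nq mulr_sumr.
  apply: ler_sum => i _; have [ki|ik] := ltnP k i.
    by rewrite b0 //= expr0n /= addr0 !mulr0.
  by rewrite ler_wpM2r // lam_nondecreasing.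
have := mn_quad (A - B) x.
rewrite mulmxBr mulmxBl mxE [X in complex.Re (_ + X)]mxE ReB -/(nq x) => lAB.
rewrite -(ler_pM2r xpos) mulrDl; apply: (le_trans lA).
rewrite -lerBlDl; apply: (le_trans _ lAB); rewrite lerD2l lerN2.
exact: lB.
Qed.

Lemma lam_lip n (A B : 'M[C]_n) (k : 'I_n) : is_hermitian A -> is_hermitian B ->
  `|lam A k - lam B k| <= 2 * mn (A - B).
Proof.
move=> hA hB; have := lam_le k hA hB; have := lam_le k hB hA.
rewrite (mnBC B A); move: (mn (A - B)) (lam A k) (lam B k) => d a b h1 h2.
by rewrite ler_distl; apply/andP; split; lra.
Qed.
End SpectralTheorem.

Section SpectralProjections.
Variable R : realType.
Variable n : nat.
Local Notation C := (complex R).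
Implicit Types (A B V X : 'M[C]_n) (k l : 'I_n) (S : {set 'I_n}).

(** An arbitrary choice, with no continuity in [A]. *)
Definition eigbasis A : 'M[C]_n :=
  xget 1%:M [set W : 'M[C]_n | adj W *m W = 1%:M /\
    A = W *m diag_mx (\row_k cR (lam A k)) *m adj W].

Lemma eigbasisP A : is_hermitian A -> adj (eigbasis A) *m eigbasis A = 1%:M /\
  A = eigbasis A *m diag_mx (\row_k cR (lam A k)) *m adj (eigbasis A).
Proof.
move=> hA; apply: (xgetPex 1%:M (P := [set W : 'M[C]_n | adj W *m W = 1%:M /\
    A = W *m diag_mx (\row_k cR (lam A k)) *m adj W])).
by have [W [h1 h2 _ _]] := lam_diag hA; exists W.
Qed.

(** At a multiple eigenvalue this depends on the chosen basis; only [specproj A S] with [S] isolated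
    is intrinsic. Locked so that unification does not unfold it. *)
Definition eigproj A k : 'M[C]_n := locked (eigbasis A *m delta_mx k k *m adj (eigbasis A)).
Definition specproj A S : 'M[C]_n := locked (\sum_(k in S) eigproj A k).

Lemma eigprojE A k : eigproj A k = eigbasis A *m delta_mx k k *m adj (eigbasis A).
Proof. by rewrite /eigproj -lock. Qed.
Lemma specprojE A S : specproj A S = \sum_(k in S) eigproj A k.
Proof. by rewrite /specproj -lock. Qed.

Definition isolated A S := forall k l, k \in S -> l \notin S -> lam A k != lam A l.

Variable A : 'M[C]_n.
Hypothesis hA : is_hermitian A.
Local Notation W := (eigbasis A).
Local Notation P := (eigproj A).

Lemma eigbasis_adjl : adj W *m W = 1%:M. Proof. by have [] := eigbasisP hA. Qed.
Lemma eigbasis_adjr : W *m adj W = 1%:M.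
Proof. exact/mulmx1C/eigbasis_adjl. Qed.

Lemma eigprojM k l : P k *m P l = if k == l then P k else 0.
Proof.
rewrite !eigprojE -!mulmxA [adj W *m (W *m _)]mulmxA eigbasis_adjl mul1mx.
rewrite [delta_mx k k *m _]mulmxA; case: eqP => [<-|/eqP kl].
  by rewrite mul_delta_mx.
by rewrite mul_delta_mx_cond (negPf kl) mulr0n mul0mx mulmx0.
Qed.

Lemma eigproj_sum : \sum_k P k = 1%:M.
Proof.
under eq_bigr do rewrite eigprojE.
rewrite -mulmx_suml -mulmx_sumr (_ : \sum_k delta_mx k k = 1%:M).
  by rewrite mulmx1 eigbasis_adjr.
apply/matrixP => i j; rewrite summxE (bigD1 i) //= big1 => [|k ki]; rewrite !mxE.
  by rewrite addr0 eqxx [j == i]eq_sym.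
by rewrite [i == k]eq_sym (negPf ki).
Qed.

Lemma eigproj_adj k : adj (P k) = P k.
Proof. by rewrite !eigprojE !adjM adjK adj_delta mulmxA. Qed.

Lemma eigproj_mul k : A *m P k = cR (lam A k) *: P k.
Proof.
have [W1 E] := eigbasisP hA; rewrite {1}E eigprojE -!mulmxA [adj W *m (W *m _)]mulmxA W1 mul1mx.
rewrite [diag_mx _ *m _]mulmxA scalemxAr; congr (_ *m _); rewrite scalemxAl; congr (_ *m _).
apply/matrixP => i j; rewrite mul_diag_mx !mxE.
by case: eqP => [->|_] //=; rewrite !mulr0.
Qed.

Lemma eigproj_mulr k : P k *m A = cR (lam A k) *: P k.
Proof. by rewrite -[LHS]adjK adjM eigproj_adj hA eigproj_mul adjZ eigproj_adj conj_cR. Qed.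

Lemma eigproj_tr k : \tr (P k) = 1.
Proof.
rewrite eigprojE mxtrace_mulC mulmxA eigbasis_adjl mul1mx.
rewrite /mxtrace (bigD1 k) //= big1 => [|i ik]; rewrite !mxE ?eqxx ?addr0 //.
by rewrite (negPf ik).
Qed.

Definition projbound : R := ((2 * n * n) * (2 * n * n))%:R.

Lemma projbound_ge0 : 0 <= projbound. Proof. by rewrite ler0n. Qed.

Lemma delta_mn (k l : 'I_n) : mn (delta_mx k l : 'M[C]_n) = 1.
Proof.
rewrite /mn (bigD1 k) //= (bigD1 l) //= !mxE !eqxx /= cn1.
rewrite big1 => [|j jl]; last by rewrite mxE (negPf jl) andbF cn0.
rewrite big1 ?addr0 // => i ik; rewrite big1 // => j _.
by rewrite mxE (negPf ik) cn0.
Qed.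

Lemma eigproj_mn k : mn (P k) <= projbound.
Proof.
have hW := mn_isometry eigbasis_adjl.
rewrite eigprojE; apply: (le_trans (mnM _ _)); rewrite mn_adj /projbound natrM.
apply: ler_pM => //; apply: (le_trans (mnM _ _)).
by rewrite delta_mn mulr1.
Qed.

Lemma eigproj_sandwich X k : P k *m X *m P k = \tr (P k *m X) *: P k.
Proof.
rewrite !eigprojE; set D := delta_mx k k : 'M[C]_n.
have -> : W *m D *m adj W *m X *m (W *m D *m adj W) = W *m (D *m (adj W *m X *m W) *m D) *m adj W.
  by rewrite !mulmxA.
have -> : \tr (W *m D *m adj W *m X) = \tr (D *m (adj W *m X *m W)).
  by rewrite -!mulmxA mxtrace_mulC !mulmxA.
set Y := adj W *m X *m W.
have DYD : D *m Y *m D = \tr (D *m Y) *: D.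
  apply/matrixP => i j; rewrite !mxE.
  have trE : \tr (D *m Y) = Y k k.
    rewrite /mxtrace (bigD1 k) //= big1 => [|u uk]; rewrite !mxE.
      by rewrite (bigD1 k) //= big1 => [|v vk]; rewrite !mxE ?eqxx ?mul1r ?addr0 // (negPf vk) andbF mul0r.
    by rewrite big1 // => v _; rewrite !mxE (negPf uk) mul0r.
  rewrite trE (bigD1 k) //= big1 ?addr0 => [|v vk]; last by rewrite [D v j]mxE (negPf vk) mulr0.
  rewrite [D k j]mxE [(D *m Y) i k]mxE eqxx /= (bigD1 k) //= big1 ?addr0 => [|v vk]; last by rewrite mxE (negPf vk) andbF mul0r.
  rewrite mxE eqxx andbT.
  by case: (i == k); case: (j == k); rewrite ?mul1r ?mulr1 ?mul0r ?mulr0.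
by rewrite DYD -scalemxAr -scalemxAl.
Qed.

Section SpecSet.
Variable S : {set 'I_n}.
Local Notation Q := (specproj A S).

Lemma specprojl l : P l *m Q = if l \in S then P l else 0.
Proof.
rewrite specprojE mulmx_sumr; case: ifP => lS.
  rewrite (bigD1 l) //= eigprojM eqxx big1 ?addr0 // => k /andP [_ kl].
  by rewrite eigprojM eq_sym (negPf kl).
rewrite big1 // => k kS; rewrite eigprojM; case: eqP => // lk.
by rewrite lk kS in lS.
Qed.

Lemma specproj_adj : adj Q = Q.
Proof. by rewrite specprojE adj_sum; apply: eq_bigr => k _; rewrite eigproj_adj. Qed.

Lemma specprojr l : Q *m P l = if l \in S then P l else 0.
Proof.
rewrite -[LHS]adjK adjM specproj_adj eigproj_adj specprojl.
by case: ifP; rewrite ?adj0 ?eigproj_adj.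
Qed.

Lemma specproj_idem : Q *m Q = Q.
Proof. by rewrite {1 3}specprojE mulmx_suml; apply: eq_bigr => k kS; rewrite specprojl kS. Qed.

Lemma specproj_comm : A *m Q = Q *m A.
Proof.
rewrite specprojE mulmx_suml mulmx_sumr; apply: eq_bigr => k _.
by rewrite eigproj_mul eigproj_mulr.
Qed.

Lemma specprojC : 1%:M - Q = specproj A (~: S).
Proof.
rewrite -eigproj_sum !specprojE (bigID (mem S)) /= addrAC subrr add0r.
by apply: eq_bigl => k; rewrite inE.
Qed.

Lemma specproj_tr : \tr Q = #|S|%:R.
Proof.
rewrite specprojE raddf_sum /= -sum1_card natr_sum; apply: eq_bigr => k _.
exact: eigproj_tr.
Qed.

End SpecSet.

Lemma mx_blocks X : X = \sum_l \sum_k P l *m X *m P k.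
Proof.
rewrite -{1}[X]mul1mx -{1}[1%:M *m X]mulmx1 -eigproj_sum !mulmx_suml.
by apply: eq_bigr => l _; rewrite mulmx_sumr.
Qed.

Lemma gap_exists : exists2 g : R, 0 < g &
  forall k l, lam A k != lam A l -> g <= `|lam A k - lam A l|.
Proof.
pose F (p : 'I_n * 'I_n) : R := `|lam A p.1 - lam A p.2|.
(* The initial value 1 covers the case where all eigenvalues coincide. *)
exists (\big[Num.min/1]_(p : 'I_n * 'I_n | lam A p.1 != lam A p.2) F p).
  by apply: lt_bigmin => // p h; rewrite normr_gt0 subr_eq0.
by move=> k l kl; rewrite (bigD1 (k, l)) //= ge_min lexx.
Qed.

End SpectralProjections.

(** * Perturbation of spectral projections *)

Section Perturbation.
Variable R : realType.
Variable n : nat.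
Local Notation C := (complex R).
Variable A : 'M[C]_n.
Hypothesis hA : is_hermitian A.
Implicit Types (B V X : 'M[C]_n) (k l : 'I_n).
Local Notation P := (eigproj A).
Variable S : {set 'I_n}.
Hypothesis iS : isolated A S.
Local Notation Q := (specproj A S).

Lemma eigproj_cross B k l : is_hermitian B ->
  P l *m (B - A) *m eigproj B k = cR (lam B k - lam A l) *: (P l *m eigproj B k).
Proof.
move=> hB; rewrite mulmxBr mulmxBl -mulmxA (eigproj_mul hB) (eigproj_mulr hA).
by rewrite -scalemxAr -scalemxAl cRB scalerBl.
Qed.

Lemma sum_card_le (T : {set 'I_n}) (c : R) : 0 <= c -> \sum_(l in T) c <= n%:R * c.
Proof.
move=> c0; rewrite sumr_const -[leLHS]mulr_natl; apply: ler_wpM2r => //.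
by rewrite ler_nat -[X in (_ <= X)%N]card_ord max_card.
Qed.

Lemma gap_half (a b c g d : R) : g <= a -> b <= 2 * d -> d < g / 4 -> a <= b + c -> g / 2 <= c.
Proof. by move=> *; lra. Qed.

Lemma proj_sub (Q1 Q2 Qc1 Qc2 : 'M[C]_n) : 1%:M - Q1 = Qc1 -> 1%:M - Q2 = Qc2 ->
  Q2 - Q1 = Qc1 *m Q2 - Q1 *m Qc2.
Proof. by move=> <- <-; rewrite mulmxBl mulmxBr mul1mx mulmx1 opprB addrA subrK. Qed.

(** No resolvent is involved: the difference of the two projections is a sum of cross terms
    [P l *m eigproj B k] between [S] and its complement, and by [eigproj_cross] such a term is
    [P l *m (B - A) *m eigproj B k] divided by an eigenvalue difference. *)
Lemma specproj_lip : exists c e : R, [/\ 0 < c, 0 < e & forall B,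
  is_hermitian B -> mn (B - A) < e ->
  mn (specproj B S - Q) <= c * mn (B - A)].
Proof.
have [g g0 gP] := gap_exists A.
move pE : (projbound R n) => p.
have p0 : 0 <= p by rewrite -pE projbound_ge0.
pose c0 := 2 / g * (p * p).
have c00 : 0 <= c0 by rewrite /c0 !mulr_ge0 ?invr_ge0 // ltW.
(* Within g / 4 of [A] each eigenvalue moves by less than g / 2, so the divisors of the cross terms
   stay above g / 2. The added 1 makes the constant positive. *)
exists (n%:R * (n%:R * c0) + n%:R * (n%:R * c0) + 1), (g / 4); split; rewrite ?divr_gt0 //.
  by rewrite ltr_wpDl // addr_ge0 // mulr_ge0 ?ler0n // mulr_ge0 ?ler0n.
move=> B hB; move dE : (mn (B - A)) => d dg.
have d0 : 0 <= d by rewrite -dE.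
have cross k l : lam A k != lam A l -> mn (P l *m eigproj B k) <= c0 * d.
  move=> kl; have h3 : g / 2 <= `|lam B k - lam A l|.
    apply: (gap_half (gP _ _ kl) _ dg (b := `|lam B k - lam A k|)); first by rewrite -dE; exact: lam_lip.
    rewrite [`|lam B k - lam A k|]distrC.
    by have := ler_normD (lam A k - lam B k) (lam B k - lam A l); rewrite addrA subrK.
  have h4 : `|lam B k - lam A l| * mn (P l *m eigproj B k) <= p * p * d.
    rewrite -mn_cR -eigproj_cross //; apply: (le_trans (mnM _ _)).
    apply: (@le_trans _ _ (p * d * p)); last by rewrite mulrAC.
    apply: ler_pM => //; last by rewrite -pE; exact: eigproj_mn.
    apply: (le_trans (mnM _ _)); rewrite dE; apply: ler_pM => //; by rewrite -pE; exact: eigproj_mn.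
  have h5 : g / 2 * mn (P l *m eigproj B k) <= p * p * d.
    by apply: (le_trans _ h4); apply: ler_wpM2r.
  rewrite mulrC -ler_pdivlMr in h5; last by rewrite divr_gt0.
  by apply: (le_trans h5); rewrite /c0 invf_div mulrC mulrA.
clearbody c0.
have dec : specproj B S - Q = \sum_(l in ~: S) \sum_(k in S) P l *m eigproj B k
    - \sum_(l in S) \sum_(k in ~: S) P l *m eigproj B k.
  rewrite (proj_sub (specprojC hA S) (specprojC hB S)) 4!specprojE !mulmx_suml.
  by congr (_ - _); apply: eq_bigr => l _; rewrite mulmx_sumr.
have bd (S1 S2 : {set 'I_n}) : (forall k l, k \in S2 -> l \in S1 -> lam A k != lam A l) ->
    mn (\sum_(l in S1) \sum_(k in S2) P l *m eigproj B k) <= n%:R * (n%:R * (c0 * d)).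
  move=> h; have cd0 : 0 <= c0 * d by exact: mulr_ge0.
  apply: (le_trans (mn_sum _ _ _)).
  apply: (le_trans (ler_sum _ (G := fun=> n%:R * (c0 * d)) _)); last first.
    by apply: sum_card_le; rewrite mulr_ge0.
  move=> l lS; apply: (le_trans (mn_sum _ _ _)).
  apply: (le_trans (ler_sum _ (G := fun=> c0 * d) _)); last exact: sum_card_le.
  by move=> k kS; apply: cross; apply: h.
rewrite dec; apply: (le_trans (mnB _ _)).
rewrite !mulrDl mul1r -!mulrA.
apply: ler_wpDr => //.
apply: lerD; apply: bd => k l; rewrite !inE => h1 h2; first exact: iS.
by rewrite eq_sym; apply: iS.
Qed.

(* Kato's generator of the transport of spectral projections; [0^-1 = 0] discards the
   resonant blocks. *)
Definition kato V : 'M[C]_n :=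
  \sum_(l < n) \sum_(k < n) cR (lam A l - lam A k)^-1 *: (P l *m V *m P k).
Definition resonant V : 'M[C]_n :=
  \sum_(l < n) \sum_(k < n | lam A l == lam A k) P l *m V *m P k.

Lemma comm_block l k V : A *m (P l *m V *m P k) - (P l *m V *m P k) *m A =
  cR (lam A l - lam A k) *: (P l *m V *m P k).
Proof.
rewrite !mulmxA (eigproj_mul hA) -[X in _ - X]mulmxA (eigproj_mulr hA).
by rewrite -!scalemxAl -scalemxAr cRB scalerBl.
Qed.

Lemma kato_comm V : A *m kato V - kato V *m A = V - resonant V.
Proof.
rewrite [X in _ = X - _](mx_blocks hA V) /kato /resonant mulmx_sumr mulmx_suml -!sumrB.
apply: eq_bigr => l _; rewrite mulmx_sumr mulmx_suml -sumrB.
rewrite [X in _ = X - _](bigID (fun k : 'I_n => lam A l == lam A k)) /= addrAC subrr add0r.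
rewrite [RHS]big_mkcond; apply: eq_bigr => k _ /=.
rewrite -scalemxAr -scalemxAl -scalerBr comm_block scalerA -cRM.
case: eqP => [->|/eqP h] /=; first by rewrite subrr mulr0 scale0r.
by rewrite mulVf ?scale1r // subr_eq0.
Qed.

Lemma resonant_specproj V : Q *m resonant V = resonant V *m Q.
Proof.
rewrite mulmx_sumr mulmx_suml; apply: eq_bigr => l _.
rewrite mulmx_sumr mulmx_suml; apply: eq_bigr => k /eqP lk.
rewrite !mulmxA (specprojr hA) -[RHS]mulmxA (specprojl hA).
case: ifP => lS; case: ifP => kS //; rewrite ?mul0mx ?mulmx0 //.
  by have := iS lS (negbT kS); rewrite lk eqxx.
by have := iS kS (negbT lS); rewrite lk eqxx.
Qed.

(** Bracketing the candidate remainder with [A] cancels every first-order term: commutation of [B]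
    with [Q'] supplies the bracket of [A] with [Z], and the equation for [K] supplies the rest. What
    is left is quadratic, which controls the nonresonant blocks of the remainder. *)
Lemma transport_comm (Q1 Q' K V D B Z : 'M[C]_n) : B = A + V -> Q' = Q1 + Z ->
  A *m Q1 = Q1 *m A -> B *m Q' = Q' *m B -> A *m K - K *m A = V - D ->
  Q1 *m D = D *m Q1 ->
  A *m (Z + (K *m Q1 - Q1 *m K)) - (Z + (K *m Q1 - Q1 *m K)) *m A = Z *m V - V *m Z.
Proof.
move=> BE QE AQ BQ AK QD.
have AK' : A *m K = K *m A + V - D by rewrite -addrA -AK addrC subrK.
have AZ : A *m Z = Q1 *m V + Z *m A + Z *m V - V *m Q1 - V *m Z.
  rewrite BE QE !mxdistr AQ in BQ.
  have -> : A *m Z = (Q1 *m A + A *m Z + (V *m Q1 + V *m Z)) - Q1 *m A - V *m Q1 - V *m Z by mxadd.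
  by rewrite BQ; mxadd.
rewrite !mxdistr.
rewrite AZ !mulmxA AK' AQ !mxdistr.
rewrite -[K *m Q1 *m A]mulmxA -[Q1 *m A *m K]mulmxA AK' -AQ.
by rewrite !mxdistr !mulmxA QD; mxadd.
Qed.

(** Idempotency of both projections makes the diagonal blocks of [Z] quadratic. This handles the
    resonant blocks, to which the bracket with [A] is blind. *)
Lemma proj_blocks (Pl Pk Q1 Q' Z : 'M[C]_n) : Q1 *m Q1 = Q1 -> Q' *m Q' = Q' -> Q' = Q1 + Z ->
  (Pl *m Q1 = Pl /\ Q1 *m Pk = Pk -> Pl *m Z *m Pk = - (Pl *m (Z *m Z) *m Pk)) /\
  (Pl *m Q1 = 0 /\ Q1 *m Pk = 0 -> Pl *m Z *m Pk = Pl *m (Z *m Z) *m Pk).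
Proof.
move=> QQ QQ' QE; have ZE : Z = Q1 *m Z + Z *m Q1 + Z *m Z.
  rewrite QE !mxdistr QQ in QQ'.
  transitivity ((Q1 + Z) - Q1); first by mxadd.
  by rewrite -{1}QQ'; mxadd.
have E : Pl *m Z *m Pk = Pl *m Q1 *m Z *m Pk + Pl *m Z *m (Q1 *m Pk) + Pl *m (Z *m Z) *m Pk.
  by rewrite {1}ZE !mxdistr !mulmxA.
split=> -[h1 h2]; rewrite h1 h2 in E; last by rewrite E mulmx0 !mul0mx !add0r.
have -> : Pl *m Z *m Pk = (Pl *m Z *m Pk + Pl *m Z *m Pk + Pl *m (Z *m Z) *m Pk) - Pl *m Z *m Pk - Pl *m (Z *m Z) *m Pk by mxadd.
by rewrite -E; mxadd.
Qed.

(** The first-order motion of the projection is its commutator with [kato]; the remainder is bounded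
    block by block in the eigenbasis of [A]. *)
Lemma specproj_kato : exists c e : R, [/\ 0 < c, 0 < e & forall B,
  is_hermitian B -> mn (B - A) < e ->
  mn (specproj B S - Q + (kato (B - A) *m Q - Q *m kato (B - A))) <= c * mn (B - A) ^+ 2].
Proof.
have [g g0 gP] := gap_exists A.
have [c [e [c0 e0 lip]]] := specproj_lip.
move pE : (projbound R n) => p.
have p0 : 0 <= p by rewrite -pE projbound_ge0.
(* The first summand is for nonresonant blocks, where one divides by the gap; the second is for
   resonant ones, where isolation puts both indices in [S] or both outside. *)
pose b := g^-1 * (p * p * 2 * c) + p * p * c ^+ 2.
have b1 : 0 <= g^-1 * (p * p * 2 * c) by rewrite !mulr_ge0 ?invr_ge0 // ltW.
have b2 : 0 <= p * p * c ^+ 2 by rewrite !mulr_ge0 ?exprn_ge0 // ltW.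
have b0 : 0 <= b by exact: addr_ge0.
exists (n%:R * (n%:R * b) + 1), e; split => //.
  by rewrite ltr_wpDl // !mulr_ge0.
move=> B hB he; have {lip he} := lip _ hB he.
have [Z ZE] : exists Z, Z = specproj B S - Q by eexists.
have [V VE] : exists V, V = B - A by eexists.
rewrite -ZE -VE; move dE : (mn V) => d hZ.
have d0 : 0 <= d by rewrite -dE.
have [Rm RmE] : exists Rm, Rm = Z + (kato V *m Q - Q *m kato V) by eexists.
rewrite -RmE.
have Q'E : specproj B S = Q + Z by rewrite ZE addrC subrK.
have BE : B = A + V by rewrite VE addrC subrK.
have AR : A *m Rm - Rm *m A = Z *m V - V *m Z.
  rewrite RmE; apply: (transport_comm BE Q'E (specproj_comm hA S) _ (kato_comm V) (resonant_specproj V)).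
  exact: specproj_comm.
have blocks l k := proj_blocks (P l) (P k) (specproj_idem hA S) (specproj_idem hB S) Q'E.
have mZ2 : mn (Z *m Z) <= c ^+ 2 * d ^+ 2.
  by apply: (le_trans (mnM _ _)); rewrite -exprMn expr2; apply: ler_pM.
have Pmn k : mn (P k) <= p by rewrite -pE; exact: eigproj_mn.
have sand X y l k : mn X <= y -> mn (P l *m X *m P k) <= p * y * p.
  move=> Xy; apply: (le_trans (mnM _ _)); apply: ler_pM => //.
  by apply: (le_trans (mnM _ _)); apply: ler_pM.
have mPZ l k : mn (P l *m (Z *m Z) *m P k) <= p * p * c ^+ 2 * d ^+ 2.
  apply: (le_trans (sand _ _ l k mZ2)).
  by rewrite le_eqVlt; apply/orP; left; apply/eqP; ring.
have blk l k : mn (P l *m Rm *m P k) <= b * d ^+ 2.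
  rewrite /b mulrDl.
  have [lk|lk] := eqVneq (lam A l) (lam A k); last first.
    apply: ler_wpDr; first by rewrite mulr_ge0 // exprn_ge0.
    rewrite -mulrA mulrC ler_pdivlMr // mulrC.
    apply: (@le_trans _ _ (`|lam A l - lam A k| * mn (P l *m Rm *m P k))).
      by apply: ler_wpM2r => //; apply: gP.
    rewrite -mn_cR -comm_block.
    have -> : A *m (P l *m Rm *m P k) - P l *m Rm *m P k *m A = P l *m (Z *m V - V *m Z) *m P k.
      have Pl : A *m P l = P l *m A by rewrite (eigproj_mul hA) (eigproj_mulr hA).
      have Pk : A *m P k = P k *m A by rewrite (eigproj_mul hA) (eigproj_mulr hA).
      by rewrite -AR mulmxBr mulmxBl !mulmxA Pl -[_ *m P k *m A]mulmxA -Pk !mulmxA.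
    apply: (@le_trans _ _ (p * (c * d * d + c * d * d) * p)); last first.
      by rewrite le_eqVlt; apply/orP; left; apply/eqP; ring.
    apply: sand; apply: (le_trans (mnB _ _)); apply: lerD; apply: (le_trans (mnM _ _)).
      by rewrite dE; apply: ler_pM.
    by rewrite dE mulrC; apply: ler_pM.
  apply: ler_wpDl; first by rewrite mulr_ge0 // exprn_ge0.
  have RZ : forall X, P l *m Rm *m P k = P l *m Z *m P k + (P l *m kato V *m (Q *m P k) - P l *m Q *m kato V *m P k).
    by move=> _; rewrite RmE !mxdistr !mulmxA.
  rewrite (RZ 0); have [lS|lS] := boolP (l \in S).
    have kS : k \in S by apply: contraT => kS; have := iS lS kS; rewrite lk eqxx.
    have Pl : P l *m Q = P l by rewrite (specprojl hA) lS.
    have Pk : Q *m P k = P k by rewrite (specprojr hA) kS.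
    by rewrite Pl Pk subrr addr0 ((blocks l k).1 (conj Pl Pk)) mnN.
  have kS : k \notin S by apply/negP => kS; have := iS kS lS; rewrite lk eqxx.
  have Pl : P l *m Q = 0 by rewrite (specprojl hA) (negPf lS).
  have Pk : Q *m P k = 0 by rewrite (specprojr hA) (negPf kS).
  by rewrite Pl Pk mulmx0 !mul0mx subrr addr0 ((blocks l k).2 (conj Pl Pk)).
rewrite [Rm](mx_blocks hA) mulrDl mul1r; apply: ler_wpDr; first exact: exprn_ge0.
apply: (le_trans (mn_sum _ _ _)).
apply: (le_trans (ler_sum _ (G := fun=> n%:R * (b * d ^+ 2)) _)); last first.
  by rewrite sumr_const card_ord -[leLHS]mulr_natl !mulrA.
move=> l _; apply: (le_trans (mn_sum _ _ _)).
apply: (le_trans (ler_sum _ (G := fun=> b * d ^+ 2) _)) => //.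
by rewrite sumr_const card_ord -[leLHS]mulr_natl.
Qed.
End Perturbation.

(** * Lie algebras containing a Hermitian matrix *)

Section Subspaces.
Variable K : fieldType.

Definition subspace N (g : set 'rV[K]_N) :=
  [/\ g 0, (forall x y, g x -> g y -> g (x + y)) & (forall a x, g x -> g (a *: x))].

(** A matrix of maximal rank among those whose row space lies in [g] must exhaust it, since an
    element outside would raise the rank. *)
Lemma subspace_rowspace N (g : set 'rV[K]_N) : subspace g ->
  exists G : 'M[K]_N, forall x, g x <-> (x <= G)%MS.
Proof.
move=> [g0 gD gZ].
pose p r := `[< exists G : 'M[K]_N, \rank G = r /\ forall x : 'rV_N, (x <= G)%MS -> g x >].
have p0 : exists r, p r.
  exists 0%N; apply/asboolP; exists 0; rewrite mxrank0; split => // x.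
  by rewrite submx0 => /eqP ->.
have pN r : p r -> (r <= N)%N by move=> /asboolP [G [<- _]]; exact: rank_leq_col.
case: (ex_maxnP p0 pN) => r /asboolP [G [Gr Gg]] maxr.
exists G => x; split; last exact: Gg.
move=> gx; apply: contraT => xG.
have lt : (G < G + x)%MS.
  by rewrite /ltmx addsmxSl /=; apply: contra xG; apply: submx_trans; exact: addsmxSr.
have : p (\rank (G + x)%MS).
  apply/asboolP; exists (G + x)%MS; split => // y /sub_addsmxP [[u v] /= ->].
  apply: gD; first by apply: Gg; exact: submxMl.
  by rewrite [v]mx11_scalar mul_scalar_mx; apply: gZ.
by move=> /maxr; rewrite leqNgt -Gr rank_ltmx.
Qed.
End Subspaces.

(** * Orthogonal projections off invariant subspaces *)

Section OrthogonalProjection.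
Variable R : realType.
Local Notation C := (complex R).

Lemma frobE p q (M : 'M[C]_(p, q)) :
  complex.Re (\tr (M *m adj M)) = \sum_i \sum_j (complex.Re (M i j) ^+ 2 + complex.Im (M i j) ^+ 2).
Proof.
rewrite Re_sum; apply: eq_bigr => i _; rewrite mxE Re_sum; apply: eq_bigr => j _.
by rewrite !mxE Rez_cn_sq.
Qed.

Lemma frob_eq0 p q (M : 'M[C]_(p, q)) : complex.Re (\tr (M *m adj M)) = 0 -> M = 0.
Proof.
rewrite frobE => E; apply/matrixP => i j; rewrite mxE.
have h k l : 0 <= complex.Re (M k l) ^+ 2 + complex.Im (M k l) ^+ 2 by rewrite addr_ge0 ?sqr_ge0.
have E1 : \sum_j (complex.Re (M i j) ^+ 2 + complex.Im (M i j) ^+ 2) = 0.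
  apply: (psumr_eq0P (P := xpredT) _ E) => // k _; exact: sumr_ge0.
have /eqP : complex.Re (M i j) ^+ 2 + complex.Im (M i j) ^+ 2 = 0.
  by apply: (psumr_eq0P (P := xpredT) (fun j _ => h i j) E1).
rewrite paddr_eq0 ?sqr_ge0 // !sqrf_eq0.
by case: (M i j) => a b /= /andP [/eqP -> /eqP ->].
Qed.

Lemma mul_adj_eq0 p q (M : 'M[C]_(p, q)) : M *m adj M = 0 -> M = 0.
Proof. by move=> E; apply: frob_eq0; rewrite E mxtrace0. Qed.

Lemma gram_unit r N (G : 'M[C]_(r, N)) : row_free G -> G *m adj G \in unitmx.
Proof.
move=> fG; rewrite -row_free_unit -kermx_eq0; apply/rowV0P => x /sub_kermxP.
move=> E; have : (x *m G) *m adj (x *m G) = 0 by rewrite adjM mulmxA -[x *m G *m _]mulmxA E mul0mx.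
by move=> /mul_adj_eq0 /eqP; rewrite mulmx_free_eq0 // => /eqP.
Qed.

(** For a row basis [G] of the subspace, the orthogonal projection onto it is [adj G *m Gi *m G]
    with [Gi] the inverse Gram matrix. A skew [M] that preserves the subspace also preserves its
    orthogonal complement, hence commutes with the projections; in matrices, this is the adjoint of
    the relation expressing invariance. *)
Lemma ortho_complement_proj N (g : set 'rV[C]_N) : subspace g ->
  exists Pi : 'M[C]_N, (forall x, g x <-> x *m Pi = 0) /\
  forall M : 'M[C]_N, adj M = - M -> (forall x, g x -> g (x *m M)) -> M *m Pi = Pi *m M.
Proof.
move=> /subspace_rowspace [G0 G0P].
pose G := row_base G0; have fG : row_free G by exact: row_base_free.
have GP x : g x <-> (x <= G)%MS by rewrite G0P eq_row_base.
have [Gi [GiA GiG GGi]] : exists Gi, [/\ adj Gi = Gi, Gi *m (G *m adj G) = 1%:M &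
    G *m adj G *m Gi = 1%:M].
  have U := gram_unit fG; exists (invmx (G *m adj G)); split; rewrite ?mulVmx ?mulmxV //.
  have E : adj (invmx (G *m adj G)) *m (G *m adj G) = 1%:M.
    have GA : adj (G *m adj G) = G *m adj G by rewrite adjM adjK.
    by rewrite -[X in _ *m X]GA -adjM mulmxV // adj1.
  by rewrite -[LHS]mulmx1 -(mulmxV U) mulmxA E mul1mx.
move: G fG GP Gi GiA GiG GGi => G fG GP Gi GiA GiG GGi.
pose P0 := adj G *m Gi *m G.
have P0_adj : adj P0 = P0 by rewrite /P0 !adjM adjK GiA mulmxA.
have GP0 : G *m P0 = G by rewrite /P0 !mulmxA GGi mul1mx.
exists (1%:M - P0); split.
  move=> x; rewrite GP mulmxBr mulmx1; split.
    by case/submxP => y ->; rewrite -mulmxA GP0 subrr.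
  by move/eqP; rewrite subr_eq0 => /eqP ->; rewrite /P0 mulmxA submxMl.
move=> M Madj Mg; rewrite mulmxBr mulmxBl mul1mx mulmx1; congr (_ - _).
have [Kx KE] : exists Kx, G *m M = Kx *m G.
  have : (G *m M <= G)%MS.
    by apply/row_subP => i; rewrite row_mul -GP; apply: Mg; rewrite GP row_sub.
  by case/submxP => Kx ->; exists Kx.
have P0M : P0 *m M = P0 *m M *m P0.
  by rewrite {1 2}/P0 -!mulmxA [G *m (M *m _)]mulmxA KE -[in RHS]mulmxA GP0.
clearbody P0.
have MP0 : M *m P0 = P0 *m M *m P0.
  have := congr1 (@adj R _ _) P0M; rewrite !adjM P0_adj Madj !(mulNmx, mulmxN) mulmxA.
  by move=> /oppr_inj.
by rewrite MP0 -P0M.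
Qed.
End OrthogonalProjection.

(** * Functions of ad A inside a complex Lie algebra *)

Section FunctionalCalculus.
Variable R : realType.
Variable n : nat.
Local Notation C := (complex R).

Definition complex_lie (g : set 'M[C]_n) :=
  [/\ g 0, (forall X Y, g X -> g Y -> g (X + Y)), (forall a X, g X -> g (a *: X)) &
      (forall X Y, g X -> g Y -> g (X *m Y - Y *m X))].

Lemma lagrange (T : fieldType) (s : seq T) (h : T -> T) : exists p : {poly T}, forall x, x \in s -> p.[x] = h x.
Proof.
elim: s => [|a s [p pP]]; first by exists 0.
have [as_|as_] := boolP (a \in s).
  by exists p => x; rewrite inE => /orP [/eqP ->|]; exact: pP.
pose q := \prod_(b <- s) ('X - b%:P).
have qa : q.[a] != 0 by rewrite -rootE root_prod_XsubC.
exists (p + ((h a - p.[a]) / q.[a])%:P * q) => x.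
rewrite inE !hornerE => /orP [/eqP ->|xs]; first by rewrite divfK // addrC subrK.
have /eqP -> : q.[x] == 0 by rewrite -rootE root_prod_XsubC.
by rewrite mulr0 addr0 pP.
Qed.

Variable g : set 'M[C]_n.
Hypothesis gL : complex_lie g.

Lemma complex_lie_sum (I : Type) (s : seq I) (Q : pred I) (F : I -> 'M[C]_n) :
  (forall i, Q i -> g (F i)) -> g (\sum_(i <- s | Q i) F i).
Proof. by case: gL => g0 gD _ _ h; elim/big_ind: _. Qed.

Lemma complex_lieB X Y : g X -> g Y -> g (X - Y).
Proof. by case: gL => _ gD gZ _ gX gY; apply: gD => //; rewrite -scaleN1r; apply: gZ. Qed.

Variable A : 'M[C]_n.
Hypothesis hA : is_hermitian A.
Hypothesis gA : g A.
Local Notation P := (eigproj A).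

(** The bracket with [A] multiplies the block [P l *m V *m P k] by the eigenvalue difference, so
    p(ad A) acts on it by the value of p there; induction in Horner form keeps the result in [g]. *)
Lemma ad_poly V (p : {poly C}) : g V ->
  g (\sum_(l < n) \sum_(k < n) p.[cR (lam A l - lam A k)] *: (P l *m V *m P k)).
Proof.
case: gL => g0 gD gZ gB; elim/poly_ind: p V => [|p c IH] V gV.
  rewrite (_ : \sum_l _ = 0) // big1 // => l _; rewrite big1 // => k _.
  by rewrite horner0 scale0r.
pose V' := A *m V - V *m A.
have := gD _ _ (IH V' (gB _ _ gA gV)) (gZ c _ gV); congr (g _).
rewrite [X in _ + c *: X = _](mx_blocks hA V) scaler_sumr -big_split /=; apply: eq_bigr => l _.
rewrite scaler_sumr -big_split /=; apply: eq_bigr => k _.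
have -> : P l *m V' *m P k = cR (lam A l - lam A k) *: (P l *m V *m P k).
  rewrite /V' mulmxBr mulmxBl !mulmxA (eigproj_mulr hA) -[_ *m A *m P k]mulmxA (eigproj_mul hA).
  by rewrite -!scalemxAl -scalemxAr cRB scalerBl.
by rewrite !hornerE scalerA -scalerDl.
Qed.

(** There are finitely many eigenvalue differences, so any function of them is interpolated by a
    polynomial. *)
Lemma ad_fun V (h : R -> C) : g V ->
  g (\sum_(l < n) \sum_(k < n) h (lam A l - lam A k) *: (P l *m V *m P k)).
Proof.
move=> gV.
pose s := [seq cR (lam A (nat_of_ord p.1) - lam A (nat_of_ord p.2)) | p <- enum (('I_n * 'I_n)%type : finType)].
have [p pP] := lagrange s (fun z => h (complex.Re z)).
have := ad_poly p gV; congr (g _).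
apply: eq_bigr => l _; apply: eq_bigr => k _; rewrite pP //.
by apply/mapP; exists (l, k); rewrite ?mem_enum.
Qed.

Lemma kato_in V : g V -> g (kato A V).
Proof. exact: (ad_fun (fun x => cR x^-1)). Qed.

Lemma resonant_in V : g V -> g (resonant A V).
Proof.
move=> gV; have := ad_fun (fun x => if x == 0 then 1 else 0) gV; congr (g _).
apply: eq_bigr => l _; rewrite [RHS]big_mkcond; apply: eq_bigr => k _ /=.
by rewrite subr_eq0; case: eqP; rewrite ?scale1r ?scale0r.
Qed.

Lemma kato_adj V : adj V = V -> adj (kato A V) = - kato A V.
Proof.
move=> hV; rewrite adj_sum -sumrN.
under eq_bigr => l _ do rewrite adj_sum.
rewrite exchange_big /=; apply: eq_bigr => k _; rewrite -sumrN; apply: eq_bigr => l _.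
rewrite adjZ conj_cR !adjM hV !eigproj_adj mulmxA -scaleNr -cRN.
by rewrite -[X in _ = cR X *: _]invrN opprB.
Qed.
End FunctionalCalculus.

(** * Transport of spectral planes *)

Section Superoperators.
Variable R : realType.
Variable n : nat.
Local Notation C := (complex R).
Implicit Types (Q X Y K : 'M[C]_n).

Lemma trB p (A B : 'M[C]_p) : \tr (A - B) = \tr A - \tr B.
Proof. exact: linearB. Qed.
Lemma trN p (A : 'M[C]_p) : \tr (- A) = - \tr A.
Proof. exact: linearN. Qed.

(* The projection of gl(n) onto sl(E), for Q the orthogonal projection onto a plane E. *)
Definition slproj Q Y : 'M[C]_n := Q *m Y *m Q - (2^-1 * \tr (Q *m Y)) *: Q.
Definition comm K Y : 'M[C]_n := K *m Y - Y *m K.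

Fact slproj_is_linear Q : linear (slproj Q).
Proof.
move=> a X Y; rewrite /slproj !mulmxDr mulmxDl -!scalemxAr -scalemxAl mxtraceD mxtraceZ.
by mxadd.
Qed.
HB.instance Definition _ Q := GRing.isLinear.Build C 'M[C]_n 'M[C]_n _ (slproj Q) (slproj_is_linear Q).
Fact comm_is_linear K : linear (comm K).
Proof.
move=> a X Y; rewrite /comm !mulmxDr mulmxDl -!scalemxAr -scalemxAl.
by mxadd.
Qed.
HB.instance Definition _ Q := GRing.isLinear.Build C 'M[C]_n 'M[C]_n _ (comm Q) (comm_is_linear Q).

Lemma mn_mxvec p q (X : 'M[C]_(p, q)) : mn (mxvec X) = mn X.
Proof.
rewrite /mn big_ord1 pair_big /=.
rewrite (reindex _ (curry_mxvec_bij p q)) /=.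
by apply: eq_bigr => -[i j] _; rewrite mxvecE.
Qed.

Lemma mn_lin_mx (M : 'M[C]_(n * n)) (c : R) : (forall Y : 'M[C]_n, mn (mxvec Y *m M) <= c * mn Y) ->
  mn M <= (n * n)%:R * c.
Proof.
move=> h; rewrite {1}/mn.
apply: (le_trans (ler_sum _ (G := fun=> c) _)); last by rewrite sumr_const card_ord -[leLHS]mulr_natl.
move=> i _; have := h (vec_mx (delta_mx 0 i)); rewrite vec_mxK -rowE.
rewrite -[mn (vec_mx _)]mn_mxvec vec_mxK /mn !big_ord1.
have -> : \sum_j cn ((delta_mx 0 i : 'rV[C]_(n * n)) ord0 j) = 1.
  rewrite (bigD1 i) //= mxE !eqxx cn1 big1 ?addr0 // => j ji.
  by rewrite mxE (negPf ji) andbF cn0.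
rewrite mulr1.
by congr (_ <= _); apply: eq_bigr => j _; rewrite [row _ _ _ _]mxE.
Qed.

Lemma lin_mx_ext p (M N : 'M[C]_(n * n, p)) :
  (forall Y : 'M[C]_n, mxvec Y *m M = mxvec Y *m N) -> M = N.
Proof.
move=> h; apply/row_matrixP => i; rewrite !rowE.
by have := h (vec_mx (delta_mx 0 i)); rewrite vec_mxK.
Qed.

Lemma mxvec_dot X Y : mxvec X *m adj (mxvec Y) = (\tr (X *m adj Y))%:M.
Proof.
apply/matrixP => i j; rewrite !ord1 !mxE eqxx mulr1n.
transitivity (\sum_(p : 'I_n * 'I_n) X p.1 p.2 * adj Y p.2 p.1).
  rewrite (reindex _ (curry_mxvec_bij n n)) /=; apply: eq_bigr => -[k l] _.
  by rewrite mxvecE !mxE mxvecE.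
rewrite -(pair_bigA _ (fun k l => X k l * adj Y l k)) /=.
by rewrite /mxtrace; apply: eq_bigr => k _; rewrite mxE.
Qed.

(** By cyclicity of the trace, ad K is skew for the Hilbert-Schmidt product, which [mxvec_dot]
    expresses on flattened matrices. *)
Lemma comm_mx_adj K : adj K = - K -> adj (lin_mx (comm K)) = - lin_mx (comm K).
Proof.
move=> hK; apply: (can_inj (@adjK R _ _)); rewrite adjK.
apply: lin_mx_ext => X; apply: (can_inj (@adjK R _ _)).
apply: lin_mx_ext => Y; rewrite mul_vec_lin [in RHS]adjM adjK mulNmx mulmxN mulmxA mul_vec_lin.
rewrite -mulNmx -linearN !mxvec_dot; congr (_%:M).
rewrite /comm adjB !adjM hK !(mulNmx, mulmxN) opprK [RHS]/= mulmxBl !mulmxDr mulmxN opprB.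
rewrite mxtraceD trN trB addrC; congr (_ - _).
  by rewrite mulmxA.
by rewrite mulmxA mxtrace_mulC mulmxA.
Qed.

Definition frobsq p q (M : 'M[C]_(p, q)) : R := complex.Re (\tr (M *m adj M)).

Lemma frobsqD p q (X Y : 'M[C]_(p, q)) :
  frobsq (X + Y) = frobsq X + complex.Re (\tr (X *m adj Y) + \tr (Y *m adj X)) + frobsq Y.
Proof.
by rewrite /frobsq adjD mulmxDl !mulmxDr !mxtraceD !ReD !addrA.
Qed.

Lemma Re_tr_le p q (X Y : 'M[C]_(p, q)) : `|complex.Re (\tr (X *m adj Y))| <= mn X * mn Y.
Proof.
apply: (le_trans (Re_le_cn _)); apply: (le_trans (mn_tr _)).
by apply: (le_trans (mnM _ _)); rewrite mn_adj.
Qed.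

(* First variation of the squared Hilbert-Schmidt norm of [T *m Pi] along the flow
   [T' = M T - T M] vanishes when [Pi] commutes with the skew [M]. *)
Lemma frobsq_flow N (T M E Pi : 'M[C]_N) (c d : R) : adj M = - M -> M *m Pi = Pi *m M ->
  0 <= c -> 0 <= d -> d <= 1 -> mn (M *m T - T *m M) <= c * d -> mn E <= c * d ^+ 2 ->
  `|frobsq ((T + (M *m T - T *m M) + E) *m Pi) - frobsq (T *m Pi)| <=
    (2 * c * mn T + 4 * c ^+ 2) * mn Pi ^+ 2 * d ^+ 2.
Proof.
move=> Madj MPi c0 d0 d1; have [D DE] : exists D : 'M[C]_N, D = M *m T - T *m M by eexists.
rewrite -DE => hD hE.
have flow0 : \tr (T *m Pi *m adj (D *m Pi)) + \tr (D *m Pi *m adj (T *m Pi)) = 0.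
  have BM : Pi *m adj Pi *m M = M *m (Pi *m adj Pi).
    have := congr1 (@adj R _ _) MPi; rewrite !adjM Madj mulNmx mulmxN => /oppr_inj E1.
    by rewrite -mulmxA E1 !mulmxA MPi.
  have -> : T *m Pi *m adj (D *m Pi) = T *m (Pi *m adj Pi) *m adj D by rewrite adjM !mulmxA.
  have -> : D *m Pi *m adj (T *m Pi) = D *m (Pi *m adj Pi) *m adj T by rewrite adjM !mulmxA.
  move: (Pi *m adj Pi) BM => B BM.
  have -> : adj D = M *m adj T - adj T *m M.
    by rewrite DE adjB !adjM Madj mulNmx mulmxN opprK addrC.
  have -> : T *m B *m (M *m adj T - adj T *m M) = T *m B *m (M *m adj T) - T *m B *m (adj T *m M) by exact: mulmxBr.
  have -> : D *m B *m adj T = M *m T *m B *m adj T - T *m M *m B *m adj T by rewrite DE 2!mulmxBl.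
  rewrite 2!trB.
  have -> : T *m B *m (M *m adj T) = T *m M *m B *m adj T.
    by rewrite !mulmxA -[T *m B *m M]mulmxA BM !mulmxA.
  have -> : \tr (T *m B *m (adj T *m M)) = \tr (M *m T *m B *m adj T).
    by rewrite mulmxA mxtrace_mulC !mulmxA.
  by rewrite addrA subrK subrr.
have -> : (T + D + E) *m Pi = T *m Pi + (D + E) *m Pi by rewrite -[T + D + E]addrA mulmxDl.
rewrite frobsqD [X in `|X|]addrC !addrA [- _ + _]addrC subrr add0r.
have -> : \tr (T *m Pi *m adj ((D + E) *m Pi)) + \tr ((D + E) *m Pi *m adj (T *m Pi)) =
   \tr (T *m Pi *m adj (E *m Pi)) + \tr (E *m Pi *m adj (T *m Pi)).
  by rewrite !mulmxDl adjD mulmxDr !mxtraceD addrACA flow0 add0r.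
rewrite ReD.
have h1 := Re_tr_le (T *m Pi) (E *m Pi); have h2 := Re_tr_le (E *m Pi) (T *m Pi).
have h3 := Re_tr_le ((D + E) *m Pi) ((D + E) *m Pi); rewrite -/(frobsq _) in h3.
have hTP : mn (T *m Pi) <= mn T * mn Pi by exact: mnM.
have hEP : mn (E *m Pi) <= c * d ^+ 2 * mn Pi by apply: (le_trans (mnM _ _)); apply: ler_wpM2r.
have hDE : mn ((D + E) *m Pi) <= 2 * c * d * mn Pi.
  apply: (le_trans (mnM _ _)); apply: ler_wpM2r => //; apply: (le_trans (mnD _ _)).
  have h4 : c * d ^+ 2 <= c * d by apply: ler_wpM2l => //; rewrite expr2 ler_piMl.
  by rewrite -!mulrA mulrDl mul1r; apply: lerD => //; apply: (le_trans hE).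
apply: (le_trans (ler_normD _ _)); apply: (le_trans (lerD (ler_normD _ _) (lexx _))).
have k1 : mn (T *m Pi) * mn (E *m Pi) <= mn T * mn Pi * (c * d ^+ 2 * mn Pi) by apply: ler_pM.
have k2 : mn ((D + E) *m Pi) * mn ((D + E) *m Pi) <= (2 * c * d * mn Pi) * (2 * c * d * mn Pi) by apply: ler_pM.
apply: (le_trans (lerD (lerD (le_trans h1 k1) (le_trans h2 _)) (le_trans h3 k2))).
  by rewrite mulrC; exact: k1.
by rewrite le_eqVlt; apply/orP; left; apply/eqP; ring.
Qed.

(** Polarization in the projection: [slproj Q] is [slproj2 Q Q]. *)
Definition slproj2 Q1 Q2 Y : 'M[C]_n := Q1 *m Y *m Q2 - (2^-1 * \tr (Q1 *m Y)) *: Q2.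

Lemma slproj2_mn Q1 Q2 Y : mn (slproj2 Q1 Q2 Y) <= 2 * (mn Q1 * mn Q2) * mn Y.
Proof.
rewrite /slproj2; apply: (le_trans (mnB _ _)).
have h1 : mn (Q1 *m Y *m Q2) <= mn Q1 * mn Y * mn Q2.
  by apply: (le_trans (mnM _ _)); apply: ler_wpM2r => //; exact: mnM.
have h2 : mn ((2^-1 * \tr (Q1 *m Y)) *: Q2) <= mn Q1 * mn Y * mn Q2.
  apply: (le_trans (mnZ _ _)); apply: ler_wpM2r => //.
  have -> : 2^-1 = cR 2^-1 :> C by rewrite cRV cR_nat.
  rewrite cn_cRM; apply: (@le_trans _ _ (1 * cn (\tr (Q1 *m Y)))).
    by apply: ler_wpM2r => //; rewrite ger0_norm ?invr_ge0 // invf_le1 // ler1n.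
  by rewrite mul1r; apply: (le_trans (mn_tr _)); exact: mnM.
apply: (le_trans (lerD h1 h2)).
by rewrite le_eqVlt; apply/orP; left; apply/eqP; ring.
Qed.

(** Infinitesimal form of the equivariance of [slproj] under conjugation of [Q] and [Y]. *)
Lemma slproj_flow Q K Y : slproj2 Q (Q *m K - K *m Q) Y + slproj2 (Q *m K - K *m Q) Q Y =
  slproj Q (comm K Y) - comm K (slproj Q Y).
Proof.
have tE : \tr ((Q *m K - K *m Q) *m Y) = \tr (Q *m comm K Y).
  by rewrite /comm mulmxBl mulmxBr !trB -!mulmxA; congr (_ - _); rewrite mxtrace_mulC mulmxA.
rewrite /slproj2 tE /slproj; move: (2^-1 * \tr (Q *m comm K Y) : C) (2^-1 * \tr (Q *m Y) : C) => a b {tE}.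
rewrite /comm !mxdistr -!scalemxAl -!scalemxAr !mulmxA scalerBr.
move: (Q *m Y *m Q *m K) (Q *m Y *m K *m Q) (Q *m K *m Y *m Q) (K *m Q *m Y *m Q) => X1 X2 X3 X4.
move: (Q *m K) (K *m Q) => X5 X6.
by mxadd.
Qed.

Lemma slproj_expand Q N E Y : slproj (Q + N + E) Y =
  slproj Q Y + (slproj2 Q N Y + slproj2 N Q Y) +
  (slproj2 Q E Y + slproj2 E Q Y + slproj2 (N + E) (N + E) Y).
Proof.
rewrite /slproj /slproj2 !mxdistr !mxtraceD !mulrDr.
move: (2^-1 * \tr (Q *m Y) : C) (2^-1 * \tr (N *m Y) : C) (2^-1 * \tr (E *m Y) : C) => a b c.
move: (Q *m Y *m Q) (Q *m Y *m N) (Q *m Y *m E) => X1 X2 X3.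
move: (N *m Y *m Q) (N *m Y *m N) (N *m Y *m E) => X4 X5 X6.
move: (E *m Y *m Q) (E *m Y *m N) (E *m Y *m E) => X7 X8 X9.
by mxadd.
Qed.

(* The squared Hilbert-Schmidt norm of the composition of [slproj Q] with the orthogonal
   projection [Pi] off a subalgebra; it vanishes iff the subalgebra contains sl(E). *)
Definition defect (Pi : 'M[C]_(n * n)) Q : R := frobsq (lin_mx (slproj Q) *m Pi).

Lemma defect_flow Pi Q (c : R) : 0 <= c -> exists C0 : R, forall K Q' (d : R),
  adj K = - K -> lin_mx (comm K) *m Pi = Pi *m lin_mx (comm K) ->
  0 <= d -> d <= 1 -> mn K <= c * d ->
  mn (Q' - Q + (K *m Q - Q *m K)) <= c * d ^+ 2 ->
  `|defect Pi Q' - defect Pi Q| <= C0 * d ^+ 2.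
Proof.
move=> c0; move qE : (mn Q) => q; have q0 : 0 <= q by rewrite -qE.
(* k d bounds the increment [N + E] of the projection; a1 d and a2 d^2 bound the first-order and the
   remaining part of the increment of [slproj]. *)
pose k := 2 * q * c + c; have k0 : 0 <= k by rewrite /k addr_ge0 // !mulr_ge0.
pose a1 := 8 * q ^+ 2 * c; pose a2 := 4 * q * c + 2 * k ^+ 2.
have a10 : 0 <= a1 by rewrite !mulr_ge0 ?exprn_ge0.
have a20 : 0 <= a2 by rewrite addr_ge0 ?mulr_ge0 ?exprn_ge0.
pose c' := (n * n)%:R * (a1 + a2).
have c'0 : 0 <= c' by apply: mulr_ge0; [exact: ler0n|exact: addr_ge0].
exists ((2 * c' * mn (lin_mx (slproj Q)) + 4 * c' ^+ 2) * mn Pi ^+ 2) => K Q' d hK MPi d0 d1.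
have [N NE] : exists N : 'M[C]_n, N = Q *m K - K *m Q by eexists.
have [E EE] : exists E : 'M[C]_n, E = Q' - Q + (K *m Q - Q *m K) by eexists.
rewrite -EE => hKd hE.
have Q'E : Q' = Q + N + E.
  rewrite EE NE; move: (Q *m K) (K *m Q) => X1 X2; by mxadd.
have hN : mn N <= 2 * q * c * d.
  rewrite NE; apply: (le_trans (mnB _ _)).
  have h1 : mn (Q *m K) <= q * (c * d) by apply: (le_trans (mnM _ _)); rewrite qE; apply: ler_wpM2l.
  have h2 : mn (K *m Q) <= (c * d) * q by apply: (le_trans (mnM _ _)); rewrite qE; apply: ler_wpM2r.
  apply: (le_trans (lerD h1 h2)).
  by rewrite le_eqVlt; apply/orP; left; apply/eqP; ring.
have hNE : mn (N + E) <= k * d.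
  apply: (le_trans (mnD _ _)); rewrite /k mulrDl; apply: lerD => //; apply: (le_trans hE).
  by apply: ler_wpM2l => //; rewrite expr2 ler_piMl.
pose T := lin_mx (slproj Q); pose M := lin_mx (comm K).
pose E' : 'M[C]_(n * n) := lin_mx (slproj Q') - T - (M *m T - T *m M).
have flowY Y : mxvec Y *m (M *m T - T *m M) = mxvec (slproj2 Q N Y + slproj2 N Q Y).
  by rewrite mulmxBr !mulmxA /M /T !mul_vec_lin NE slproj_flow [RHS](linearB mxvec).
have E'Y Y : mxvec Y *m E' = mxvec (slproj2 Q E Y + slproj2 E Q Y + slproj2 (N + E) (N + E) Y).
  rewrite mulmxBr flowY mulmxBr /T !mul_vec_lin Q'E /= slproj_expand.
  rewrite -!(linearB mxvec); congr mxvec.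
  move: (slproj Q Y) (slproj2 Q N Y) (slproj2 N Q Y) (slproj2 Q E Y) (slproj2 E Q Y) => X1 X2 X3 X4 X5.
  by mxadd.
have -> : defect Pi Q' = frobsq ((T + (M *m T - T *m M) + E') *m Pi).
    rewrite /defect /E' -/T; congr (frobsq (_ *m _)).
  by rewrite -[lin_mx _ - T - _]addrA -opprD [RHS]addrC subrK.
have dd : d ^+ 2 <= d by rewrite expr2 ler_piMl.
apply: frobsq_flow => //; first exact: comm_mx_adj.
  apply: (le_trans (mn_lin_mx (c := a1 * d) _)).
    move=> Y; rewrite flowY mn_mxvec; apply: (le_trans (mnD _ _)).
    apply: (le_trans (lerD (slproj2_mn _ _ _) (slproj2_mn _ _ _))); rewrite qE.
    rewrite -mulrDl; apply: ler_wpM2r => //.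
    apply: (@le_trans _ _ (4 * q * (2 * q * c * d))); last first.
      by rewrite le_eqVlt; apply/orP; left; apply/eqP; rewrite /a1; ring.
    have := ler_wpM2l q0 hN; rewrite [mn N * q]mulrC -[4 * q * _]mulrA.
    by move: (q * mn N) (q * _) => x y xy; lra.
  rewrite mulrA; apply: ler_wpM2r => //; apply: ler_wpM2l; rewrite ?ler0n //.
  by rewrite lerDl.
apply: (le_trans (mn_lin_mx (c := a2 * d ^+ 2) _)).
  move=> Y; rewrite E'Y mn_mxvec; apply: (le_trans (mnD _ _)).
  apply: (le_trans (lerD (mnD _ _) (slproj2_mn _ _ _))).
  apply: (le_trans (lerD (lerD (slproj2_mn _ _ _) (slproj2_mn _ _ _)) (lexx _))); rewrite qE.
  rewrite -!mulrDl; apply: ler_wpM2r => //.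
  have h1 : mn (N + E) * mn (N + E) <= k * d * (k * d) by apply: ler_pM.
  have h2 : q * mn E <= q * (c * d ^+ 2) by apply: ler_wpM2l.
  rewrite [mn E * q]mulrC.
  apply: (@le_trans _ _ (2 * (q * (c * d ^+ 2)) + 2 * (q * (c * d ^+ 2)) + 2 * (k * d * (k * d)))).
    by apply: lerD; first apply: lerD; apply: ler_wpM2l.
  by rewrite le_eqVlt; apply/orP; left; apply/eqP; rewrite /a2; ring.
rewrite mulrA; apply: ler_wpM2r; first exact: exprn_ge0.
by apply: ler_wpM2l; rewrite ?ler0n // lerDr.
Qed.
End Superoperators.

(* In the coordinates (h, e, f) of sl_2: [v, [v, w]] and [w, [v, w]] together with [v, w]
   form a basis, the determinant being proportional to the square of the Killing norm of [v, w]. *)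
Section Sl2.
Variable K : fieldType.

Lemma basis3 (a1 a2 a3 b1 b2 b3 c1 c2 c3 : K) :
  a1 * (b2 * c3 - b3 * c2) - a2 * (b1 * c3 - b3 * c1) + a3 * (b1 * c2 - b2 * c1) != 0 ->
  forall x1 x2 x3, exists p q r, [/\ x1 = p * a1 + q * b1 + r * c1,
    x2 = p * a2 + q * b2 + r * c2 & x3 = p * a3 + q * b3 + r * c3].
Proof.
set d := (X in X != 0) => d0 x1 x2 x3.
exists ((x1 * (b2 * c3 - b3 * c2) - x2 * (b1 * c3 - b3 * c1) + x3 * (b1 * c2 - b2 * c1)) / d),
  ((x1 * (c2 * a3 - c3 * a2) - x2 * (c1 * a3 - c3 * a1) + x3 * (c1 * a2 - c2 * a1)) / d),
  ((x1 * (a2 * b3 - a3 * b2) - x2 * (a1 * b3 - a3 * b1) + x3 * (a1 * b2 - a2 * b1)) / d).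
by split; rewrite /d in d0 *; field.
Qed.

(** Coordinates of the bracket in the basis (h, e, f) with [h, e] = 2 e, [h, f] = -2 f and [e, f] =
    h. *)
Definition br1 (a1 a2 a3 b1 b2 b3 : K) := a2 * b3 - a3 * b2.
Definition br2 (a1 a2 a3 b1 b2 b3 : K) := 2 * (a1 * b2 - a2 * b1).
Definition br3 (a1 a2 a3 b1 b2 b3 : K) := - 2 * (a1 * b3 - a3 * b1).

Lemma sl2_det (a1 a2 a3 b1 b2 b3 : K) :
  let c1 := br1 a1 a2 a3 b1 b2 b3 in let c2 := br2 a1 a2 a3 b1 b2 b3 in
  let c3 := br3 a1 a2 a3 b1 b2 b3 in
  let u1 := br1 a1 a2 a3 c1 c2 c3 in let u2 := br2 a1 a2 a3 c1 c2 c3 in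
  let u3 := br3 a1 a2 a3 c1 c2 c3 in
  let w1 := br1 b1 b2 b3 c1 c2 c3 in let w2 := br2 b1 b2 b3 c1 c2 c3 in
  let w3 := br3 b1 b2 b3 c1 c2 c3 in
  c1 * (u2 * w3 - u3 * w2) - c2 * (u1 * w3 - u3 * w1) + c3 * (u1 * w2 - u2 * w1) =
  - 4 * (c1 ^+ 2 + c2 * c3) ^+ 2.
Proof. rewrite /br1 /br2 /br3 /=; ring. Qed.
End Sl2.

Lemma cross_eq0_dep (R : realFieldType) (a1 x1 y1 a2 x2 y2 : R) :
  y1 * x2 - x1 * y2 = 0 -> a1 * x2 - x1 * a2 = 0 -> a1 * y2 - y1 * a2 = 0 ->
  exists p q : R, [/\ (p != 0) || (q != 0), p * a1 + q * a2 = 0, p * x1 + q * x2 = 0 & p * y1 + q * y2 = 0].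
Proof.
move=> h1 h2 h3.
have [a0|a0] := boolP ((a1 != 0) || (a2 != 0)).
  exists a2, (- a1); split; [by rewrite oppr_eq0 orbC | ring | |]; lra.
have [x0|x0] := boolP ((x1 != 0) || (x2 != 0)).
  exists x2, (- x1); split; [by rewrite oppr_eq0 orbC | | ring |]; lra.
have [y0|y0] := boolP ((y1 != 0) || (y2 != 0)).
  exists y2, (- y1); split; [by rewrite oppr_eq0 orbC | | | ring]; lra.
move: a0 x0 y0; rewrite !negb_or !negbK => /andP [/eqP -> /eqP ->] /andP [/eqP -> /eqP ->] /andP [/eqP -> /eqP ->].
by exists 1, 0; rewrite oner_eq0 !mulr0 addr0.
Qed.

(** On Hermitian arguments the bracket is, up to a factor, i times a real cross product, so its
    Killing norm is a sum of squares up to sign. It vanishes only if the two matrices are dependent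
    over the reals, by [cross_eq0_dep]. *)
Lemma hermitian_killing (R : realType) (a1 x1 y1 a2 x2 y2 : R) (z1 z2 : complex R) :
  z1 = Complex x1 y1 -> z2 = Complex x2 y2 ->
  br1 (cR a1) z1 (conjc z1) (cR a2) z2 (conjc z2) ^+ 2 +
  br2 (cR a1) z1 (conjc z1) (cR a2) z2 (conjc z2) * br3 (cR a1) z1 (conjc z1) (cR a2) z2 (conjc z2) =
  cR (- 4 * ((y1 * x2 - x1 * y2) ^+ 2 + (a1 * x2 - x1 * a2) ^+ 2 + (a1 * y2 - y1 * a2) ^+ 2)).
Proof.
have cE (x y : R) : Complex x y = cR x + iC R * cR y.
  by apply/eqP; rewrite eq_complex /= !mul0r !mul1r ?subr0 ?addr0 ?add0r !eqxx.
have cEb (x y : R) : conjc (Complex x y) = cR x - iC R * cR y.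
  by apply/eqP; rewrite eq_complex /=; apply/andP; split; apply/eqP; ring.
move=> -> ->; rewrite !cEb !cE /br1 /br2 /br3 !expr2 !(cR_nat, cRM, cRN, cRB, cRD).
have := iC2 R; move: (iC R) (cR a1) (cR x1) (cR y1) (cR a2) (cR x2) (cR y2) => i ? ? ? ? ? ? ii.
by ring: ii.
Qed.

(** * Local constancy of the defect and generators of sl(n) *)

Section LocalConstancy.
Variable R : realType.
Variable n : nat.
Local Notation C := (complex R).
Variable g : set 'M[C]_n.
Hypothesis gL : complex_lie g.

(** [Pi] projects flattened matrices off [g]. For skew [K] in [g], ad K preserves [g] and is skew,
    hence commutes with [Pi]. *)
Lemma exists_defect_proj : exists Pi : 'M[C]_(n * n),
  (forall Q, defect Pi Q = 0 <-> forall Y, g (slproj Q Y)) /\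
  (forall K : 'M[C]_n, adj K = - K -> g K -> lin_mx (comm K) *m Pi = Pi *m lin_mx (comm K)).
Proof.
have [g0 gD gZ gB] := gL.
have sub : subspace [set x : 'rV[C]_(n * n) | g (vec_mx x)].
  split => /=; first by rewrite linear0.
    by move=> x y gx gy; rewrite linearD; apply: gD.
  by move=> a x gx; rewrite linearZ; apply: gZ.
have [Pi [PiP PiC]] := ortho_complement_proj sub.
exists Pi; split => [Q|K hK gK].
  have E Y : mxvec Y *m (lin_mx (slproj Q) *m Pi) = mxvec (slproj Q Y) *m Pi.
    by rewrite mulmxA mul_vec_lin.
  split=> [/frob_eq0 h Y|h].
    have /PiP : mxvec (slproj Q Y) *m Pi = 0 by rewrite -E h mulmx0.
    by rewrite /= mxvecK.
  rewrite /defect (_ : _ *m Pi = 0) /frobsq ?mul0mx ?mxtrace0 //.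
  apply: lin_mx_ext => Y; rewrite E mulmx0; apply/PiP; rewrite /= mxvecK; exact: h.
apply: PiC; first exact: comm_mx_adj.
move=> x /= gx; rewrite -[x]vec_mxK mul_vec_lin mxvecK /=.
exact: gB.
Qed.

Lemma kato_mn (A : 'M[C]_n) : is_hermitian A ->
  exists2 c : R, 0 <= c & forall V, mn (kato A V) <= c * mn V.
Proof.
move=> hA; pose p := projbound R n; have p0 : 0 <= p by exact: projbound_ge0.
exists (\sum_(l < n) \sum_(k < n) `|(lam A l - lam A k)^-1| * (p * p)).
  by apply: sumr_ge0 => l _; apply: sumr_ge0 => k _; rewrite !mulr_ge0.
move=> V; rewrite mulr_suml; apply: (le_trans (mn_sum _ _ _)); apply: ler_sum => l _.
rewrite mulr_suml; apply: (le_trans (mn_sum _ _ _)); apply: ler_sum => k _.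
rewrite mn_cR -mulrA; apply: ler_wpM2l => //.
apply: (le_trans (mnM _ _)); rewrite mulrAC; apply: ler_pM => //; last exact: eigproj_mn.
by apply: (le_trans (mnM _ _)); apply: ler_wpM2r => //; exact: eigproj_mn.
Qed.

Lemma defect_local (Pi : 'M[C]_(n * n)) (A : 'M[C]_n) (S : {set 'I_n}) :
  (forall K : 'M[C]_n, adj K = - K -> g K -> lin_mx (comm K) *m Pi = Pi *m lin_mx (comm K)) ->
  is_hermitian A -> g A -> isolated A S ->
  exists c e : R, [/\ 0 <= c, 0 < e & forall B, is_hermitian B -> g B -> mn (B - A) < e ->
    `|defect Pi (specproj B S) - defect Pi (specproj A S)| <= c * mn (B - A) ^+ 2].
Proof.
move=> PiC hA gA iS.
have [c1 [e1 [c10 e10 h1]]] := specproj_kato hA iS.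
have [c2 c20 h2] := kato_mn hA.
have c12 : 0 <= c1 + c2 by rewrite addr_ge0 // ltW.
have [c3 h3] := defect_flow Pi (specproj A S) c12.
(* The minimum with 1 gives the condition d <= 1 of [defect_flow]; the absolute value is taken
   because the sign of the constant found there is not recorded. *)
exists `|c3|, (Num.min e1 1); split => //; first by rewrite lt_min e10 ltr01.
move=> B hB gB; rewrite lt_min => /andP [he1 he2].
have hV : is_hermitian (B - A) by rewrite /is_hermitian adjB hA hB.
have gV : g (B - A) by exact: complex_lieB.
apply: (@le_trans _ _ (c3 * mn (B - A) ^+ 2)); last first.
  by apply: ler_wpM2r; [exact: exprn_ge0 | exact: ler_norm].
apply: (h3 (kato A (B - A))) => //.
- exact: kato_adj.
- apply: PiC; first exact: kato_adj.
  exact: kato_in.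
- exact: ltW.
- by apply: (le_trans (h2 _)); apply: ler_wpM2r => //; rewrite lerDr ltW.
by apply: (le_trans (h1 _ hB he1)); apply: ler_wpM2r; [exact: exprn_ge0 | rewrite lerDl].
Qed.

Section Generation.
Variable W : 'M[C]_n.
Hypothesis W1 : adj W *m W = 1%:M.

Definition munit (k l : 'I_n) : 'M[C]_n := locked (W *m delta_mx k l *m adj W).

Lemma munitE k l : munit k l = W *m delta_mx k l *m adj W.
Proof. by rewrite /munit -lock. Qed.

Lemma delta_sandwich (Z : 'M[C]_n) (k l i j : 'I_n) :
  delta_mx k l *m Z *m delta_mx i j = Z l i *: delta_mx k j.
Proof.
rewrite -(mul_delta_mx (0 : 'I_1) k l) -(mul_delta_mx (0 : 'I_1) i j) -!mulmxA.
rewrite [delta_mx 0 l *m _]mulmxA -rowE [row l Z *m _]mulmxA -colE.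
have -> : col i (row l Z) = (Z l i)%:M by apply/matrixP => a b; rewrite !ord1 !mxE eqxx mulr1n.
by rewrite mul_scalar_mx -scalemxAr mul_delta_mx.
Qed.

Lemma munit_sandwich X k l i j : munit k l *m X *m munit i j = (adj W *m X *m W) l i *: munit k j.
Proof.
rewrite !munitE scalemxAl scalemxAr -delta_sandwich !mulmxA //.
Qed.

Lemma munitM k l i j : munit k l *m munit i j = if l == i then munit k j else 0.
Proof.
rewrite !munitE -!mulmxA [adj W *m (W *m _)]mulmxA W1 mul1mx.
rewrite [delta_mx k l *m _]mulmxA; case: eqP => [<-|/eqP kl].
  by rewrite mul_delta_mx mulmxA.
by rewrite mul_delta_mx_cond (negPf kl) mulr0n mul0mx mulmx0.
Qed.

Lemma munit_coord X : X = \sum_k \sum_l (adj W *m X *m W) k l *: munit k l.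
Proof.
have WW : W *m adj W = 1%:M by exact: mulmx1C.
rewrite -{1}[X]mulmx1 -{1}[X *m _]mul1mx -{1}WW -{1}WW -!mulmxA [X *m _]mulmxA [adj W *m (X *m W *m _)]mulmxA [adj W *m _]mulmxA.
rewrite {1}[adj W *m X *m W]matrix_sum_delta mulmx_suml mulmx_sumr; apply: eq_bigr => k _.
rewrite mulmx_suml mulmx_sumr; apply: eq_bigr => l _.
by rewrite -scalemxAl -scalemxAr munitE mulmxA.
Qed.

Lemma trace_munit k l : \tr (munit k l) = (k == l)%:R.
Proof.
rewrite munitE mxtrace_mulC mulmxA W1 mul1mx /mxtrace (bigD1 k) //= big1 => [|i ik]; rewrite !mxE ?eqxx ?addr0 //.
by rewrite (negPf ik).
Qed.

Hypothesis gS : forall k l : 'I_n, l = k.+1 :> nat -> g (munit k l) /\ g (munit l k).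

(** Brackets of neighboring matrix units reach all off-diagonal ones, by induction on the distance
    between the indices; brackets of transposed units then give the differences of diagonal ones. *)
Lemma sl_generated X : \tr X = 0 -> g X.
Proof.
have [g0 gD gZ gB] := gL.
have up d : forall k l : 'I_n, l = (k + d.+1)%N :> nat -> g (munit k l) /\ g (munit l k).
  elim: d => [|d IH] k l; first by rewrite addn1; exact: gS.
  move=> lk; have h : (k + d.+1 < n)%N by rewrite -[X in (_ <= X)%N]/n; have := ltn_ord l; lia.
  pose i := Ordinal h; have [a1 a2] := IH k i erefl.
  have [b1 b2] : g (munit i l) /\ g (munit l i) by apply: gS; rewrite lk /= addnS.
  have ki : (l == k) = false by apply/negbTE; rewrite -val_eqE /= lk; lia.
  have kl : (k == l) = false by rewrite eq_sym.
  split.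
    by have := gB _ _ a1 b1; rewrite !munitM eqxx ki subr0.
  by have := gB _ _ b2 a2; rewrite !munitM eqxx kl subr0.
have off k l : k != l -> g (munit k l).
  rewrite neq_ltn => /orP [kl|lk].
    by have [] := up (l - k.+1)%N k l; first by rewrite -addSnnS subnKC.
  by have [] := up (k - l.+1)%N l k; first by rewrite -addSnnS subnKC.
have dg k l : g (munit k k - munit l l).
  have [->|kl] := eqVneq k l; first by rewrite subrr.
  have lk : l != k by rewrite eq_sym.
  by have := gB _ _ (off k l kl) (off l k lk); rewrite !munitM !eqxx.
move=> trX; rewrite (munit_coord X); set a := adj W *m X *m W.
have tra : \sum_k a k k = 0.
  by rewrite -[LHS]/(\tr a) /a mxtrace_mulC mulmxA (mulmx1C W1) mul1mx.
have -> : \sum_k \sum_l a k l *: munit k l =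
    \sum_k a k k *: munit k k + \sum_k \sum_(l | l != k) a k l *: munit k l.
  by rewrite -big_split /=; apply: eq_bigr => k _; rewrite (bigD1 k).
apply: gD; last first.
  by apply: complex_lie_sum => // k _; apply: complex_lie_sum => // l lk; apply: gZ; apply: off; rewrite eq_sym.
case: (pickP (fun _ : 'I_n => true)) => [i0 _|none]; last by rewrite big1 // => k; have := none k.
have -> : \sum_k a k k *: munit k k = \sum_k a k k *: (munit k k - munit i0 i0).
  under [RHS]eq_bigr => k _ do rewrite scalerBr.
  by rewrite sumrB -[X in _ = _ - X]scaler_suml tra scale0r subr0.
by apply: complex_lie_sum => // k _; apply: gZ.
Qed.
End Generation.

Lemma slproj_pairE (Q e11 e12 e21 e22 Y : 'M[C]_n) (y11 y12 y21 y22 : C) : Q = e11 + e22 ->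
  e11 *m Y *m e11 = y11 *: e11 -> e11 *m Y *m e22 = y12 *: e12 ->
  e22 *m Y *m e11 = y21 *: e21 -> e22 *m Y *m e22 = y22 *: e22 ->
  \tr (e11 *m Y) = y11 -> \tr (e22 *m Y) = y22 ->
  slproj Q Y = (2^-1 * (y11 - y22)) *: (e11 - e22) + y12 *: e12 + y21 *: e21.
Proof.
move=> -> h11 h12 h21 h22 t1 t2.
rewrite /slproj mulmxDl mxtraceD t1 t2 mulmxDl 2!mulmxDr h11 h12 h21 h22.
apply/matrixP => i j; rewrite !(mxDE, mxNE, mxZE).
move: (e11 i j) (e12 i j) (e21 i j) (e22 i j) => *.
by field.
Qed.

Section Pair.
Variable A : 'M[C]_n.
Hypothesis hA : is_hermitian A.
Variables (j1 j2 : 'I_n).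
Hypothesis j12 : j1 != j2.
Local Notation W := (eigbasis A).
Local Notation E := (munit W).
Local Notation Q := (specproj A [set j1; j2]).

Lemma specproj_pair : Q = E j1 j1 + E j2 j2.
Proof. by rewrite specprojE big_setU1 ?inE // big_set1 !eigprojE !munitE. Qed.

Lemma pair_in_of_slproj : (forall Y, g (slproj Q Y)) -> g (E j1 j2) /\ g (E j2 j1).
Proof.
have W1 := eigbasis_adjl hA; have j21 : (j2 == j1) = false by rewrite eq_sym (negPf j12).
have [Q12 Q21] : Q *m E j1 j2 = E j1 j2 /\ Q *m E j2 j1 = E j2 j1.
  rewrite specproj_pair; split; rewrite mulmxDl.
    by rewrite (munitM W1 j1 j1 j1 j2) (munitM W1 j2 j2 j1 j2) eqxx j21 addr0.
  by rewrite (munitM W1 j1 j1 j2 j1) (munitM W1 j2 j2 j2 j1) eqxx (negPf j12) add0r.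
have [E12 E21] : E j1 j2 *m Q = E j1 j2 /\ E j2 j1 *m Q = E j2 j1.
  rewrite specproj_pair; split; rewrite mulmxDr.
    by rewrite (munitM W1 j1 j2 j1 j1) (munitM W1 j1 j2 j2 j2) eqxx j21 add0r.
  by rewrite (munitM W1 j2 j1 j1 j1) (munitM W1 j2 j1 j2 j2) eqxx (negPf j12) addr0.
move=> h; have := h (E j1 j2); have := h (E j2 j1).
rewrite /slproj Q12 Q21 E12 E21 !(trace_munit W1) (negPf j12) j21 mulr0.
by rewrite !scale0r !subr0.
Qed.

Lemma trace_munit_mul Y k : \tr (E k k *m Y) = (adj W *m Y *m W) k k.
Proof.
have W1 := eigbasis_adjl hA.
transitivity (\tr (E k k *m Y *m E k k)).
  by rewrite [RHS]mxtrace_mulC mulmxA (munitM W1 k k k k) eqxx.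
by rewrite munit_sandwich mxtraceZ (trace_munit W1) eqxx mulr1.
Qed.

Lemma slproj_in_of_pair : g (E j1 j2) -> g (E j2 j1) -> g (E j1 j1 - E j2 j2) ->
  forall Y, g (slproj Q Y).
Proof.
have W1 := eigbasis_adjl hA; have j21 : (j2 == j1) = false by rewrite eq_sym (negPf j12).
have [g0 gD gZ gB] := gL.
move=> g12 g21 g11 Y; rewrite /slproj specproj_pair.
have trQ k : \tr (E k k *m Y) = (adj W *m Y *m W) k k by exact: trace_munit_mul.
rewrite -/(slproj _ _) (slproj_pairE erefl (munit_sandwich _ _ _ _ _ _) (munit_sandwich _ _ _ _ _ _)
  (munit_sandwich _ _ _ _ _ _) (munit_sandwich _ _ _ _ _ _) (trQ _) (trQ _)).
exact: (gD _ _ (gD _ _ (gZ _ _ g11) (gZ _ _ g12)) (gZ _ _ g21)).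
Qed.
End Pair.

(** * Generating sl(E) at a double eigenvalue *)

Section Conical.
Variable A : 'M[C]_n.
Hypothesis hA : is_hermitian A.
Hypothesis gA : g A.
Variables (j1 j2 : 'I_n).
Hypothesis j12 : j1 != j2.
Hypothesis lam12 : lam A j1 = lam A j2.
Hypothesis simple_off : forall k l : 'I_n, k != l -> lam A k = lam A l ->
  (k \in [set j1; j2]%SET) && (l \in [set j1; j2]%SET).
Local Notation S := [set j1; j2]%SET.
Local Notation W := (eigbasis A).
Local Notation E := (munit W).
Local Notation Q := (specproj A S).
Local Notation P := (eigproj A).

(** What the resonant part retains on the simple eigenvalues. It annihilates everything supported on
    the plane and commutes with the other diagonal parts, so it drops out of all brackets formed
    below. *)
Definition diagpart V : 'M[C]_n := \sum_(k in ~: S) \tr (P k *m V) *: P k.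

Lemma resonant_pair V : resonant A V = Q *m V *m Q + diagpart V.
Proof.
rewrite /resonant (bigID (fun l => l \in S)) /=; congr (_ + _).
  rewrite specprojE !mulmx_suml; apply: eq_bigr => l lS.
  rewrite mulmx_sumr; apply: eq_bigl => k.
  have lamS i : i \in S -> lam A i = lam A j1 by rewrite !inE => /orP [] /eqP ->.
  apply/eqP/idP => [lk|kS]; last by rewrite !lamS.
  have [<-//|kl] := eqVneq l k.
  by have /andP [] := simple_off kl lk.
rewrite /diagpart; apply: eq_big => [l|l lS]; first by rewrite finset.in_setC.
rewrite (bigD1 l) //= big1 ?addr0; first exact: eigproj_sandwich.
move=> k /andP [/eqP lk kl].
have /andP [kS lS'] := simple_off kl (esym lk).
by rewrite lS' in lS.
Qed.

Lemma diagpart_pair V X : X = Q *m X *m Q -> diagpart V *m X = 0 /\ X *m diagpart V = 0.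
Proof.
move=> XE; have [DQ QD] : diagpart V *m Q = 0 /\ Q *m diagpart V = 0.
  rewrite mulmx_suml mulmx_sumr; split; apply: big1 => k; rewrite inE => kS.
    by rewrite -scalemxAl (specprojl hA S k) (negPf kS) scaler0.
  by rewrite -scalemxAr (specprojr hA S k) (negPf kS) scaler0.
by rewrite XE -[Q *m X *m Q]mulmxA mulmxA DQ mul0mx mulmxA -mulmxA QD mulmx0.
Qed.

Lemma diagpartC V V' : diagpart V *m diagpart V' = diagpart V' *m diagpart V.
Proof.
have E2 X Y : diagpart X *m diagpart Y = \sum_(k in ~: S) (\tr (P k *m X) * \tr (P k *m Y)) *: P k.
  rewrite mulmx_suml; apply: eq_bigr => k kS; rewrite mulmx_sumr (bigD1 k) //= big1 ?addr0.
    by rewrite -scalemxAl -scalemxAr scalerA (eigprojM hA k k) eqxx.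
  move=> l /andP [_ lk]; rewrite -scalemxAl -scalemxAr (eigprojM hA k l) eq_sym (negPf lk).
  by rewrite !scaler0.
by rewrite !E2; apply: eq_bigr => k _; rewrite mulrC.
Qed.

Definition slvec (a1 a2 a3 : C) : 'M[C]_n := a1 *: (E j1 j1 - E j2 j2) + a2 *: E j1 j2 + a3 *: E j2 j1.

Lemma slvec_comb p a1 a2 a3 q b1 b2 b3 : p *: slvec a1 a2 a3 + q *: slvec b1 b2 b3 =
  slvec (p * a1 + q * b1) (p * a2 + q * b2) (p * a3 + q * b3).
Proof.
rewrite /slvec; move: (E j1 j1 - E j2 j2) (E j1 j2) (E j2 j1) => X Y Z.
rewrite !scalerDr !scalerA !scalerDl.
rewrite addrACA [p * a1 *: X + p * a2 *: Y + _]addrACA //.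
Qed.

(** Stated for abstract matrices obeying the multiplication table of the units, so that the
    computation runs on variables. *)
Lemma slvecE (X11 X12 X21 X22 : 'M[C]_n) a1 a2 a3 b1 b2 b3 :
   X11 *m X11 = X11 -> X11 *m X12 = X12 -> X11 *m X21 = 0 -> X11 *m X22 = 0 ->
   X12 *m X11 = 0 -> X12 *m X12 = 0 -> X12 *m X21 = X11 -> X12 *m X22 = X12 ->
   X21 *m X11 = X21 -> X21 *m X12 = X22 -> X21 *m X21 = 0 -> X21 *m X22 = 0 ->
   X22 *m X11 = 0 -> X22 *m X12 = 0 -> X22 *m X21 = X21 -> X22 *m X22 = X22 ->
   let v (a1 a2 a3 : C) := a1 *: (X11 - X22) + a2 *: X12 + a3 *: X21 in
   v a1 a2 a3 *m v b1 b2 b3 - v b1 b2 b3 *m v a1 a2 a3 =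
   v (br1 a1 a2 a3 b1 b2 b3) (br2 a1 a2 a3 b1 b2 b3) (br3 a1 a2 a3 b1 b2 b3).
Proof.
move=> h1 h2 h3 h4 h5 h6 h7 h8 h9 h10 h11 h12 h13 h14 h15 h16 v.
have mulv x1 x2 x3 y1 y2 y3 : v x1 x2 x3 *m v y1 y2 y3 =
    (x1 * y1 + x2 * y3) *: X11 + (x1 * y1 + x3 * y2) *: X22 + (x1 * y2 - x2 * y1) *: X12 + (x3 * y1 - x1 * y3) *: X21.
  rewrite /v !(mulmxDl, mulmxDr) -!scalemxAl -!scalemxAr !(mulmxDl, mulmxDr) !(mulNmx, mulmxN).
  rewrite h1 h2 h3 h4 h5 h6 h7 h8 h9 h10 h11 h12 h13 h14 h15 h16.
  rewrite !(subr0, sub0r, oppr0, scaler0, add0r, addr0, opprK).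
  apply/matrixP => i j; rewrite !(mxDE, mxNE, mxZE).
  by move: (X11 i j) (X12 i j) (X21 i j) (X22 i j) => *; ring.
rewrite !mulv /v /br1 /br2 /br3; apply/matrixP => i j; rewrite !(mxDE, mxNE, mxZE).
by move: (X11 i j) (X12 i j) (X21 i j) (X22 i j) => *; ring.
Qed.

Lemma slvec_br a1 a2 a3 b1 b2 b3 :
  slvec a1 a2 a3 *m slvec b1 b2 b3 - slvec b1 b2 b3 *m slvec a1 a2 a3 =
  slvec (br1 a1 a2 a3 b1 b2 b3) (br2 a1 a2 a3 b1 b2 b3) (br3 a1 a2 a3 b1 b2 b3).
Proof.
have W1 := eigbasis_adjl hA; have j21 : (j2 == j1) = false by rewrite eq_sym (negPf j12).
by apply: slvecE; rewrite (munitM W1 _ _ _ _) ?eqxx ?(negPf j12) ?j21.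
Qed.

Lemma pair_units : [/\ Q *m E j1 j1 = E j1 j1, Q *m E j1 j2 = E j1 j2, Q *m E j2 j1 = E j2 j1 & Q *m E j2 j2 = E j2 j2]
  /\ [/\ E j1 j1 *m Q = E j1 j1, E j1 j2 *m Q = E j1 j2, E j2 j1 *m Q = E j2 j1 & E j2 j2 *m Q = E j2 j2].
Proof.
have W1 := eigbasis_adjl hA; have j21 : (j2 == j1) = false by rewrite eq_sym (negPf j12).
rewrite specproj_pair //; split; split; rewrite ?mulmxDl ?mulmxDr.
- by rewrite (munitM W1 j1 j1 j1 j1) (munitM W1 j2 j2 j1 j1) eqxx j21 addr0.
- by rewrite (munitM W1 j1 j1 j1 j2) (munitM W1 j2 j2 j1 j2) eqxx j21 addr0.
- by rewrite (munitM W1 j1 j1 j2 j1) (munitM W1 j2 j2 j2 j1) eqxx (negPf j12) add0r.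
- by rewrite (munitM W1 j1 j1 j2 j2) (munitM W1 j2 j2 j2 j2) eqxx (negPf j12) add0r.
- by rewrite (munitM W1 j1 j1 j1 j1) (munitM W1 j1 j1 j2 j2) eqxx (negPf j12) addr0.
- by rewrite (munitM W1 j1 j2 j1 j1) (munitM W1 j1 j2 j2 j2) eqxx j21 add0r.
- by rewrite (munitM W1 j2 j1 j1 j1) (munitM W1 j2 j1 j2 j2) eqxx (negPf j12) addr0.
- by rewrite (munitM W1 j2 j2 j1 j1) (munitM W1 j2 j2 j2 j2) eqxx j21 add0r.
Qed.

Lemma slvec_specproj a1 a2 a3 : Q *m slvec a1 a2 a3 = slvec a1 a2 a3 /\ slvec a1 a2 a3 *m Q = slvec a1 a2 a3.
Proof.
have [[q1 q2 q3 q4] [r1 r2 r3 r4]] := pair_units.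
rewrite /slvec; move: (E j1 j1) (E j1 j2) (E j2 j1) (E j2 j2) q1 q2 q3 q4 r1 r2 r3 r4.
move=> e1 e2 e3 e4 q1 q2 q3 q4 r1 r2 r3 r4; split.
  by rewrite 2!mulmxDr -!scalemxAr mulmxBr q1 q2 q3 q4.
by rewrite 2!mulmxDl -!scalemxAl mulmxBl r1 r2 r3 r4.
Qed.

(** Coordinates of the compression of [V] to the plane: [halfdiff], [offdiag] and its conjugate
    along h, e, f, and [halfsum] along the identity of the plane. *)
Definition halfdiff V : C := 2^-1 * ((adj W *m V *m W) j1 j1 - (adj W *m V *m W) j2 j2).
Definition halfsum V : C := 2^-1 * ((adj W *m V *m W) j1 j1 + (adj W *m V *m W) j2 j2).
Definition offdiag V : C := (adj W *m V *m W) j1 j2.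

Lemma hermitian_offdiag V : adj V = V -> (adj W *m V *m W) j2 j1 = conjc (offdiag V).
Proof.
move=> hV; have : adj (adj W *m V *m W) = adj W *m V *m W by rewrite !adjM adjK hV mulmxA.
rewrite /offdiag; move: (adj W *m V *m W) => y hy.
have := congr1 (fun M : 'M[C]_n => M j2 j1) hy; rewrite /adj mxE mxE => <-.
by [].
Qed.

Lemma hermitian_halfdiff V : adj V = V -> exists a : R, halfdiff V = cR a.
Proof.
move=> hV; have : adj (adj W *m V *m W) = adj W *m V *m W by rewrite !adjM adjK hV mulmxA.
rewrite /halfdiff; move: (adj W *m V *m W) => y hy.
have re k : exists a : R, y k k = cR a.
  have := congr1 (fun M : 'M[C]_n => M k k) hy; rewrite /adj mxE mxE.
  case: (y k k) => a b [] h; exists a; rewrite /cR; congr Complex; lra.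
have [a ->] := re j1; have [b ->] := re j2; exists (2^-1 * (a - b)).
by rewrite cRM cRB cRV cR_nat.
Qed.

Lemma hermitian_halfsum V : adj V = V -> exists a : R, halfsum V = cR a.
Proof.
move=> hV; have : adj (adj W *m V *m W) = adj W *m V *m W by rewrite !adjM adjK hV mulmxA.
rewrite /halfsum; move: (adj W *m V *m W) => y hy.
have re k : exists a : R, y k k = cR a.
  have := congr1 (fun M : 'M[C]_n => M k k) hy; rewrite /adj mxE mxE.
  case: (y k k) => a b [] h; exists a; rewrite /cR; congr Complex; lra.
have [a ->] := re j1; have [b ->] := re j2; exists (2^-1 * (a + b)).
by rewrite cRM cRD cRV cR_nat.
Qed.

Lemma compress_slvec V : adj V = V ->
  Q *m V *m Q = slvec (halfdiff V) (offdiag V) (conjc (offdiag V)) + halfsum V *: Q.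
Proof.
move=> hV; have W1 := eigbasis_adjl hA.
have tQ : \tr (Q *m V) = (adj W *m V *m W) j1 j1 + (adj W *m V *m W) j2 j2.
  by rewrite specproj_pair // mulmxDl mxtraceD !trace_munit_mul.
rewrite -(hermitian_offdiag hV) /slvec /halfdiff /halfsum /offdiag -tQ.
transitivity (slproj Q V + (2^-1 * \tr (Q *m V)) *: Q); first by rewrite /slproj subrK.
congr (_ + _); apply: (slproj_pairE (specproj_pair A j12)); try exact: munit_sandwich.
  exact: trace_munit_mul.
exact: trace_munit_mul.
Qed.

(** [resonant A V] is known to lie in [g], while the compression of [V] is not; on elements
    supported on the plane both have the same bracket, and the scalar part of the compression is
    central. *)
Lemma resonant_slvec V x1 x2 x3 : adj V = V -> g V -> g (slvec x1 x2 x3) ->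
  let a1 := halfdiff V in let a2 := offdiag V in let a3 := conjc (offdiag V) in
  g (slvec (br1 a1 a2 a3 x1 x2 x3) (br2 a1 a2 a3 x1 x2 x3) (br3 a1 a2 a3 x1 x2 x3)).
Proof.
move=> hV gV gx /=; have [_ _ _ gB] := gL.
have := gB _ _ (resonant_in gL hA gA gV) gx; rewrite resonant_pair (compress_slvec hV) -slvec_br.
have [q r] := slvec_specproj x1 x2 x3.
have [d1 d2] := @diagpart_pair V (slvec x1 x2 x3) ltac:(by rewrite q r).
have [_ _] := slvec_specproj (halfdiff V) (offdiag V) (conjc (offdiag V)).
move: (slvec x1 x2 x3) (slvec (halfdiff V) _ _) (diagpart V) q r d1 d2 => X Y D q r d1 d2.
rewrite 2!mulmxDl 2!mulmxDr d1 d2 -scalemxAl -scalemxAr q r !addr0.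
by rewrite opprD addrACA subrr addr0.
Qed.

(** The bracket of the two resonant parts lies in sl(E) and in [g]. Together with its brackets with
    [V1] and [V2] it forms a basis of sl(E), unless its Killing norm vanishes; but then some real
    combination of [V1] and [V2] would compress to a scalar. *)
Lemma conical_slproj V1 V2 : adj V1 = V1 -> adj V2 = V2 -> g V1 -> g V2 ->
  (forall p q : R, (p != 0) || (q != 0) -> forall k : R,
     Q *m (cR p *: V1 + cR q *: V2) *m Q != cR k *: Q) ->
  forall Y, g (slproj Q Y).
Proof.
move=> h1 h2 g1 g2 indep.
have [a1 a1E] := hermitian_halfdiff h1; have [a2 a2E] := hermitian_halfdiff h2.
have [s1 s1E] := hermitian_halfsum h1; have [s2 s2E] := hermitian_halfsum h2.
have [g0 gD gZ gB] := gL.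
pose b1 := offdiag V1; pose b2 := offdiag V2.
pose c1 := br1 (cR a1) b1 (conjc b1) (cR a2) b2 (conjc b2).
pose c2 := br2 (cR a1) b1 (conjc b1) (cR a2) b2 (conjc b2).
pose c3 := br3 (cR a1) b1 (conjc b1) (cR a2) b2 (conjc b2).
have gc : g (slvec c1 c2 c3).
  have := gB _ _ (resonant_in gL hA gA g1) (resonant_in gL hA gA g2).
  rewrite !resonant_pair (compress_slvec h1) (compress_slvec h2) a1E a2E /c1 /c2 /c3 -slvec_br.
  have [q1 r1] := slvec_specproj (cR a1) b1 (conjc b1).
  have [q2 r2] := slvec_specproj (cR a2) b2 (conjc b2).
  have QQ := specproj_idem hA S.
  have DC := diagpartC V1 V2.
  have [d1 d2] := @diagpart_pair V1 (slvec (cR a2) b2 (conjc b2) + halfsum V2 *: Q)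
    ltac:(by rewrite mulmxDr mulmxDl q2 r2 -scalemxAr -scalemxAl QQ QQ).
  have [d3 d4] := @diagpart_pair V2 (slvec (cR a1) b1 (conjc b1) + halfsum V1 *: Q)
    ltac:(by rewrite mulmxDr mulmxDl q1 r1 -scalemxAr -scalemxAl QQ QQ).
  move: d1 d2 d3 d4 q1 r1 q2 r2; rewrite -/b1 -/b2.
  move: (slvec (cR a1) _ _) (slvec (cR a2) _ _) (halfsum V1) (halfsum V2) DC => X1 X2 t1 t2 DC.
  move=> d1 d2 d3 d4 q1 r1 q2 r2.
  rewrite [(_ + _ + diagpart V1) *m _]mulmxDl mulmxDr d4 addr0 mulmxDr d1 add0r.
  rewrite [(_ + _ + diagpart V2) *m _]mulmxDl mulmxDr d2 addr0 mulmxDr d3 add0r DC.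
  rewrite opprD addrACA subrr addr0.
  rewrite !mulmxDl !mulmxDr -!scalemxAl -!scalemxAr q1 r1 q2 r2 QQ.
  congr (g _); move: (X1 *m X2) (X2 *m X1) Q => Y1 Y2 Q1; by mxadd.
have gu := resonant_slvec h1 g1 gc; have gw := resonant_slvec h2 g2 gc.
rewrite /= a1E -/b1 in gu; rewrite /= a2E -/b2 in gw.
have N0 : c1 ^+ 2 + c2 * c3 != 0.
  apply/negP => /eqP.
  case b1E : (offdiag V1) => [x1 y1]; case b2E : (offdiag V2) => [x2 y2].
  rewrite /c1 /c2 /c3 (hermitian_killing _ _ b1E b2E) -cR0 => /cR_inj E1.
  have [p [q [pq e1 e2 e3]]] : exists p q : R, [/\ (p != 0) || (q != 0), p * a1 + q * a2 = 0,
      p * x1 + q * x2 = 0 & p * y1 + q * y2 = 0].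
    have := sqr_ge0 (a1 * x2 - x1 * a2); have := sqr_ge0 (a1 * y2 - y1 * a2).
    have := sqr_ge0 (y1 * x2 - x1 * y2) => k1 k2 k3.
    by apply: cross_eq0_dep; apply/eqP; rewrite -sqrf_eq0; apply/eqP; lra.
  have /negP := indep p q pq (p * s1 + q * s2); apply; apply/eqP.
  rewrite mulmxDr mulmxDl -!scalemxAr -!scalemxAl (compress_slvec h1) (compress_slvec h2).
  rewrite a1E a2E s1E s2E b1E b2E (scalerDr (cR p)) (scalerDr (cR q)) addrACA slvec_comb !scalerA -scalerDl.
  rewrite -!cRM -!cRD e1.
  have -> : cR p * Complex x1 y1 + cR q * Complex x2 y2 = 0.
    by apply/eqP; rewrite eq_complex /= !mul0r !subr0 !addr0 e2 e3 !eqxx.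
  have -> : cR p * conjc (Complex x1 y1) + cR q * conjc (Complex x2 y2) = 0.
    by apply/eqP; rewrite eq_complex /= !mul0r !subr0 !addr0 !mulrN -opprD e2 e3 oppr0 !eqxx.
  by rewrite /slvec !scale0r !add0r.
have dne0 : - 4 * (c1 ^+ 2 + c2 * c3) ^+ 2 != 0 :> C.
  by rewrite mulf_neq0 ?oppr_eq0 ?pnatr_eq0 // expf_neq0.
rewrite -sl2_det in dne0.
have gall x1 x2 x3 : g (slvec x1 x2 x3).
  have [p [q [r [-> -> ->]]]] := basis3 dne0 x1 x2 x3.
  have := gD _ _ (gD _ _ (gZ p _ gc) (gZ q _ gu)) (gZ r _ gw); congr (g _).
  rewrite slvec_comb; set x := slvec _ _ _; rewrite -[x]scale1r /x slvec_comb !mul1r.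
  by [].
apply: slproj_in_of_pair => //.
- by have := gall 0 1 0; rewrite /slvec !scale0r scale1r add0r addr0.
- by have := gall 0 0 1; rewrite /slvec !scale0r scale1r !add0r.
- by have := gall 1 0 0; rewrite /slvec !scale0r scale1r !addr0.
Qed.
End Conical.
End LocalConstancy.

(** * Degenerate perturbation theory *)

Section Realification.
Variable R : realType.
Variables (n p : nat).
Local Notation C := (complex R).

(** Spans are taken over the reals while entries are complex; flattening to real rows makes the rank
    calculus over [R] applicable. *)
Definition realify (X : 'M[C]_n) : 'rV[R]_(n * n + n * n) :=
  row_mx (map_mx (@complex.Re R) (mxvec X)) (map_mx (@complex.Im R) (mxvec X)).

Definition lincomb (B : 'I_p -> 'M[C]_n) (x : 'rV[R]_p) : 'M[C]_n := \sum_i cR (x 0 i) *: B i.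
Definition realbasis (B : 'I_p -> 'M[C]_n) : 'M[R]_(p, n * n + n * n) := \matrix_i realify (B i).

Lemma realify_inj : injective realify.
Proof.
move=> X Y /eq_row_mx [h1 h2]; rewrite -[X]mxvecK -[Y]mxvecK; congr vec_mx.
apply/rowP => k; have := congr1 (fun M : 'rV_(n * n) => M 0 k) h1; have := congr1 (fun M : 'rV_(n * n) => M 0 k) h2.
by rewrite !mxE; case: (mxvec X 0 k) => a b; case: (mxvec Y 0 k) => c d /= -> ->.
Qed.

Lemma realify_lincomb B x : realify (lincomb B x) = x *m realbasis B.
Proof.
apply/rowP => k; rewrite [RHS]mxE /realify.
under eq_bigr => i _ do rewrite [realbasis B i k]mxE /realify.
rewrite -[k]splitK; case: (fintype.split k) => l /=.
  rewrite row_mxEl mxE linear_sum /= summxE Re_sum; apply: eq_bigr => i _.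
  by rewrite row_mxEl linearZ /= mxE [in RHS]mxE; case: (mxvec (B i) 0 l) => a b /=; rewrite mul0r subr0.
rewrite row_mxEr mxE linear_sum /= summxE Im_sum; apply: eq_bigr => i _.
by rewrite row_mxEr linearZ /= mxE [in RHS]mxE; case: (mxvec (B i) 0 l) => a b /=; rewrite mul0r addr0.
Qed.

Lemma realify_entry X k : `|realify X 0 k| <= mn X.
Proof.
rewrite /realify -[k]splitK; case: (fintype.split k) => l /=; rewrite ?row_mxEl ?row_mxEr mxE -mn_mxvec.
  by apply: (le_trans (Re_le_cn _)); exact: mn_entry.
by apply: (le_trans (Im_le_cn _)); exact: mn_entry.
Qed.

Definition n1 q (v : 'rV[R]_q) : R := \sum_k `|v 0 k|.

Lemma n1_ge0 q (v : 'rV[R]_q) : 0 <= n1 v.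
Proof. by apply: sumr_ge0. Qed.

Lemma n1_mulmx q (X : 'M[C]_n) (M : 'M[R]_(n * n + n * n, q)) :
  n1 (realify X *m M) <= mn X * \sum_i \sum_j `|M i j|.
Proof.
rewrite /n1 exchange_big /= mulr_sumr; apply: ler_sum => j _; rewrite mxE mulr_sumr.
apply: (le_trans (ler_norm_sum _ _ _)); apply: ler_sum => i _; rewrite normrM.
by apply: ler_wpM2r => //; exact: realify_entry.
Qed.

(** Quantitative injectivity, read off a pseudo-inverse of the basis matrix instead of a compactness
    argument. *)
Lemma lincomb_lower_bound B : (forall x, lincomb B x = 0 -> x = 0) ->
  exists2 c : R, 0 < c & forall x, n1 x <= c * mn (lincomb B x).
Proof.
move=> inj; have free : row_free (realbasis B).
  rewrite -kermx_eq0; apply/rowV0P => x /sub_kermxP E; apply: inj; apply: realify_inj.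
  by rewrite realify_lincomb E /realify linear0 !map_mx0 row_mx0.
exists (1 + \sum_i \sum_j `|pinvmx (realbasis B) i j|).
  by rewrite ltr_wpDr // sumr_ge0 // => i _; rewrite sumr_ge0.
move=> x; rewrite -{1}(mulmxKp free x) -realify_lincomb mulrC.
apply: (le_trans (n1_mulmx _ _)); apply: ler_wpM2l => //; by rewrite lerDr.
Qed.

Lemma lincomb_coords B : exists2 c : R, 0 < c & forall X, (realify X <= realbasis B)%MS ->
  exists2 x, lincomb B x = X & n1 x <= c * mn X.
Proof.
exists (1 + \sum_i \sum_j `|pinvmx (realbasis B) i j|).
  by rewrite ltr_wpDr // sumr_ge0 // => i _; rewrite sumr_ge0.
move=> X XB; exists (realify X *m pinvmx (realbasis B)).
  by apply: realify_inj; rewrite realify_lincomb mulmxKpV.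
rewrite mulrC; apply: (le_trans (n1_mulmx _ _)); apply: ler_wpM2l => //; by rewrite lerDr.
Qed.

Lemma lincomb_mn B : exists2 c : R, 0 < c & forall x, mn (lincomb B x) <= c * n1 x.
Proof.
exists (1 + \sum_i mn (B i)); first by rewrite ltr_wpDr // sumr_ge0.
move=> x; apply: (le_trans (mn_sum _ _ _)); rewrite /n1 mulr_sumr; apply: ler_sum => i _.
rewrite mn_cR mulrC; apply: ler_wpM2r => //.
by rewrite (bigD1 i) //= addrCA lerDl addr_ge0 // sumr_ge0.
Qed.
End Realification.

(** * Splitting of a multiple eigenvalue *)

Section DoubleEigenvalue.
Variable R : realType.
Variable n : nat.
Local Notation C := (complex R).
Variable A : 'M[C]_n.
Hypothesis hA : is_hermitian A.
Variable S : {set 'I_n}.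
Hypothesis iS : isolated A S.
Variable mu : R.
Hypothesis lamS : forall k, k \in S -> lam A k = mu.
Local Notation Q := (specproj A S).

Lemma specproj_eigen : Q *m A = cR mu *: Q.
Proof.
rewrite specprojE mulmx_suml scaler_sumr; apply: eq_bigr => k kS.
by rewrite (eigproj_mulr hA) lamS.
Qed.

(** The eigenvalue equation of [B] compressed by [Q]. Every term on the right has two small factors,
    so [l - mu] is an eigenvalue of the compressed perturbation up to second order. *)
Lemma first_order_id (B Qb V P : 'M[C]_n) (l : R) : B = A + V -> B *m P = cR l *: P -> Qb *m P = P ->
  Q *m V *m Q *m P - cR (l - mu) *: P =
  - (Q *m V *m ((Qb - Q) *m P)) - cR (l - mu) *: ((Qb - Q) *m P).
Proof.
move=> BE BP QP; have E1 : Q *m V *m P = cR (l - mu) *: (Q *m P).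
  have -> : V = B - A by rewrite BE addrC addKr.
  by rewrite mulmxBr mulmxBl -mulmxA BP specproj_eigen -scalemxAr -scalemxAl cRB scalerBl.
rewrite [in RHS]mulmxBl QP mulmxBr E1 mulmxA scalerBr.
move: (Q *m V *m Q *m P) (cR (l - mu)) (Q *m P) => X c Y.
by mxadd.
Qed.

Lemma first_order : exists c e : R, [/\ 0 < c, 0 < e & forall B, is_hermitian B -> mn (B - A) < e ->
  forall k, k \in S ->
   mn (Q *m (B - A) *m Q *m eigproj B k - cR (lam B k - mu) *: eigproj B k) <= c * mn (B - A) ^+ 2].
Proof.
have [c [e [c0 e0 lip]]] := specproj_lip hA iS.
pose p := projbound R n; have p0 : 0 <= p by exact: projbound_ge0.
exists (mn Q * (c * p) + 2 * (c * p) + 1), e; split => //.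
  by rewrite ltr_wpDl // addr_ge0 // !mulr_ge0 // ltW.
move=> B hB he k kS; have hl := lip B hB he.
have QP : specproj B S *m eigproj B k = eigproj B k by rewrite (specprojr hB) kS.
have BE : B = A + (B - A) by rewrite addrC subrK.
rewrite (first_order_id BE (eigproj_mul hB k) QP).
have hd : `|lam B k - mu| <= 2 * mn (B - A) by rewrite -(lamS kS); exact: lam_lip.
move: hl hd; move: (specproj B S - Q) (B - A) => Z V hl hd.
have hP : mn (eigproj B k) <= p by exact: eigproj_mn.
have hZP : mn (Z *m eigproj B k) <= c * mn V * p.
  by apply: (le_trans (mnM _ _)); apply: ler_pM.
apply: (le_trans (mnB _ _)); rewrite mnN mn_cR.
have h1 : mn (Q *m V *m (Z *m eigproj B k)) <= mn Q * mn V * (c * mn V * p).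
  by apply: (le_trans (mnM _ _)); apply: ler_pM => //; exact: mnM.
have h2 : `|lam B k - mu| * mn (Z *m eigproj B k) <= 2 * mn V * (c * mn V * p) by apply: ler_pM.
apply: (le_trans (lerD h1 h2)); rewrite [leRHS]mulrDl mul1r; apply: ler_wpDr; first exact: exprn_ge0.
by rewrite le_eqVlt; apply/orP; left; apply/eqP; ring.
Qed.

Lemma eigproj_mn_ge1 (B : 'M[C]_n) k : is_hermitian B -> 1 <= mn (eigproj B k).
Proof. by move=> hB; rewrite -[X in X <= _](@cn1 R) -(eigproj_tr hB k); exact: mn_tr. Qed.

(** A scalar compression makes all eigenvalues of the group move together up to second order, which
    is incompatible with a splitting linear in t. *)
Lemma split_bound : exists c e : R, [/\ 0 < c, 0 < e & forall B (k0 : R), is_hermitian B -> mn (B - A) < e ->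
  Q *m (B - A) *m Q = cR k0 *: Q -> forall k, k \in S ->
   `|lam B k - mu - k0| <= c * mn (B - A) ^+ 2].
Proof.
have [c1 [e1 [c10 e10 lip]]] := specproj_lip hA iS.
have [c2 [e2 [c20 e20 fo]]] := first_order.
pose p := projbound R n; have p0 : 0 <= p by exact: projbound_ge0.
pose q := mn Q; have q0 : 0 <= q by exact: mn_ge0.
exists (c2 + q * q * p * (c1 * p)), (Num.min e1 e2); split.
- by rewrite ltr_wpDr // !mulr_ge0 // ltW.
- by rewrite lt_min e10.
move=> B k0 hB; rewrite lt_min => /andP [he1 he2] QV k kS.
have k0V : `|k0| <= q * q * p * mn (B - A).
  apply: (@le_trans _ _ (`|k0| * mn (eigproj A k))); first by rewrite ler_peMr // eigproj_mn_ge1.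
  rewrite -mn_cR; have -> : cR k0 *: eigproj A k = Q *m (B - A) *m Q *m eigproj A k.
    by rewrite QV -scalemxAl (specprojr hA) kS.
  apply: (@le_trans _ _ (q * mn (B - A) * q * p)); last first.
    by rewrite le_eqVlt; apply/orP; left; apply/eqP; ring.
  apply: (le_trans (mnM _ _)); apply: ler_pM => //; last exact: eigproj_mn.
  by apply: (le_trans (mnM _ _)); apply: ler_wpM2r => //; exact: mnM.
have hl := lip B hB he1; have := fo B hB he2 k kS; rewrite QV.
have QP : specproj B S *m eigproj B k = eigproj B k by rewrite (specprojr hB) kS.
have hP : mn (eigproj B k) <= p by exact: eigproj_mn.
have P1 := eigproj_mn_ge1 k hB.
have d0 : 0 <= mn (B - A) by [].
move: d0 hl QP hP P1 k0V; move: (mn (B - A)) => d d0; move: (specproj B S) (eigproj B k) => Qb P hl QP hP P1 k0d h.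
have E1 : cR (lam B k - mu - k0) *: P = - (cR k0 *: Q *m P - cR (lam B k - mu) *: P) - cR k0 *: ((Qb - Q) *m P).
  rewrite cRB scalerBl -scalemxAl mulmxBl QP scalerBr.
  move: (cR (lam B k - mu) *: P) (cR k0 *: P) (cR k0 *: (Q *m P)) => X Y Z; by mxadd.
have h3 : `|lam B k - mu - k0| * mn P <= c2 * d ^+ 2 + q * q * p * d * (c1 * d * p).
  rewrite -mn_cR E1; apply: (le_trans (mnB _ _)); rewrite mnN mn_cR; apply: lerD => //.
  by apply: ler_pM => //; apply: (le_trans (mnM _ _)); apply: ler_pM.
apply: (@le_trans _ _ (`|lam B k - mu - k0| * mn P)); first by rewrite ler_peMr.
apply: (le_trans h3); rewrite mulrDl; apply: lerD => //.
by rewrite le_eqVlt; apply/orP; left; apply/eqP; ring.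
Qed.

(** A converse of [split_bound]: eigenvalues that remain equal force a nearly scalar compression.
    Summing [first_order] over [S] replaces the individual eigenprojections of [B] by their sum,
    which is close to [Q]. *)
Lemma scalar_bound : exists c e : R, [/\ 0 < c, 0 < e & forall B (m1 : R), is_hermitian B -> mn (B - A) < e ->
  (forall k, k \in S -> lam B k = m1) ->
  mn (Q *m (B - A) *m Q - cR (m1 - mu) *: Q) <= c * mn (B - A) ^+ 2].
Proof.
have [c1 [e1 [c10 e10 lip]]] := specproj_lip hA iS.
have [c2 [e2 [c20 e20 fo]]] := first_order.
(* With [S] empty nothing relates [m1] to [mu], but then [Q] vanishes. *)
have [S0|[k0 k0S]] := set_0Vmem S.
  exists 1, 1; split => // B m1 _ _ _.
  by rewrite specprojE S0 big_set0 mul0mx mul0mx scaler0 subr0 mn0 mul1r exprn_ge0.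
pose q := mn Q; have q0 : 0 <= q by exact: mn_ge0.
exists (n%:R * c2 + (q * q * c1 + 2 * c1)), (Num.min e1 e2); split.
- by rewrite ltr_wpDl ?mulr_ge0 // ?(ltW c20) // ltr_wpDl ?mulr_ge0 // ?(ltW c10) // mulr_gt0.
- by rewrite lt_min e10.
move=> B m1 hB; rewrite lt_min => /andP [he1 he2] lamB.
have hl := lip B hB he1.
have hd : `|m1 - mu| <= 2 * mn (B - A) by rewrite -(lamS k0S) -(lamB k0 k0S); exact: lam_lip.
have hs : mn (Q *m (B - A) *m Q *m specproj B S - cR (m1 - mu) *: specproj B S) <= n%:R * (c2 * mn (B - A) ^+ 2).
  rewrite [specproj B S]specprojE mulmx_sumr scaler_sumr -sumrB.
  apply: (le_trans (mn_sum _ _ _)).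
  apply: (le_trans (ler_sum _ (G := fun=> c2 * mn (B - A) ^+ 2) _)); last first.
    by apply: sum_card_le; rewrite mulr_ge0 ?exprn_ge0 // ltW.
  by move=> k kS; rewrite -(lamB k kS); apply: fo.
have QQ := specproj_idem hA S.
move: hl hd hs; rewrite -/q; move: (B - A) (specproj B S) => V Qb hl hd hs.
have E1 : Q *m V *m Q - cR (m1 - mu) *: Q = (Q *m V *m Q *m Qb - cR (m1 - mu) *: Qb)
   - (Q *m V *m Q *m (Qb - Q) - cR (m1 - mu) *: (Qb - Q)).
  rewrite mulmxBr scalerBr -[Q *m V *m Q *m Q]mulmxA QQ.
  move: (Q *m V *m Q *m Qb) (Q *m V *m Q) (cR (m1 - mu)) Q => X Y c Q1; by mxadd.
rewrite E1; apply: (le_trans (mnB _ _)); rewrite mulrDl -mulrA; apply: lerD => //.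
apply: (le_trans (mnB _ _)); rewrite mn_cR mulrDl; apply: lerD.
  apply: (@le_trans _ _ (q * mn V * q * (c1 * mn V))); last first.
    by rewrite le_eqVlt; apply/orP; left; apply/eqP; ring.
  apply: (le_trans (mnM _ _)); apply: ler_pM => //.
  by apply: (le_trans (mnM _ _)); apply: ler_wpM2r => //; exact: mnM.
apply: (@le_trans _ _ (2 * mn V * (c1 * mn V))); first by apply: ler_pM.
by rewrite le_eqVlt; apply/orP; left; apply/eqP; ring.
Qed.
End DoubleEigenvalue.

(** * Conical intersections *)

Section ParameterDependence.
Variable R : realType.
Variables n m : nat.
Local Notation C := (complex R).
Variables (H0 : 'M[C]_n) (Hs : 'I_m -> 'M[C]_n).
Hypothesis hH0 : is_hermitian H0.
Hypothesis hHs : forall k, is_hermitian (Hs k).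
Local Notation H := (Hu H0 Hs).

Lemma lincomb_hermitian (B : 'I_m -> 'M[C]_n) v : (forall k, is_hermitian (B k)) -> is_hermitian (lincomb B v).
Proof.
move=> hB; rewrite /is_hermitian adj_sum; apply: eq_bigr => k _.
by rewrite adjZ conj_cR hB.
Qed.

Lemma Hu_hermitian u : is_hermitian (H u).
Proof. by rewrite /is_hermitian adjD hH0; congr (_ + _); exact: lincomb_hermitian. Qed.

Lemma HuB w u : H w - H u = lincomb Hs (w - u).
Proof.
rewrite /Hu opprD addrACA subrr add0r -sumrB; apply: eq_bigr => k _.
by rewrite -scalerBl -cRB !mxE.
Qed.

Lemma lincombZ p (B : 'I_p -> 'M[C]_n) t v : lincomb B (t *: v) = cR t *: lincomb B v.
Proof. by rewrite scaler_sumr; apply: eq_bigr => k _; rewrite mxE scalerA cRM. Qed.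

Lemma n1Z q t (v : 'rV[R]_q) : n1 (t *: v) = `|t| * n1 v.
Proof. by rewrite mulr_sumr; apply: eq_bigr => k _; rewrite mxE normrM. Qed.
Lemma n1D q (v w : 'rV[R]_q) : n1 (v + w) <= n1 v + n1 w.
Proof. by rewrite -big_split; apply: ler_sum => k _; rewrite mxE; exact: ler_normD. Qed.
Lemma n1N q (v : 'rV[R]_q) : n1 (- v) = n1 v.
Proof. by apply: eq_bigr => k _; rewrite mxE normrN. Qed.
Lemma n1_eq0 q (v : 'rV[R]_q) : n1 v = 0 -> v = 0.
Proof.
move=> v0; apply/rowP => k; rewrite mxE; apply/eqP; rewrite -normr_eq0; apply/eqP.
exact: (psumr_eq0P (P := xpredT) (F := fun k => `|v 0 k|) (fun i _ => normr_ge0 _) v0).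
Qed.
Lemma n1_gt0 q (v : 'rV[R]_q) : v != 0 -> 0 < n1 v.
Proof. by move=> v0; rewrite lt_neqAle n1_ge0 andbT eq_sym; apply: contra v0 => /eqP /n1_eq0 ->. Qed.
Lemma n10 q : n1 (0 : 'rV[R]_q) = 0.
Proof. by rewrite /n1 big1 // => k _; rewrite mxE normr0. Qed.

Lemma n1_entry q (v : 'rV[R]_q) k : `|v 0 k| <= n1 v.
Proof. by rewrite /n1 (bigD1 k) //= lerDl sumr_ge0. Qed.

(** Neighborhoods of row vectors come from the sup norm; this lemma and the next pass to [n1], which
    matches the estimates in [mn]. *)
Lemma open_n1 q (U : set 'rV[R]_q) u : open U -> U u -> exists2 e : R, 0 < e & forall w, n1 (w - u) < e -> U w.
Proof.
move=> oU Uu; have /nbhs_ballP [e /= e0 be] : nbhs u U by apply: open_nbhs_nbhs.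
exists e => // w wu; apply: be; split => // i j; rewrite (ord1 i) /ball /= distrC.
by apply: le_lt_trans wu; have := n1_entry (w - u) j; rewrite !mxE.
Qed.

Lemma n1_open q (U : set 'rV[R]_q) :
  (forall u, U u -> exists2 e : R, 0 < e & forall w, n1 (w - u) < e -> U w) -> open U.
Proof.
move=> h; rewrite openE => u Uu; have [e e0 he] := h u Uu.
apply/nbhs_ballP; exists (e / (q%:R + 1)) => /=; first by rewrite divr_gt0 // ltr_wpDl.
move=> w [_ bw]; apply: he; rewrite /n1.
apply: (@le_lt_trans _ _ (\sum_(k < q) e / (q%:R + 1))).
  apply: ler_sum => k _; have := bw 0 k; rewrite /ball /= distrC !mxE; exact: ltW.
rewrite sumr_const card_ord -[X in X < _]mulr_natl mulrCA -[X in _ < X]mulr1 ltr_pM2l //.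
by rewrite ltr_pdivrMr ?ltr_wpDl // mul1r ltrDl.
Qed.

Lemma Hu_lip : exists2 c : R, 0 < c & forall w u, mn (H w - H u) <= c * n1 (w - u).
Proof. by have [c c0 hc] := lincomb_mn Hs; exists c => // w u; rewrite HuB. Qed.

Lemma count_lam (A : 'M[C]_n) x : is_hermitian A ->
  count_mem x (eigseq A) = #|[set k : 'I_n | lam A k == x]%SET|.
Proof.
move=> hA; have [_ [_ _ sz _]] := lam_diag hA.
rewrite -sum1_count (big_nth 0) sz big_mkord -sum1_card.
by apply: eq_bigl => k; rewrite inE.
Qed.

Lemma double_eigenvalue (A : 'M[C]_n) (j1 j2 : 'I_n) : is_hermitian A -> j1 != j2 -> lam A j1 = lam A j2 ->
  count_mem (lam A j1) (eigseq A) = 2%N ->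
  forall k : 'I_n, (lam A k == lam A j1) = (k \in [set j1; j2]%SET).
Proof.
move=> hA j12 e12; rewrite (count_lam _ hA) => c2 k.
have /eqP -> : [set j1; j2]%SET == [set k : 'I_n | lam A k == lam A j1]%SET.
  rewrite eqEcard c2 cards2 j12 andbT; apply/fintype.subsetP => i.
  by rewrite !inE => /orP [] /eqP ->; rewrite ?e12.
by rewrite !inE.
Qed.

Lemma double_isolated (A : 'M[C]_n) (j1 j2 : 'I_n) : is_hermitian A -> j1 != j2 -> lam A j1 = lam A j2 ->
  count_mem (lam A j1) (eigseq A) = 2%N -> isolated A [set j1; j2]%SET.
Proof.
move=> hA j12 e12 c2 k l kS lS; have D := double_eigenvalue hA j12 e12 c2.
move: (kS) (lS); rewrite -!D => /eqP -> h; by rewrite eq_sym.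
Qed.

Section ConicalPoint.
Variables (j1 j2 : 'I_n) (ub : 'rV[R]_m).
Hypothesis j12 : j2 = j1.+1 :> nat.
Hypothesis con : conical_int H j1 ub.
Local Notation S := [set j1; j2]%SET.
Local Notation Q := (specproj (H ub) S).

Lemma conical_neq : j1 != j2.
Proof. by rewrite -val_eqE /= j12; lia. Qed.

Lemma conical_lam : lam (H ub) j1 = lam (H ub) j2.
Proof. by case: con; rewrite j12. Qed.

Lemma conical_isolated : isolated (H ub) S.
Proof.
case: con => _ c2 _; apply: double_isolated => //; first exact: Hu_hermitian.
  exact: conical_neq.
exact: conical_lam.
Qed.

Lemma conical_lamS k : k \in S -> lam (H ub) k = lam (H ub) j1.
Proof. by rewrite !inE => /orP [] /eqP ->; rewrite ?conical_lam. Qed.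

(** Otherwise [split_bound] would make the splitting along [v] of order t^2, against the linear
    lower bound in the definition of a conical intersection. *)
Lemma conical_unit_nonscalar v k0 : eunit v -> Q *m lincomb Hs v *m Q != cR k0 *: Q.
Proof.
move=> v1; apply/negP => /eqP QV.
have [c [e [c0 e0 sb]]] := split_bound (Hu_hermitian ub) conical_isolated conical_lamS.
case: con => _ _ [cc cc0 /(_ v v1) [d d0 hd]].
pose y := mn (lincomb Hs v); have y0 : 0 <= y by exact: mn_ge0.
(* Three demands on t: below the threshold d of the conical inequality, within the perturbation
   radius e, and small enough for 2 c (t y)^2 to stay below cc t. Using [y + 1] covers y = 0. *)
pose t := Num.min (d / 2) (Num.min (e / (y + 1) / 2) (cc / (2 * c * (y + 1) ^+ 2 + 1) / 2)).
have y1 : 0 < y + 1 by rewrite ltr_wpDl.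
have cy : 0 < 2 * c * (y + 1) ^+ 2 + 1 by rewrite ltr_wpDl // !mulr_ge0 ?exprn_ge0 // ltW.
have t0 : 0 < t by rewrite !lt_min !divr_gt0.
have td : t < d.
  apply: (@le_lt_trans _ _ (d / 2)); first by rewrite ge_min lexx.
  by rewrite ltr_pdivrMr // mulr_natr mulr2n ltrDl.
have te : t * (y + 1) < e.
  rewrite -ltr_pdivlMr //; apply: (@le_lt_trans _ _ (e / (y + 1) / 2)).
    by rewrite !ge_min lexx orbT.
  by rewrite ltr_pdivrMr // mulr_natr mulr2n ltrDl divr_gt0.
have tc : 2 * c * (y + 1) ^+ 2 * t < cc.
  apply: (@le_lt_trans _ _ ((2 * c * (y + 1) ^+ 2 + 1) * t)).
    by apply: ler_wpM2r; rewrite ?(ltW t0) // lerDl.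
  rewrite mulrC -ltr_pdivlMr //; apply: (@le_lt_trans _ _ (cc / (2 * c * (y + 1) ^+ 2 + 1) / 2)).
    by rewrite !ge_min lexx !orbT.
  by rewrite ltr_pdivrMr // mulr_natr mulr2n ltrDl divr_gt0.
have BE : H (ub + t *: v) - H ub = cR t *: lincomb Hs v by rewrite HuB addrC addKr lincombZ.
have mnB : mn (H (ub + t *: v) - H ub) = t * y by rewrite BE mn_cR ger0_norm // ltW.
have hB := Hu_hermitian (ub + t *: v).
have QB : Q *m (H (ub + t *: v) - H ub) *m Q = cR (t * k0) *: Q.
  by rewrite BE -scalemxAr -scalemxAl QV scalerA cRM.
have lt_e : mn (H (ub + t *: v) - H ub) < e.
  by rewrite mnB; apply: le_lt_trans te; rewrite ler_wpM2l // ?(ltW t0) // lerDl.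
have hS k : k \in S -> `|lam (H (ub + t *: v)) k - lam (H ub) j1 - t * k0| <= c * (t * y) ^+ 2.
  by move=> kS; rewrite -mnB; apply: sb.
have := hd t t0 td; rewrite -j12.
have := hS j1 (set21 _ _); have := hS j2 (set22 _ _).
move: (lam _ j2) (lam _ j1) (lam (H ub) j1) => l2 l1 mu a1 a2 a3.
have a4 : l2 - l1 <= 2 * c * (t * y) ^+ 2.
  have -> : l2 - l1 = (l2 - mu - t * k0) - (l1 - mu - t * k0) by ring.
  apply: (le_trans (ler_norm _)); apply: (le_trans (ler_normB _ _)).
  by move: a1 a2; rewrite -mulrA; lra.
have a5 : 2 * c * (t * y) ^+ 2 <= (2 * c * (y + 1) ^+ 2 * t) * t.
  have -> : 2 * c * (y + 1) ^+ 2 * t * t = 2 * c * (t * (y + 1)) ^+ 2 by ring.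
  apply: ler_wpM2l; first by rewrite mulr_ge0 // ltW.
  rewrite ler_sqr ?nnegrE ?mulr_ge0 ?(ltW t0) ?(ltW y1) //.
  by rewrite ler_wpM2l ?(ltW t0) // lerDl.
have a6 : (2 * c * (y + 1) ^+ 2 * t) * t < cc * t by rewrite ltr_pM2r.
have := lt_le_trans a3 (le_trans a4 a5); rewrite ltNge => /negP; apply; exact: ltW.
Qed.

Lemma conical_nonscalar v k0 : v != 0 -> Q *m lincomb Hs v *m Q != cR k0 *: Q.
Proof.
move=> v0; pose r := \sum_k v 0 k ^+ 2.
have r0 : 0 < r.
  rewrite lt_neqAle sumr_ge0 ?andbT => [|k _]; last exact: sqr_ge0.
  rewrite eq_sym; apply: contra v0 => /eqP r0; apply/eqP/rowP => k; rewrite mxE; apply/eqP.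
  rewrite -sqrf_eq0; apply/eqP.
  exact: (psumr_eq0P (P := xpredT) (F := fun k => v 0 k ^+ 2) (fun i _ => sqr_ge0 _) r0).
have s0 : 0 < Num.sqrt r by rewrite sqrtr_gt0.
have v1 : eunit ((Num.sqrt r)^-1 *: v).
  rewrite /eunit; under eq_bigr => k _ do rewrite mxE exprMn.
  by rewrite -mulr_sumr -/r exprVn sqr_sqrtr ?(ltW r0) // mulVf // gt_eqF.
apply: contra (conical_unit_nonscalar ((Num.sqrt r)^-1 * k0) v1) => /eqP E.
by rewrite lincombZ -scalemxAr -scalemxAl E scalerA cRM.
Qed.

(** By [conical_nonscalar], [Q] and the compressed directions are independent over the reals, so the
    compression of [lincomb Hs v] stays at distance at least a multiple of |v| from the scalars,
    uniformly in the direction; equal eigenvalues at [ub + v] would make this distance quadratic in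
    |v|. *)
Lemma conical_punctured : exists2 e : R, 0 < e & forall w, 0 < n1 (w - ub) -> n1 (w - ub) < e ->
  lam (H w) j1 != lam (H w) j2.
Proof.
have [c [e [c0 e0 sb]]] := scalar_bound (Hu_hermitian ub) conical_isolated conical_lamS.
(* Index 0 stands for the scalars of the plane, the others for the compressed directions. *)
pose Bf (i : 'I_(1 + m)) := match fintype.split i with inl _ => Q | inr k => Q *m Hs k *m Q end.
have BfE k0 v : lincomb Bf (row_mx (const_mx k0) v) = cR k0 *: Q + Q *m lincomb Hs v *m Q.
  rewrite /lincomb big_split_ord big_ord1 /= row_mxEl mxE; congr (_ + _).
    by rewrite /Bf (unsplitK (inl _)).
  rewrite mulmx_sumr mulmx_suml; apply: eq_bigr => k _.
  by rewrite row_mxEr /Bf (unsplitK (inr _)) -scalemxAr -scalemxAl.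
have inj x : lincomb Bf x = 0 -> x = 0.
  rewrite -[x]hsubmxK; move: (lsubmx x) (rsubmx x) => a v.
  have -> : a = const_mx (a 0 0) by apply/matrixP => i j; rewrite !ord1 mxE.
  rewrite BfE => /eqP; rewrite addrC addr_eq0 -scaleNr -cRN => E.
  have v0 : v = 0 by apply/eqP; apply: contraTT E => v0; exact: conical_nonscalar.
  move: E; rewrite v0 /lincomb big1 => [|k _]; last by rewrite mxE cR0 scale0r.
  rewrite mulmx0 mul0mx eq_sym scaler_eq0 cR_eq0 oppr_eq0 => /orP [/eqP ->|/eqP Q0].
    exact: row_mx0.
  have := specproj_tr (Hu_hermitian ub) S; rewrite Q0 mxtrace0 cards2 conical_neq => /esym/eqP.
  by rewrite pnatr_eq0.
have [c1 c10 lb] := lincomb_lower_bound inj.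
have [c3 c30 lip] := Hu_lip.
(* At distance r less than 1 / K from [ub], the quadratic upper bound K r^2 falls below r. *)
pose K := c1 * c * c3 ^+ 2; have K0 : 0 < K by rewrite !mulr_gt0 ?exprn_gt0.
exists (Num.min (e / c3) K^-1); first by rewrite lt_min divr_gt0 // invr_gt0.
move=> w w0; rewrite lt_min => /andP [we wK]; apply/negP => /eqP l12.
have hw : mn (H w - H ub) < e.
  by apply: (le_lt_trans (lip w ub)); rewrite mulrC -ltr_pdivlMr.
have := sb (H w) (lam (H w) j1) (Hu_hermitian w) hw.
have hS k : k \in S -> lam (H w) k = lam (H w) j1 by rewrite !inE => /orP [] /eqP ->.
move=> /(_ hS) {hS}; move: (lam (H w) j1 - lam (H ub) j1) => k0 hk.
have := lb (row_mx (const_mx (- k0)) (w - ub)).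
rewrite BfE cRN scaleNr [- _ + _]addrC -(HuB w ub) => h1.
have h2 : n1 (w - ub) <= n1 (row_mx (const_mx (- k0)) (w - ub) : 'rV_(1 + m)).
  rewrite /n1 big_split_ord /= big_ord1; apply: ler_wpDl => //.
  by apply: ler_sum => k _; rewrite row_mxEr.
have h3 : n1 (w - ub) <= c1 * (c * (c3 * n1 (w - ub)) ^+ 2).
  apply: (le_trans h2); apply: (le_trans h1); rewrite ler_pM2l //; apply: (le_trans hk).
  rewrite ler_pM2l // ler_sqr ?nnegrE ?mn_ge0 //.
  by rewrite mulr_ge0 ?n1_ge0 // ltW.
have : n1 (w - ub) < n1 (w - ub); last by rewrite ltxx.
apply: (le_lt_trans h3); rewrite -[X in _ < X]mul1r.
have -> : c1 * (c * (c3 * n1 (w - ub)) ^+ 2) = K * n1 (w - ub) * n1 (w - ub) by rewrite /K; ring.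
rewrite ltr_pM2r // -[X in _ < X](mulfV (lt0r_neq0 K0)) ltr_pM2l //.
Qed.
End ConicalPoint.

Definition regular u := forall k l : 'I_n, k != l -> lam (H u) k != lam (H u) l.

Lemma regularP u : (forall j1 j2 : 'I_n, j2 = j1.+1 :> nat -> lam (H u) j1 != lam (H u) j2) -> regular u.
Proof.
move=> adj; suff lt (k l : 'I_n) : (k < l)%N -> lam (H u) k != lam (H u) l.
  move=> k l; rewrite neq_ltn => /orP [/lt //|/lt]; by rewrite eq_sym.
move=> kl; have h : (k.+1 < n)%N by exact: leq_ltn_trans (ltn_ord l).
have := adj k (Ordinal h) erefl => ne.
have hH := Hu_hermitian u.
have l1 := lam_nondecreasing hH (leqnSn k) h.
have l2 : lam (H u) k.+1 <= lam (H u) l by exact: lam_nondecreasing.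
have : lam (H u) k < lam (H u) l.
  by apply: lt_le_trans l2; rewrite lt_neqAle ne l1.
by rewrite lt_neqAle => /andP [].
Qed.

Lemma lipschitz_neq (f1 f2 : 'rV[R]_m -> R) (c : R) u : 0 < c ->
  (forall w, `|f1 w - f1 u| <= c * n1 (w - u)) -> (forall w, `|f2 w - f2 u| <= c * n1 (w - u)) ->
  f1 u != f2 u -> exists2 e : R, 0 < e & forall w, n1 (w - u) < e -> f1 w != f2 w.
Proof.
move=> c0 l1 l2 ne; have g0 : 0 < `|f1 u - f2 u| by rewrite normr_gt0 subr_eq0.
exists (`|f1 u - f2 u| / (2 * c)); first by rewrite divr_gt0 // mulr_gt0.
move=> w; rewrite ltr_pdivlMr ?mulr_gt0 // => hw; apply/negP => /eqP E.
have := l1 w; have := l2 w; rewrite -E.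
have := ler_normB (f1 w - f2 u) (f1 w - f1 u).
have -> : f1 w - f2 u - (f1 w - f1 u) = f1 u - f2 u by ring.
by move: hw; rewrite mulrC -mulrA; move: (c * _) `|_| `|_| `|_| => x y z t; lra.
Qed.

Lemma simple_open u (j1 j2 : 'I_n) : lam (H u) j1 != lam (H u) j2 ->
  exists2 e : R, 0 < e & forall w, n1 (w - u) < e -> lam (H w) j1 != lam (H w) j2.
Proof.
have [c c0 lip] := Hu_lip.
have lp w (k : 'I_n) : `|lam (H w) k - lam (H u) k| <= 2 * c * n1 (w - u).
  apply: (le_trans (lam_lip k (Hu_hermitian w) (Hu_hermitian u))).
  by rewrite -mulrA ler_pM2l //; exact: lip.
have c2 : 0 < 2 * c by rewrite mulr_gt0.
exact: (@lipschitz_neq (fun w => lam (H w) j1) (fun w => lam (H w) j2) _ u c2 (lp^~ j1) (lp^~ j2)).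
Qed.

Lemma regular_punctured (U : set 'rV[R]_m) u : open U -> U u ->
  (forall u j, U u -> (j.+1 < n)%N -> lam (H u) j = lam (H u) j.+1 -> conical_int H j u) ->
  exists2 e : R, 0 < e & forall w, 0 < n1 (w - u) -> n1 (w - u) < e -> U w /\ regular w.
Proof.
move=> oU Uu con; have [e1 e10 h1] := open_n1 oU Uu.
have pair (p : 'I_n * 'I_n) : exists2 e : R, 0 < e & forall w, 0 < n1 (w - u) -> n1 (w - u) < e ->
    p.2 = p.1.+1 :> nat -> lam (H w) p.1 != lam (H w) p.2.
  case: p => j1 j2 /=; have [j12|j12] := eqVneq (j2 : nat) j1.+1; last first.
    by exists 1 => // w _ _ E; rewrite E eqxx in j12.
  have [E|/eqP ne] := pselect (lam (H u) j1 = lam (H u) j2); last first.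
    have [e e0 he] := simple_open ne; exists e; first exact: e0.
    by move=> w _ hw _; apply: he.
  have cj : conical_int H j1 u by apply: con; rewrite -?j12.
  have [e e0 he] := conical_punctured j12 cj; exists e; first exact: e0.
  by move=> w w0 we _; apply: he.
pose ef p := projT1 (cid2 (pair p)).
have ef0 p : 0 < ef p by rewrite /ef; case: cid2.
have efP p w : 0 < n1 (w - u) -> n1 (w - u) < ef p -> p.2 = p.1.+1 :> nat -> lam (H w) p.1 != lam (H w) p.2.
  by rewrite /ef; case: cid2 => //= x _; apply.
exists (\big[Num.min/e1]_(p : 'I_n * 'I_n) ef p); first by apply: lt_bigmin.
move=> w w0 hw; split.
  by apply: h1; apply: (lt_le_trans hw); exact: bigmin_le_id.
apply: regularP => j1 j2 j12; apply: (efP (j1, j2)) => //.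
by apply: (lt_le_trans hw); rewrite (bigD1 (j1, j2)) //= ge_min lexx.
Qed.
End ParameterDependence.

(** * The generated Lie algebra *)

Section Punctured.
Variable R : realType.
Variable m : nat.
Implicit Types (P Q : 'rV[R]_m -> Prop) (u v w : 'rV[R]_m).

(** The center is excluded because the plane of a pair may fail to be isolated there; [specproj]
    then depends on the chosen eigenbasis and the value of the defect carries no information. *)
Definition punctured P u := exists2 e : R, 0 < e & forall w, 0 < n1 (w - u) -> n1 (w - u) < e -> P w.

Lemma punctured_all (I : finType) (P : I -> 'rV[R]_m -> Prop) u :
  (forall i, punctured (P i) u) -> punctured (fun w => forall i, P i w) u.
Proof.
move=> h; pose ef i := projT1 (cid2 (h i)).
have ef0 i : 0 < ef i by rewrite /ef; case: cid2.
have efP i w : 0 < n1 (w - u) -> n1 (w - u) < ef i -> P i w.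
  by rewrite /ef; case: cid2 => //= x _ hx; exact: hx.
exists (\big[Num.min/1]_i ef i); first by apply: lt_bigmin.
move=> w w0 hw i; apply: efP => //.
by apply: (lt_le_trans hw); rewrite (bigD1 i) //= ge_min lexx.
Qed.

Lemma puncturedI P Q u : punctured P u -> punctured Q u -> punctured (fun w => P w /\ Q w) u.
Proof.
move=> hP hQ; have [b|e e0 he] := @punctured_all bool (fun b => if b then P else Q) u; first by case: b.
exists e; first exact: e0.
by move=> w w0 we; split; [exact: (he w w0 we true)|exact: (he w w0 we false)].
Qed.

Lemma punctured_open P : open [set u | punctured P u].
Proof.
apply: n1_open => u [e e0 he]; exists e; first exact: e0.
move=> w we; have [w0|w0] := eqVneq (w - u) 0.
  by move/eqP: w0; rewrite subr_eq0 => /eqP ->; exists e.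
have {}w0 := n1_gt0 w0.
(* A ball around [w] that avoids [u] and stays within distance e of it. *)
exists (Num.min (n1 (w - u)) (e - n1 (w - u))); first by rewrite lt_min w0 subr_gt0.
move=> z z0; rewrite lt_min => /andP [z1 z2]; apply: he.
  have := n1D (w - z) (z - u); rewrite addrA subrK -(n1N (w - z)) opprB => h.
  by move: z1 h; move: (n1 _) (n1 _) (n1 _) => a b c; lra.
have := n1D (z - w) (w - u); rewrite addrA subrK => h.
by move: z2 h; move: (n1 _) (n1 _) (n1 _) => a b c; lra.
Qed.

Lemma n1_delta (k : 'I_m) : n1 (delta_mx 0 k : 'rV[R]_m) = 1.
Proof.
rewrite /n1 (bigD1 k) //= mxE !eqxx normr1 big1 ?addr0 // => l lk.
by rewrite mxE (negPf lk) andbF normr0.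
Qed.

Lemma punctured_witness P u : (0 < m)%N -> punctured P u -> exists w, P w.
Proof.
move=> m0 [e e0 he]; exists (u + (e / 2) *: delta_mx 0 (Ordinal m0)).
have E : n1 (u + (e / 2) *: delta_mx 0 (Ordinal m0) - u) = e / 2.
  by rewrite addrC addKr n1Z n1_delta mulr1 ger0_norm // ltW // divr_gt0.
apply: he; rewrite E ?divr_gt0 //.
by rewrite ltr_pdivrMr // mulr_natr mulr2n ltrDl.
Qed.

(** A two-segment path through v3, a positive multiple of a direction d. The segment from v to v3
    meets 0 only if v is a negative multiple of d. Each of v1, v2 is opposite to at most one of the
    three directions d0, - d0, d1, so one of these suits both. *)
Lemma punctured_path (e : R) v1 v2 : (1 < m)%N -> v1 != 0 -> v2 != 0 -> n1 v1 < e -> n1 v2 < e ->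
  exists v3, forall v t, v = v1 \/ v = v2 -> 0 <= t -> t <= 1 ->
    0 < n1 (v + t *: (v3 - v)) /\ n1 (v + t *: (v3 - v)) < e.
Proof.
move=> m1 v10 v20 v1e v2e; have e0 : 0 < e by apply: le_lt_trans v1e; exact: n1_ge0.
pose k0 : 'I_m := Ordinal (ltnW m1); pose k1 : 'I_m := Ordinal m1.
pose opp v d := exists2 a : R, 0 < a & v = - a *: d.
pose d0 : 'rV[R]_m := delta_mx 0 k0; pose d1 : 'rV[R]_m := delta_mx 0 k1.
have opp01 v : opp v d0 -> opp v (- d0) -> False.
  move=> [a a0 ->] [b b0] /rowP /(_ k0); rewrite !mxE !eqxx mulr1 mulrN mulr1 opprK => ab.
  by move: a0 b0; rewrite -ab; lra.
have opp02 v : opp v d0 -> opp v d1 -> False.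
  move=> [a a0 ->] [b b0] /rowP /(_ k0); rewrite !mxE !eqxx /= mulr1 mulr0 => ab.
  by move: a0; lra.
have opp12 v : opp v (- d0) -> opp v d1 -> False.
  move=> [a a0 ->] [b b0] /rowP /(_ k0); rewrite !mxE !eqxx /= mulr0 mulrN mulr1 opprK => ab.
  by move: a0; lra.
have n1d : [/\ n1 d0 = 1, n1 (- d0) = 1 & n1 d1 = 1] by rewrite n1N !n1_delta.
have [d [n1d1 nd1 nd2]] : exists d, [/\ n1 d = 1, ~ opp v1 d & ~ opp v2 d].
  case: n1d => a0 a1 a2.
  apply: contrapT => no.
  have pick d : n1 d = 1 -> opp v1 d \/ opp v2 d.
    move=> nd; apply: contrapT => nn; apply: no; exists d; split => // o; apply: nn; [left|right]; exact: o.
  case: (pick _ a0) (pick _ a1) (pick _ a2) => b0 [] b1 [] b2.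
  - exact: opp01 b0 b1.
  - exact: opp01 b0 b1.
  - exact: opp02 b0 b2.
  - exact: opp12 b1 b2.
  - exact: opp12 b1 b2.
  - exact: opp02 b0 b2.
  - exact: opp01 b0 b1.
  - exact: opp01 b0 b1.
have h2 : 0 < e / 2 by rewrite divr_gt0.
have h2e : e / 2 < e by rewrite ltr_pdivrMr // mulr_natr mulr2n ltrDl.
exists ((e / 2) *: d) => v t hv t0 t1.
have [v0 ve nd] : [/\ v != 0, n1 v < e & ~ opp v d] by case: hv => ->.
have -> : v + t *: ((e / 2) *: d - v) = (1 - t) *: v + (t * (e / 2)) *: d.
  by rewrite scalerBr scalerBl scale1r scalerA addrCA addrC -addrA addrC -addrA [- _ + _]addrC.
split.
  apply: n1_gt0; apply/negP => /eqP E.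
  have [t1'|t1'] := eqVneq t 1.
    move: E; rewrite t1' subrr scale0r add0r mul1r => /(congr1 (@n1 R m)).
    by rewrite n1Z n1d1 n10 mulr1 => /eqP; rewrite normr_eq0 gt_eqF.
  have t2 : 0 < 1 - t by rewrite subr_gt0 lt_neqAle t1' t1.
  have [t0'|t0'] := eqVneq t 0.
    by move: E; rewrite t0' subr0 scale1r mul0r scale0r addr0 => /eqP; exact/negP.
  apply: nd; exists (t * (e / 2) / (1 - t)).
    by rewrite divr_gt0 // mulr_gt0 // lt_neqAle eq_sym t0' t0.
  apply: (scalerI (lt0r_neq0 t2)); rewrite scaleNr scalerN scalerA mulrC divfK ?gt_eqF //.
  by apply/eqP; rewrite -addr_eq0; apply/eqP.
apply: (le_lt_trans (n1D _ _)); rewrite !n1Z n1d1 mulr1 !ger0_norm ?mulr_ge0 ?subr_ge0 ?(ltW h2) ?(ltW e0) //.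
move: ve h2e; move: (n1 v) (e / 2) => x y xe ye; clear -xe ye t0 t1.
have [t00|t00] := eqVneq t 0; first by rewrite t00; lra.
by have tp : 0 < t by [rewrite lt_neqAle eq_sym t00]; nra.
Qed.
End Punctured.

(** * Propagation of the vanishing defect *)

Section Generation.
Variable R : realType.
Variables n m : nat.
Local Notation C := (complex R).
Variables (H0 : 'M[C]_n) (Hs : 'I_m -> 'M[C]_n).
Hypothesis hH0 : is_hermitian H0.
Hypothesis hHs : forall k, is_hermitian (Hs k).
Local Notation H := (Hu H0 Hs).
Variable U : set 'rV[R]_m.
Hypothesis oU : open U.
Variable g : set 'M[C]_n.
Hypothesis gL : complex_lie g.
Hypothesis gU : forall u, U u -> g (H u).

Lemma direction_in u k : U u -> g (Hs k).
Proof.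
move=> Uu; have [e e0 he] := open_n1 oU Uu; have [_ _ gZ _] := gL.
pose w := u + (e / 2) *: delta_mx 0 k.
have wu : w - u = (e / 2) *: delta_mx 0 k by rewrite addrC addKr.
have e2 : 0 < e / 2 by rewrite divr_gt0.
have Uw : U w.
  apply: he; rewrite wu n1Z n1_delta mulr1 ger0_norm ?(ltW e2) //.
  by rewrite ltr_pdivrMr // mulr_natr mulr2n ltrDl.
have := complex_lieB gL (gU Uw) (gU Uu); rewrite HuB wu lincombZ.
have -> : lincomb Hs (delta_mx 0 k) = Hs k.
  rewrite /lincomb (bigD1 k) //= mxE !eqxx cR1 scale1r big1 ?addr0 // => l lk.
  by rewrite mxE (negPf lk) andbF cR0 scale0r.
move=> /(gZ (cR (e / 2))^-1); rewrite scalerA mulVf ?scale1r //.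
by rewrite cR_eq0 gt_eqF.
Qed.

(** [H] is affine and [U] open, so differences already give all directions; the parameter [w] is not
    restricted to [U], and the segments used below are free to leave it. *)
Lemma parameter_in u w : U u -> g (H w).
Proof.
move=> Uu; have [_ gD gZ _] := gL.
have -> : H w = H u + lincomb Hs (w - u) by rewrite -(HuB H0 Hs w u) addrC subrK.
apply: (gD _ _ (gU Uu)); apply: (complex_lie_sum gL) => k _; apply: gZ; exact: direction_in Uu.
Qed.

Lemma regular_isolated w S : regular H0 Hs w -> isolated (H w) S.
Proof. by move=> rw k l kS lS; apply: rw; apply: contraNneq lS => <-. Qed.

Hypothesis U0 : U !=set0.
Let gH w : g (H w). Proof. by have [u Uu] := U0; exact: parameter_in Uu. Qed.

Variable Pi : 'M[C]_(n * n).
Hypothesis Pi0 : forall Q : 'M[C]_n, defect Pi Q = 0 <-> (forall Y : 'M[C]_n, g (slproj Q Y)).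
Hypothesis PiC : forall K : 'M[C]_n, adj K = - K -> g K -> lin_mx (comm K) *m Pi = Pi *m lin_mx (comm K).

Lemma defect_segment S w1 w2 :
  (forall t : R, 0 <= t -> t <= 1 -> isolated (H (w1 + t *: (w2 - w1))) S) ->
  defect Pi (specproj (H w1) S) = defect Pi (specproj (H w2) S).
Proof.
move=> iso; pose p t : 'rV[R]_m := w1 + t *: (w2 - w1).
have := @quadratic_variation_cst R (fun t => defect Pi (specproj (H (p t)) S)) 0 1 ler01.
rewrite /p scale0r addr0 scale1r addrCA subrr addr0; apply => t t0 t1.
have [c [e [c0 e0 loc]]] := defect_local gL PiC (Hu_hermitian hH0 hHs (p t)) (gH _) (iso t t0 t1).
have [c3 c30 lip] := Hu_lip H0 Hs.
pose y := c3 * n1 (w2 - w1); have y0 : 0 <= y by rewrite mulr_ge0 ?n1_ge0 // ltW.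
exists (c * y ^+ 2), (e / (y + 1)); split; first by rewrite divr_gt0 // ltr_wpDl.
move=> h he.
have hm : mn (H (w1 + (t + h) *: (w2 - w1)) - H (p t)) <= y * `|h|.
  apply: (le_trans (lip _ _)).
  have -> : w1 + (t + h) *: (w2 - w1) - p t = h *: (w2 - w1).
    by rewrite /p opprD addrACA subrr add0r -scalerBl addrC addKr.
  by rewrite n1Z mulrCA mulrC.
apply: (le_trans (loc _ (Hu_hermitian hH0 hHs _) (gH _) _)).
  apply: (le_lt_trans hm); apply: (@le_lt_trans _ _ (`|h| * (y + 1))).
    by rewrite mulrC ler_wpM2l // lerDl.
  by rewrite -ltr_pdivlMr // ltr_wpDl.
rewrite -mulrA; apply: ler_wpM2l; first exact: c0.
rewrite -(real_normK (num_real h)) -exprMn.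
by rewrite ler_sqr ?nnegrE ?mn_ge0 // mulr_ge0.
Qed.

Hypothesis cU : connected U.
Hypothesis m1 : (1 < m)%N.
Hypothesis con : forall u j, U u -> (j.+1 < n)%N -> lam (H u) j = lam (H u) j.+1 -> conical_int H j u.
Local Notation F j1 j2 w := (defect Pi (specproj (H w) [set j1; j2]%SET)).

(** Two coordinate directions suffice: by [conical_nonscalar] every nontrivial real combination of
    [Hs k0] and [Hs k1] has a nonscalar compression, which is the independence asked for by
    [conical_slproj]. *)
Lemma slproj_at_intersection (j1 j2 : 'I_n) ub : j2 = j1.+1 :> nat -> conical_int H j1 ub ->
  (forall l, (l < n)%N -> l != j1 -> l != j1.+1 -> count_mem (lam (H ub) l) (eigseq (H ub)) = 1%N) ->
  F j1 j2 ub = 0.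
Proof.
move=> j12 cj simple; apply/Pi0.
have ne := conical_neq j12; have hA := Hu_hermitian hH0 hHs ub.
pose k0 : 'I_m := Ordinal (ltnW m1); pose k1 : 'I_m := Ordinal m1.
have [u Uu] := U0.
have simple_off (k l : 'I_n) : k != l -> lam (H ub) k = lam (H ub) l -> k \in [set j1; j2]%SET.
  move=> kl e; rewrite !inE; apply: contraT; rewrite negb_or => /andP [k1' k2'].
  have := simple k (ltn_ord k) k1'; rewrite -j12 => /(_ k2').
  rewrite (count_lam _ hA) => /eqP /cards1P [x Ex].
  have : k \in [set x]%SET by rewrite -Ex inE.
  have : l \in [set x]%SET by rewrite -Ex inE e.
  by rewrite !inE => /eqP lx /eqP kx; rewrite lx kx eqxx in kl.
apply: (conical_slproj gL hA (gH _) ne (conical_lam j12 cj) _ (hHs k0) (hHs k1)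
  (direction_in _ Uu) (direction_in _ Uu)).
  move=> k l kl e; apply/andP; split; first exact: simple_off e.
  by apply: (simple_off l k); rewrite 1?eq_sym.
move=> p q pq k.
have -> : cR p *: Hs k0 + cR q *: Hs k1 = lincomb Hs (p *: delta_mx 0 k0 + q *: delta_mx 0 k1).
  rewrite /lincomb (bigD1 k0) //= (bigD1 k1) //= big1 => [|i /andP [i0 i1]].
    by rewrite !mxE !eqxx /= !(mulr0, mulr1) addr0 add0r addr0.
  by rewrite !mxE !eqxx (negPf i0) (negPf i1) !mulr0 addr0 cR0 scale0r.
apply: (conical_nonscalar hH0 hHs j12 cj); apply/negP => /eqP /rowP E.
have := E k0; have := E k1; rewrite !mxE !eqxx /= !(mulr0, mulr1) addr0 add0r => q0 p0.
by move: pq; rewrite p0 q0 eqxx.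
Qed.

Lemma defect_punctured_cst (j1 j2 : 'I_n) u : U u ->
  punctured (fun w => F j1 j2 w = 0) u \/ punctured (fun w => F j1 j2 w <> 0) u.
Proof.
move=> Uu; have [e e0 reg] := regular_punctured hH0 hHs oU Uu con.
have cst w1 w2 : 0 < n1 (w1 - u) -> n1 (w1 - u) < e -> 0 < n1 (w2 - u) -> n1 (w2 - u) < e ->
    F j1 j2 w1 = F j1 j2 w2.
  move=> p1 p1' p2 p2'.
  have nz w : 0 < n1 (w - u) -> w - u != 0 by apply: contraTneq => ->; rewrite n10 ltxx.
  have [v3 hv3] := punctured_path m1 (nz _ p1) (nz _ p2) p1' p2'.
  have seg w : w = w1 \/ w = w2 -> F j1 j2 w = F j1 j2 (u + v3).
    move=> hw; apply: defect_segment => t t0 t1; apply: regular_isolated.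
    have hw' : w - u = w1 - u \/ w - u = w2 - u by case: hw => ->; [left|right].
    have [a b] := hv3 (w - u) t hw' t0 t1.
    have E : w + t *: (u + v3 - w) - u = w - u + t *: (v3 - (w - u)).
      by rewrite opprB [v3 + _]addrC addrAC [u - w + v3]addrAC.
    by have := reg (w + t *: (u + v3 - w)); rewrite E => /(_ a b) [].
  exact: (etrans (seg w1 (or_introl erefl)) (esym (seg w2 (or_intror erefl)))).
have m0 : (0 < m)%N by exact: ltnW.
have [w0 [w01 w02]] : exists w0, 0 < n1 (w0 - u) /\ n1 (w0 - u) < e.
  by apply: (@punctured_witness R m _ u m0); exists e; [exact: e0|split].
have [z|nz] := pselect (F j1 j2 w0 = 0); [left|right]; exists e; try exact: e0.
  by move=> w a b; rewrite (cst w w0).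
by move=> w a b; rewrite (cst w w0).
Qed.

Lemma defect_punctured0 (j1 j2 : 'I_n) ub : j2 = j1.+1 :> nat -> U ub -> conical_int H j1 ub -> F j1 j2 ub = 0 ->
  forall u, U u -> punctured (fun w => F j1 j2 w = 0) u.
Proof.
move=> j12 Uub cj F0.
have m0 : (0 < m)%N by exact: ltnW.
pose A := [set u | punctured (fun w => F j1 j2 w = 0) u].
pose B := [set u | punctured (fun w => F j1 j2 w <> 0) u].
have AB u : A u -> B u -> False.
  by move=> a b; have [w [? ?]] := punctured_witness m0 (puncturedI a b).
suff E : U `&` A = U by move=> u Uu; have : (U `&` A) u by [rewrite E]; case.
apply: cU.
- exists ub; split => //.
  have [e e0 reg] := regular_punctured hH0 hHs oU Uub con.
  exists e; first exact: e0.
  move=> w w0 we; rewrite -F0; apply/esym; apply: defect_segment => t t0 t1.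
  (* The segment starts at the intersection itself, where the spectrum is not simple but the pair is
     still isolated from the rest. *)
  have [->|tn] := eqVneq t 0.
    by rewrite scale0r addr0 => k l; exact: (conical_isolated hH0 hHs j12 cj).
  have tp : 0 < t by rewrite lt_neqAle eq_sym tn.
  have [] := reg (ub + t *: (w - ub)).
  + by rewrite addrC addKr n1Z mulr_gt0 // normr_gt0.
  + rewrite addrC addKr n1Z ger0_norm //; apply: le_lt_trans we.
    by rewrite ler_piMl // n1_ge0.
  + by move=> _ r; exact: regular_isolated.
- by exists A => //; exact: punctured_open.
(* Relative closedness: [A] and [B] are open, disjoint, and cover [U] by [defect_punctured_cst]. *)
- exists (~` B); first by apply: open_closedC; exact: punctured_open.
  apply/seteqP; split => u [Uu a]; split => //; first by move=> b; exact: AB a b.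
  by case: (defect_punctured_cst j1 j2 Uu) => // b; case: a.
Qed.

(** Each consecutive pair has its own intersection, but the vanishing propagates to punctured
    neighborhoods of one common point, where a single parameter with simple spectrum serves all
    pairs. *)
Lemma sl_in : (1 < n)%N ->
  (forall j, (j.+1 < n)%N -> exists2 ub, U ub & conical_int H j ub /\
     forall l, (l < n)%N -> l != j -> l != j.+1 -> count_mem (lam (H ub) l) (eigseq (H ub)) = 1%N) ->
  forall X, \tr X = 0 -> g X.
Proof.
move=> n2 cc X X0; have m0 : (0 < m)%N by exact: ltnW.
have [u Uu] := U0.
have all0 : punctured (fun w => forall p : 'I_n * 'I_n, p.2 = p.1.+1 :> nat -> F p.1 p.2 w = 0) u.
  apply: punctured_all => -[j1 j2] /=.
  have [j12|j12] := eqVneq (j2 : nat) j1.+1; last by exists 1 => // w _ _ E; rewrite E eqxx in j12.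
  have j1n : (j1.+1 < n)%N by rewrite -j12.
  have [ub Uub [cj simple]] := cc _ j1n.
  have [e e0 he] := defect_punctured0 j12 Uub cj (slproj_at_intersection j12 cj simple) Uu.
  by exists e; [exact: e0|move=> w a b _; apply: he].
have reg := regular_punctured hH0 hHs oU Uu con.
have [w [_ F0]] := punctured_witness m0 (puncturedI reg all0).
have hw := Hu_hermitian hH0 hHs w.
apply: (sl_generated gL (proj1 (eigbasisP hw)) _ X0).
move=> k l lk; have kl : k != l by rewrite -val_eqE /= lk; lia.
apply: (pair_in_of_slproj hw kl); apply/Pi0; exact: (F0 (k, l)).
Qed.
End Generation.

(** * Real Lie algebras and their complexification *)

Section LieGenerated.
Variable R : realType.
Variable n : nat.
Local Notation C := (complex R).
Variable S : set 'M[C]_n.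

Lemma lie_gen_closed : lie_closed (lie_gen S).
Proof.
split=> [|A B hA hB|r A hA|A B hA hB] L LL SL; have [L0 LD LZ Lb] := LL => //.
- by apply: LD; [exact: hA|exact: hB].
- by apply: LZ; exact: hA.
- by apply: Lb; [exact: hA|exact: hB].
Qed.

Lemma lie_gen_sub : S `<=` lie_gen S.
Proof. by move=> X SX L _; apply. Qed.

Lemma u_alg_closed : lie_closed (@u_alg R n).
Proof.
rewrite /u_alg; split=> [|A B /= hA hB|r A /= hA|A B /= hA hB] /=.
- by rewrite adj0 oppr0.
- by rewrite adjD hA hB opprD.
- by rewrite adjZ conj_cR hA scalerN.
- by rewrite adjB !adjM hA hB !mulNmx !mulmxN !opprK opprB.
Qed.

Lemma su_alg_closed : lie_closed (@su_alg R n).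
Proof.
have [u0 uD uZ ub] := u_alg_closed.
split=> [|A B [hA tA] [hB tB]|r A [hA tA]|A B [hA tA] [hB tB]]; split.
- exact: u0.
- by rewrite mxtrace0.
- exact: uD.
- by rewrite mxtraceD tA tB addr0.
- exact: uZ.
- by rewrite mxtraceZ tA mulr0.
- exact: ub.
- by rewrite raddfB /= mxtrace_mulC subrr.
Qed.

Definition complexify (L : set 'M[C]_n) : set 'M[C]_n :=
  [set Z | exists X Y, [/\ L X, L Y & Z = X + iC R *: Y]].

Lemma complexify_lie L : lie_closed L -> complex_lie (complexify L).
Proof.
move=> [L0 LD LZ Lb].
have LB X Y : L X -> L Y -> L (X - Y).
  by move=> hX hY; apply: LD => //; rewrite -scaleN1r -(cR1 R) -cRN; exact: LZ.
split.
- by exists 0, 0; split => //; rewrite scaler0 addr0.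
- move=> _ _ [X1 [Y1 [hX1 hY1 ->]]] [X2 [Y2 [hX2 hY2 ->]]].
  by exists (X1 + X2), (Y1 + Y2); split; [exact: LD|exact: LD|rewrite scalerDr addrACA].
- move=> [a b] _ [X [Y [hX hY ->]]].
  exists (cR a *: X - cR b *: Y), (cR b *: X + cR a *: Y); split.
  + by apply: LB; exact: LZ.
  + by apply: LD; exact: LZ.
  + apply/matrixP => i j; rewrite !mxE; case: (X i j) => x1 x2; case: (Y i j) => y1 y2.
    by apply/eqP; rewrite eq_complex /=; apply/andP; split; apply/eqP; ring.
- move=> _ _ [X1 [Y1 [hX1 hY1 ->]]] [X2 [Y2 [hX2 hY2 ->]]].
  exists ((X1 *m X2 - X2 *m X1) - (Y1 *m Y2 - Y2 *m Y1)), ((X1 *m Y2 - Y2 *m X1) + (Y1 *m X2 - X2 *m Y1)).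
  split; [by apply: LB; exact: Lb|by apply: LD; exact: Lb|].
  rewrite !mulmxDl !mulmxDr -!scalemxAl -!scalemxAr !scalerA iC2 !scaleN1r.
  rewrite !scalerDr !scalerN.
  move: (X1 *m X2) (X2 *m X1) (Y1 *m Y2) (Y2 *m Y1) (iC R *: (X1 *m Y2)) (iC R *: (Y2 *m X1)).
  by move: (iC R *: (Y1 *m X2)) (iC R *: (X2 *m Y1)) => a1 a2 a3 a4 a5 a6 a7 a8; mxadd.
Qed.

(** For [X] and [Y] skew, X and i Y are the skew and Hermitian parts of X + i Y; if the sum is skew,
    the second part vanishes. *)
Lemma complexify_skew L Z : L `<=` @u_alg R n -> complexify L Z -> adj Z = - Z -> L Z.
Proof.
move=> Lu [X [Y [hX hY ->]]]; rewrite adjD adjZ (Lu _ hX) (Lu _ hY) conj_iC.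
rewrite scaleNr scalerN opprK opprD => /addrI /esym/eqP.
rewrite -subr_eq0 -opprD oppr_eq0 -mulr2n -scaler_nat scalerA scaler_eq0 => /orP [|/eqP ->].
  rewrite mulf_eq0 pnatr_eq0 /= => /eqP/(congr1 (@complex.Im R)) /= /eqP.
  by rewrite oner_eq0.
by rewrite scaler0 addr0.
Qed.
End LieGenerated.

Section LieGeneratedByHamiltonian.
Variable R : realType.
Variables n m : nat.
Local Notation C := (complex R).
Variables (H0 : 'M[C]_n) (Hs : 'I_m -> 'M[C]_n).
Hypothesis hH0 : is_hermitian H0.
Hypothesis hHs : forall k, is_hermitian (Hs k).
Local Notation H := (Hu H0 Hs).
Variable U : set 'rV[R]_m.
Hypothesis oU : open U.
Hypothesis cU : connected U.
Hypothesis n1 : (1 < n)%N.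
Hypothesis m1 : (1 < m)%N.
Hypothesis con : conically_connected U H.
Local Notation L := (lie_gen [set iC R *: H u | u in U]).

Let inL u : U u -> L (iC R *: H u).
Proof. by move=> Uu; apply: lie_gen_sub; exists u. Qed.

Lemma lie_gen_skew : L `<=` @u_alg R n.
Proof.
move=> X hX; apply: hX; first exact: u_alg_closed.
by move=> _ [u Uu <-]; rewrite /u_alg /= adjZ conj_iC (Hu_hermitian hH0 hHs) scaleNr.
Qed.

Lemma su_sub_lie_gen : @su_alg R n `<=` L.
Proof.
move=> X [hX tX]; case: con => con1 con2.
have [ub Uub _] := con2 0%N n1.
apply: (complexify_skew lie_gen_skew _ hX).
have gL := complexify_lie (lie_gen_closed [set iC R *: H u | u in U]).
have gU u : U u -> complexify L (H u).
  move=> Uu; exists 0, (- (iC R *: H u)); split.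
  - by have [] := lie_gen_closed [set iC R *: H u | u in U].
  - have [_ _ LZ _] := lie_gen_closed [set iC R *: H u | u in U].
    by have := LZ (-1) _ (inL Uu); rewrite cRN cR1 scaleN1r.
  - by rewrite add0r scalerN scalerA iC2 scaleN1r opprK.
have [Pi [Pi0 PiC]] := exists_defect_proj gL.
by apply: (sl_in hH0 hHs oU gL gU _ Pi0 PiC cU m1 con1 n1 con2 tX); exists ub.
Qed.

Lemma lie_gen_su : (forall u, U u -> \tr (H u) = 0) -> L = @su_alg R n.
Proof.
move=> t0; apply/seteqP; split; last exact: su_sub_lie_gen.
move=> X hX; apply: hX; first exact: su_alg_closed.
move=> _ [u Uu <-]; split; first exact: lie_gen_skew (inL Uu).
by rewrite mxtraceZ t0 // mulr0.
Qed.

Lemma lie_gen_u : ~ (forall u, U u -> \tr (H u) = 0) -> L = @u_alg R n.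
Proof.
move=> nt; apply/seteqP; split; first exact: lie_gen_skew.
move=> X hX.
have [u [Uu tu]] : exists u, U u /\ \tr (H u) <> 0.
  by apply: contrapT => no; apply: nt => u Uu; apply: contrapT => tu; apply: no; exists u.
have [_ LD LZ _] := lie_gen_closed [set iC R *: H u | u in U].
pose A := iC R *: H u; have hA : adj A = - A by exact: lie_gen_skew (inL Uu).
have a0 : complex.Im (\tr A) != 0.
  apply/eqP => E; apply: tu; have := skew_trace hA; rewrite E cR0 mulr0 mxtraceZ => /eqP.
  rewrite mulf_eq0 => /orP [|/eqP //]; rewrite eq_complex /= oner_eq0 andbF //.
pose r := complex.Im (\tr X) / complex.Im (\tr A).
have -> : X = (X - cR r *: A) + cR r *: A by rewrite subrK.
apply: LD; last by apply: LZ; exact: inL.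
apply: su_sub_lie_gen; split.
  by rewrite adjB adjZ conj_cR hX hA scalerN opprK opprB addrC.
by rewrite raddfB /= mxtraceZ (skew_trace hX) (skew_trace hA) mulrCA -cRM /r divfK // subrr.
Qed.
End LieGeneratedByHamiltonian.

(** * Solutions of the control system *)

Section Primitive.
Variable R : realType.
Notation mu := (@lebesgue_measure R).
Variable T : R.
Implicit Types f h x : R -> R.

Let mI (t : R) : measurable (I0 t : set (measurableTypeR R)). Proof. exact: measurable_itv. Qed.
Let mIoc (s t : R) : measurable (`]s, t]%classic : set (measurableTypeR R)). Proof. exact: measurable_itv. Qed.

Lemma I0_sub (t : R) : t <= T -> I0 t `<=` I0 T.
Proof. by move=> tT; apply: subset_itvl; rewrite bnd_simp. Qed.

Lemma ocI0_sub (s t : R) : 0 <= s -> t <= T -> `]s, t]%classic `<=` I0 T.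
Proof.
move=> s0 tT y; rewrite /I0 /= !in_itv /= => /andP [sy yt]; apply/andP; split.
  exact: le_trans s0 (ltW sy).
exact: le_trans tT.
Qed.

Lemma bounded_integrable f M (D : set (measurableTypeR R)) : measurable D -> (mu D < +oo)%E -> 0 <= M -> measurable_fun D f ->
  {ae mu, forall t, D t -> `|f t| <= M} -> mu.-integrable D (EFin \o f).
Proof.
move=> mD Df M0 mf bf; apply/integrableP; split; first exact/measurable_EFinP.
apply: (@le_lt_trans _ _ (M%:E * mu D)%E).
  by apply: integral_le_bound => //; exact/measurable_EFinP.
by rewrite lte_mul_pinfty.
Qed.

Lemma Rintegral_bound f B (s t : R) : s <= t -> 0 <= B -> mu.-integrable `]s, t]%classic (EFin \o f) ->
  {ae mu, forall r, `]s, t]%classic r -> `|f r| <= B} ->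
  `|(\int[mu]_(r in `]s, t]%classic) f r)| <= B * (t - s).
Proof.
move=> st B0 intf bf; rewrite -lee_fin EFin_normr_Rintegral //.
have mf := measurable_int _ intf.
apply: (le_trans (le_abse_integral _ _ mf)) => //.
apply: (@le_trans _ _ (B%:E * mu (`]s, t]%classic : set R))%E).
  by apply: integral_le_bound.
rewrite lebesgue_measure_itv /= lte_fin; move: st; rewrite le_eqVlt => /orP [/eqP ->|->].
  by rewrite ltxx mule0 subrr mulr0.
by rewrite -EFinD -EFinM lee_fin.
Qed.

Lemma Rintegral_lincomb (I : Type) (r : seq I) (c : I -> R) (g : I -> R -> R) (D : set (measurableTypeR R)) : measurable D ->
  (forall i, mu.-integrable D (EFin \o g i)) ->
  mu.-integrable D (EFin \o (fun t => \sum_(i <- r) c i * g i t)) /\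
  \int[mu]_(t in D) (\sum_(i <- r) c i * g i t) = \sum_(i <- r) c i * \int[mu]_(t in D) g i t.
Proof.
move=> mD hg; elim: r => [|i r [IH1 IH2]].
  under [X in Rintegral _ _ X]eq_fun do rewrite big_nil.
  rewrite big_nil Rintegral_cst // mul0r; split => //.
  apply: (@eq_integrable _ _ _ mu D mD (cst 0%E)); last exact: integrable0.
  by move=> t _; rewrite /= big_nil.
have h1 : mu.-integrable D (EFin \o (fun t => c i * g i t)).
  by apply: (@eq_integrable _ _ _ mu D mD (fun t => ((c i)%:E * (EFin \o g i) t)%E)) => //; exact: integrableZl.
split.
  have := integrableD mD h1 IH1; apply: eq_integrable => // t _.
  by rewrite /= big_cons EFinD.
under [X in Rintegral _ _ X]eq_fun do rewrite big_cons.
by rewrite RintegralD // RintegralZl // IH2 big_cons.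
Qed.

(** Scalar form of [is_sol], kept in the extended reals to match it. *)
Definition primitive_of x f := mu.-integrable (I0 T) (EFin \o f) /\
  forall t, I0 T t -> (x t)%:E = ((x 0)%:E + \int[mu]_(s in I0 t) (f s)%:E)%E.

Lemma primitiveE x f t : primitive_of x f -> I0 T t -> x t = x 0 + \int[mu]_(s in I0 t) f s.
Proof.
move=> [intf xE] tT; have := xE t tT.
rewrite -[X in (_ + X)%E]fineK; last first.
  have tT' : t <= T by move: tT; rewrite /I0 /= in_itv /= => /andP [].
  by apply: integrable_fin_num => //; exact: integrableS (mI T) (mI t) (I0_sub tT') intf.
by rewrite -EFinD => -[].
Qed.

Lemma primitive_bounded x f : primitive_of x f -> exists B, forall t, I0 T t -> `|x t| <= B.
Proof.
move=> xf; have [intf _] := xf.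
exists (`|x 0| + \int[mu]_(s in I0 T) `|f s|) => t tT.
rewrite (primitiveE xf tT); apply: (le_trans (ler_normD _ _)); rewrite lerD2l.
have tT' : t <= T by move: tT; rewrite /I0 /= in_itv /= => /andP [].
have intft : mu.-integrable (I0 t) (EFin \o f) by exact: integrableS (mI T) (mI t) (I0_sub tT') intf.
apply: (le_trans (le_normr_Rintegral _ intft)) => //.
rewrite /Rintegral; apply: fine_le.
- by apply: integrable_fin_num => //; exact: integrable_norm intft.
- by apply: integrable_fin_num => //; exact: integrable_norm intf.
apply: ge0_subset_integral => //; last exact: I0_sub.
exact: (measurable_int mu (integrable_norm intf)).
Qed.

(** The coefficients [c] will be values frozen at time [s], while the functions [g i] stay under the
    integral: a control that is only measurable admits no expansion in time. *)
Lemma primitive_increment (I : finType) (c : I -> R) (g : I -> R -> R) x f B s t : primitive_of x f ->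
  (forall i, mu.-integrable (I0 T) (EFin \o g i)) -> 0 <= s -> s <= t -> t <= T -> 0 <= B ->
  {ae mu, forall r, I0 T r -> s < r -> r <= t -> `|f r - \sum_i c i * g i r| <= B} ->
  `|x t - x s - \sum_i c i * \int[mu]_(r in `]s, t]%classic) g i r| <= B * (t - s).
Proof.
move=> xf intg s0 st tT B0 hB; have [intf _] := xf.
have t0 : 0 <= t by exact: le_trans st.
have sT : s <= T by exact: le_trans tT.
have It : I0 T t by rewrite /I0 /= in_itv /= t0.
have Is : I0 T s by rewrite /I0 /= in_itv /= s0.
have sub := ocI0_sub s0 tT.
have intft : mu.-integrable (I0 t) (EFin \o f) by exact: integrableS (mI T) (mI t) (I0_sub tT) intf.
have intfst : mu.-integrable `]s, t]%classic (EFin \o f) by exact: integrableS (mI T) (mIoc s t) sub intf.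
have intgst i : mu.-integrable `]s, t]%classic (EFin \o g i) by exact: integrableS (mI T) (mIoc s t) sub (intg i).
have [i1 i2] := Rintegral_lincomb (index_enum I) c (mIoc s t) intgst.
rewrite (primitiveE xf It) (primitiveE xf Is) opprD addrACA subrr add0r.
have -> : \int[mu]_(r in I0 t) f r - \int[mu]_(r in I0 s) f r = \int[mu]_(r in `]s, t]%classic) f r.
  by apply: Rintegral_itvB => //; rewrite bnd_simp.
rewrite -i2 -RintegralB //; apply: Rintegral_bound => //.
  by have := integrableB (mIoc s t) intfst i1.
have Fae : Filter (nbhs (almost_everywhere mu)) by exact: ae_filter_ringOfSetsType.
apply: filterS hB => r h rst; apply: h; first exact: sub.
  by move: rst; rewrite /= in_itv /= => /andP [].
by move: rst; rewrite /= in_itv /= => /andP [].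
Qed.

Lemma quadratic_cst f c : 0 <= T -> 0 <= c ->
  (forall s t, 0 <= s -> s <= t -> t <= T -> `|f t - f s| <= c * (t - s) ^+ 2) -> f T = f 0.
Proof.
(* Composition with the clamp onto [0, T] supplies values on both sides of the endpoints; being
   1-Lipschitz, it preserves the quadratic bound. *)
move=> T0 c0 hf; pose clamp (t : R) := Num.max 0 (Num.min t T).
have cl t : 0 <= t -> t <= T -> clamp t = t by move=> a b; rewrite /clamp min_l // max_r.
have hf' s t : 0 <= s -> s <= T -> 0 <= t -> t <= T -> `|f t - f s| <= c * (t - s) ^+ 2.
  move=> s0 sT t0 tT; have [st|ts] := leP s t; first exact: hf.
  by rewrite distrC -sqrrN opprB; apply: hf => //; exact: ltW.
have := @quadratic_variation_cst R (f \o clamp) 0 T T0.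
rewrite /= !cl // => -> // t t0 tT; exists c, 1; split => // h _.
rewrite (cl t) //; apply: (le_trans (hf' t (clamp (t + h)) t0 tT _ _)).
- by rewrite /clamp le_max lexx.
- by rewrite /clamp ge_max T0 /= ge_min lexx orbT.
apply: ler_wpM2l => //; rewrite -(real_normK (num_real (clamp _ - _))) -(real_normK (num_real h)).
rewrite ler_sqr ?nnegrE //; rewrite /clamp.
have [a|a] := leP (t + h) T; have [b|b] := leP 0 _.
- by rewrite addrC addKr.
- by rewrite sub0r normrN (ger0_norm t0) (@ler0_norm _ h); lra.
- by rewrite !ger0_norm; lra.
- by move: b; rewrite ltNge T0.
Qed.
End Primitive.

Lemma mn_le_parts (R : realType) n q (A : 'M[complex R]_(n, q)) B : (forall a b, `|complex.Re (A a b)| <= B) ->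
  (forall a b, `|complex.Im (A a b)| <= B) -> mn A <= (2 * n * q)%:R * B.
Proof.
move=> hr hi; have -> : (2 * n * q)%:R * B = \sum_(i < n) \sum_(j < q) (B + B).
  by rewrite !sumr_const !card_ord -[B + B]mulr2n -!mulrnA mulr_natl; congr (_ *+ _); lia.
by apply: ler_sum => i _; apply: ler_sum => j _; apply: lerD.
Qed.

Section Solutions.
Variable R : realType.
Local Notation C := (complex R).
Notation mu := (@lebesgue_measure R).
Variables n m q : nat.
Variables (H0 : 'M[C]_n) (Hs : 'I_m -> 'M[C]_n).
Hypothesis hH0 : is_hermitian H0.
Hypothesis hHs : forall k, is_hermitian (Hs k).
Local Notation H := (Hu H0 Hs).
Variables (U : set 'rV[R]_m) (T : R) (u : R -> 'rV[R]_m) (X : R -> 'M[C]_(n, q)).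
Hypothesis T0 : 0 <= T.
Hypothesis adm : admissible U T u.
Hypothesis sol : is_sol H T u X.

(** Index 0 is the drift, with coefficient 1, so that -i H(u) becomes linear in the coefficients. *)
Definition generator (i : 'I_m.+1) : 'M[C]_n := - iC R *: (if unlift ord0 i is Some k then Hs k else H0).
Definition coefficient (i : 'I_m.+1) (s : R) : R := if unlift ord0 i is Some k then u s 0 k else 1.
Local Notation K := generator.

Lemma generator_sum s : - iC R *: H (u s) = \sum_i cR (coefficient i s) *: K i.
Proof.
rewrite big_ord_recl /coefficient /generator unlift_none cR1 scale1r scalerDr; congr (_ + _).
by rewrite scaler_sumr; apply: eq_bigr => i _; rewrite liftK !scalerA mulrC.
Qed.

Lemma generator_skew i : adj (K i) = - K i.
Proof.
rewrite /generator adjZ conj_NiC scaleNr opprK.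
by case: (unlift _ _) => [k|]; rewrite ?hHs ?hH0.
Qed.

Local Notation F s := ((- iC R) *: (H (u s) *m X s)).

Lemma vector_field_sum s : F s = \sum_i cR (coefficient i s) *: (K i *m X s).
Proof.
rewrite scalemxAl generator_sum mulmx_suml; apply: eq_bigr => i _.
by rewrite -scalemxAl.
Qed.

Lemma Re_sum_cR (I : finType) (c : I -> R) (A : I -> 'M[C]_(n, q)) a b :
  complex.Re ((\sum_i cR (c i) *: A i) a b) = \sum_i complex.Re (A i a b) * c i.
Proof.
rewrite summxE Re_sum; apply: eq_bigr => i _; rewrite mxZE; case: (A i a b) => x y /=.
by ring.
Qed.
Lemma Im_sum_cR (I : finType) (c : I -> R) (A : I -> 'M[C]_(n, q)) a b :
  complex.Im ((\sum_i cR (c i) *: A i) a b) = \sum_i complex.Im (A i a b) * c i.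
Proof.
rewrite summxE Im_sum; apply: eq_bigr => i _; rewrite mxZE; case: (A i a b) => x y /=.
by ring.
Qed.

Lemma Re_primitive a b : primitive_of T (fun t => complex.Re (X t a b)) (fun s => complex.Re (F s a b)).
Proof. by have [h1 [_ h3]] := sol a b; split=> // t /h3 []. Qed.
Lemma Im_primitive a b : primitive_of T (fun t => complex.Im (X t a b)) (fun s => complex.Im (F s a b)).
Proof. by have [_ [h2 h3]] := sol a b; split=> // t /h3 []. Qed.

(** No Gronwall estimate: [is_sol] includes integrability of the vector field, and the primitive of
    an integrable function is bounded. *)
Lemma sol_bounded : exists2 B : R, 0 <= B & forall t, I0 T t -> mn (X t) <= B.
Proof.
pose br (p : 'I_n * 'I_q) := projT1 (cid (primitive_bounded (Re_primitive p.1 p.2))).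
pose bi (p : 'I_n * 'I_q) := projT1 (cid (primitive_bounded (Im_primitive p.1 p.2))).
have hr p t : I0 T t -> `|complex.Re (X t p.1 p.2)| <= br p.
  by rewrite /br; case: cid => x hx /=; exact: hx.
have hi p t : I0 T t -> `|complex.Im (X t p.1 p.2)| <= bi p.
  by rewrite /bi; case: cid => x hx /=; exact: hx.
exists (\sum_i \sum_j (br (i, j) + bi (i, j))).
  have I00 : I0 T 0 by rewrite /I0 /= in_itv /= lexx.
  apply: sumr_ge0 => i _; apply: sumr_ge0 => j _; apply: addr_ge0.
    exact: le_trans (hr (i, j) 0 I00).
  exact: le_trans (hi (i, j) 0 I00).
by move=> t It; apply: ler_sum => i _; apply: ler_sum => j _; apply: lerD; [exact: (hr (i, j))|exact: (hi (i, j))].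
Qed.

Lemma coefficient_bound : exists2 M : R, 0 <= M &
  {ae mu, forall s, I0 T s -> forall i, `|coefficient i s| <= M}.
Proof.
have [_ [_ [M hM]]] := adm; exists (Num.max 1 M); first by rewrite le_max ler01.
have Fae : Filter (nbhs (almost_everywhere mu)) by exact: ae_filter_ringOfSetsType.
have := @filter_forall _ _ _ _ Fae hM; apply: filterS => s h Is i; rewrite /coefficient.
case: (unlift ord0 i) => [k|]; last by rewrite normr1 le_max lexx.
by apply: (le_trans (h k Is)); rewrite le_max lexx orbT.
Qed.

Lemma coefficient_integrable i : mu.-integrable (I0 T) (EFin \o coefficient i).
Proof.
have [M M0 hM] := coefficient_bound; have [_ [mu_u _]] := adm.
have mI : measurable (I0 T : set (measurableTypeR R)) by exact: measurable_itv.
apply: (bounded_integrable mI _ M0).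
- rewrite lebesgue_measure_itv /= lte_fin; case: ifP => // _.
  by rewrite -EFinD ltry.
- rewrite /coefficient; case: (unlift ord0 i) => [k|]; first exact: mu_u.
  exact: measurable_cst.
have Fae : Filter (nbhs (almost_everywhere mu)) by exact: ae_filter_ringOfSetsType.
by apply: filterS hM => s h Is; exact: h.
Qed.

Lemma mn_sum_coefficient M (A : 'I_m.+1 -> 'M[C]_(n, q)) s : (forall i, `|coefficient i s| <= M) ->
  mn (\sum_i cR (coefficient i s) *: A i) <= M * \sum_i mn (A i).
Proof.
move=> h; apply: (le_trans (mn_sum _ _ _)); rewrite mulr_sumr; apply: ler_sum => i _.
by rewrite mn_cR ler_wpM2r // mn_ge0.
Qed.

(** [w i] is the integral of the i-th coefficient over the time interval. Freezing the state at time
    [s] costs the Lipschitz bound on [X] times the length of the interval, hence a quadratic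
    error. *)
Lemma sol_increment : exists2 c : R, 0 <= c & forall s t, 0 <= s -> s <= t -> t <= T ->
  [/\ mn (X s) <= c, mn (X t - X s) <= c * (t - s) & exists2 w : 'I_m.+1 -> R,
     (forall i, `|w i| <= c * (t - s)) &
     mn (X t - X s - \sum_i cR (w i) *: (K i *m X s)) <= c * (t - s) ^+ 2].
Proof.
have [B B0 hB] := sol_bounded; have [M M0 hM] := coefficient_bound.
have Fae : Filter (nbhs (almost_everywhere mu)) by exact: ae_filter_ringOfSetsType.
pose k := \sum_i mn (K i); have k0 : 0 <= k by apply: sumr_ge0 => i _; exact: mn_ge0.
have sumK s0 : \sum_i mn (K i *m X s0) <= k * mn (X s0).
  by rewrite mulr_suml; apply: ler_sum => i _; exact: mnM.
pose d : R := (2 * n * q)%:R; have d0 : 0 <= d by rewrite ler0n.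
pose c1 := M * (k * B); have c10 : 0 <= c1 by rewrite !mulr_ge0.
have lip s t : 0 <= s -> s <= t -> t <= T -> mn (X t - X s) <= d * (c1 * (t - s)).
  move=> s0 st tT.
  have ae1 : {ae mu, forall r, I0 T r -> s < r -> r <= t -> mn (F r) <= c1}.
    apply: filterS hM => r h Ir _ _; rewrite vector_field_sum.
    apply: (le_trans (mn_sum_coefficient _ (h Ir))); apply: ler_wpM2l => //.
    by apply: (le_trans (sumK r)); apply: ler_wpM2l => //; exact: hB.
  (* An empty family of integrands turns [primitive_increment] into a plain Lipschitz bound. *)
  have nog i : mu.-integrable (I0 T) (EFin \o (fun (i : 'I_0) (_ : R) => 0 : R) i) by case: i.
  apply: mn_le_parts => a b.
    rewrite mxDE mxNE ReB; have := primitive_increment (c := fun _ => 0) (Re_primitive a b) nog s0 st tT c10.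
    rewrite !big_ord0 !subr0; apply; apply: filterS ae1 => r h Ir sr rt; rewrite subr0.
    exact: le_trans (Re_le_cn _) (le_trans (mn_entry _ _ _) (h Ir sr rt)).
  rewrite mxDE mxNE ImB; have := primitive_increment (c := fun _ => 0) (Im_primitive a b) nog s0 st tT c10.
  rewrite !big_ord0 !subr0; apply; apply: filterS ae1 => r h Ir sr rt; rewrite subr0.
  exact: le_trans (Im_le_cn _) (le_trans (mn_entry _ _ _) (h Ir sr rt)).
pose c2 := M * (k * (d * c1)); have c20 : 0 <= c2 by rewrite !mulr_ge0.
exists (B + d * c1 + M + d * c2); first by rewrite !addr_ge0 // mulr_ge0.
move=> s t s0 st tT; have ts : 0 <= t - s by rewrite subr_ge0.
have Is : I0 T s by rewrite /I0 /= in_itv /= s0 (le_trans st).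
have dc1 : 0 <= d * c1 by rewrite mulr_ge0.
have dc2 : 0 <= d * c2 by rewrite mulr_ge0.
split.
- by apply: (le_trans (hB s Is)); rewrite -!addrA lerDl !addr_ge0.
- apply: (le_trans (lip s t s0 st tT)); rewrite mulrA; apply: ler_wpM2r => //.
  by rewrite -addrA addrAC lerDr !addr_ge0.
exists (fun i => \int[mu]_(r in `]s, t]%classic) coefficient i r).
  have sub := ocI0_sub s0 tT.
  move=> i; apply: (@le_trans _ _ (M * (t - s))); last first.
    by apply: ler_wpM2r => //; rewrite -addrA [M + _]addrC addrA lerDr !addr_ge0.
  apply: Rintegral_bound => //.
    have mI : measurable (I0 T : set (measurableTypeR R)) by exact: measurable_itv.
    have mJ : measurable (`]s, t]%classic : set (measurableTypeR R)) by exact: measurable_itv.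
    exact: integrableS mI mJ sub (coefficient_integrable i).
  by apply: filterS hM => r h rst; apply: h; exact: sub.
have ae2 : {ae mu, forall r, I0 T r -> s < r -> r <= t ->
    mn (F r - \sum_i cR (coefficient i r) *: (K i *m X s)) <= c2 * (t - s)}.
  apply: filterS hM => r h Ir sr rt; rewrite vector_field_sum -sumrB.
  under eq_bigr => i _ do rewrite -scalerBr -mulmxBr.
  apply: (le_trans (mn_sum_coefficient _ (h Ir))); rewrite /c2 -!mulrA; apply: ler_wpM2l => //.
  apply: (@le_trans _ _ (k * mn (X r - X s))).
    by rewrite mulr_suml; apply: ler_sum => i _; exact: mnM.
  apply: ler_wpM2l => //; apply: (le_trans (lip s r s0 (ltW sr) (le_trans rt tT))).
  by rewrite -[M * (k * (B * _))]/(M * (k * (B * (t - s)))) !mulrA !ler_wpM2l // ?mulr_ge0 // lerB.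
have c2t : 0 <= c2 * (t - s) by rewrite mulr_ge0.
have cint i := coefficient_integrable i.
apply: (@le_trans _ _ (d * (c2 * (t - s) * (t - s)))); last first.
  rewrite -(mulrA c2) -expr2 mulrA; apply: ler_wpM2r; first exact: sqr_ge0.
  by rewrite lerDr !addr_ge0.
apply: mn_le_parts => a b.
  rewrite mxDE mxNE ReB mxDE mxNE ReB Re_sum_cR.
  apply: (primitive_increment (Re_primitive a b) cint s0 st tT c2t).
  apply: filterS ae2 => r h Ir sr rt.
  by rewrite -Re_sum_cR -ReB -mxNE -mxDE; exact: le_trans (Re_le_cn _) (le_trans (mn_entry _ _ _) (h Ir sr rt)).
rewrite mxDE mxNE ImB mxDE mxNE ImB Im_sum_cR.
apply: (primitive_increment (Im_primitive a b) cint s0 st tT c2t).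
apply: filterS ae2 => r h Ir sr rt.
by rewrite -Im_sum_cR -ImB -mxNE -mxDE; exact: le_trans (Im_le_cn _) (le_trans (mn_entry _ _ _) (h Ir sr rt)).
Qed.

(** The first-order increment is [W *m X s] with [W] skew, so it cancels in the Gram matrix, whose
    increments are therefore quadratic in the time step. *)
Lemma sol_gram : adj (X T) *m X T = adj (X 0) *m X 0.
Proof.
have [c c0 hc] := sol_increment.
have key s t : 0 <= s -> s <= t -> t <= T ->
    mn (adj (X t) *m X t - adj (X s) *m X s) <= (3 * c ^+ 2) * (t - s) ^+ 2.
  move=> s0 st tT; have [Xs dX [w _ hD]] := hc s t s0 st tT; have ts : 0 <= t - s by rewrite subr_ge0.
  pose W := \sum_i cR (w i) *: K i.
  have WE : \sum_i cR (w i) *: (K i *m X s) = W *m X s.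
    by rewrite mulmx_suml; apply: eq_bigr => i _; rewrite scalemxAl.
  have Ws : adj W = - W.
    by rewrite adj_sum -sumrN; apply: eq_bigr => i _; rewrite adjZ conj_cR generator_skew scalerN.
  move: hD; rewrite WE; set D := (X in mn X) => hD.
  have E : X t - X s = W *m X s + D by rewrite /D [W *m _ + _]addrC subrK.
  have -> : adj (X t) *m X t - adj (X s) *m X s =
      adj (X s) *m D + adj D *m X s + adj (X t - X s) *m (X t - X s).
    have -> : adj (X s) *m D + adj D *m X s = adj (X s) *m (X t - X s) + adj (X t - X s) *m X s.
      clearbody D; rewrite E adjD adjM Ws !mxdistr !mulmxA.
      by move: (adj (X s) *m W *m X s) (adj (X s) *m D) (adj D *m X s) => a1 a2 a3; mxadd.
    rewrite adjB !mxdistr; move: (adj (X t) *m X t) (adj (X s) *m X s) (adj (X s) *m X t) (adj (X t) *m X s) => a1 a2 a3 a4.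
    by mxadd.
  have h1 : mn (adj (X s) *m D) <= c * (c * (t - s) ^+ 2).
    by apply: (le_trans (mnM _ _)); rewrite mn_adj; apply: ler_pM; rewrite ?mn_ge0.
  have h2 : mn (adj D *m X s) <= c * (c * (t - s) ^+ 2).
    by apply: (le_trans (mnM _ _)); rewrite mn_adj mulrC; apply: ler_pM; rewrite ?mn_ge0.
  have h3 : mn (adj (X t - X s) *m (X t - X s)) <= (c * (t - s)) * (c * (t - s)).
    by apply: (le_trans (mnM _ _)); rewrite mn_adj; apply: ler_pM; rewrite ?mn_ge0.
  apply: (le_trans (mnD _ _)); apply: (le_trans (lerD (mnD _ _) (lexx _))).
  apply: (le_trans (lerD (lerD h1 h2) h3)); rewrite le_eqVlt; apply/orP; left; apply/eqP; ring.
have c3 : 0 <= 3 * c ^+ 2 by rewrite mulr_ge0 // sqr_ge0.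
apply/matrixP => i j; apply/eqP; rewrite eq_complex; apply/andP; split; apply/eqP.
  apply: (@quadratic_cst _ T (fun t => complex.Re ((adj (X t) *m X t) i j)) _ T0 c3) => s t s0 st tT.
  rewrite -ReB -mxNE -mxDE.
  exact: le_trans (Re_le_cn _) (le_trans (mn_entry _ _ _) (key s t s0 st tT)).
apply: (@quadratic_cst _ T (fun t => complex.Im ((adj (X t) *m X t) i j)) _ T0 c3) => s t s0 st tT.
rewrite -ImB -mxNE -mxDE.
exact: le_trans (Im_le_cn _) (le_trans (mn_entry _ _ _) (key s t s0 st tT)).
Qed.
End Solutions.

(** * Unit complex numbers *)

Section Cis.
Variable R : realType.
Local Notation C := (complex R).
Implicit Types x y : R.

Definition cis x : C := Complex (cos x) (sin x).

Lemma cis0 : cis 0 = 1. Proof. by rewrite /cis cos0 sin0. Qed.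
Lemma cisD x y : cis (x + y) = cis x * cis y.
Proof. by apply/eqP; rewrite eq_complex /= cosD sinD; apply/andP; split; apply/eqP; ring. Qed.
Lemma conj_cis x : conjc (cis x) = cis (- x).
Proof. by rewrite /cis cosN sinN. Qed.
Lemma cis_conj x : cis x * conjc (cis x) = 1.
Proof. by rewrite conj_cis -cisD subrr cis0. Qed.
Lemma cis_sum (I : Type) (s : seq I) (F : I -> R) : cis (\sum_(i <- s) F i) = \prod_(i <- s) cis (F i).
Proof.
by elim: s => [|i s IH]; rewrite ?big_nil ?cis0 // !big_cons cisD IH.
Qed.
Lemma abs_sin_le x : `|sin x| <= `|x|.
Proof.
suff pos y : 0 <= y -> `|sin y| <= y.
  have [x0|x0] := leP 0 x; first by rewrite (ger0_norm x0); exact: pos.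
  by rewrite -normrN -sinN (ltr0_norm x0); apply: pos; rewrite oppr_ge0 ltW.
move=> y0; have [c _ E] := @MVT_segment R sin cos 0 y y0 (fun x _ => is_derive_sin x)
  (continuous_subspaceT (fun x => @continuous_sin R x)).
move: E; rewrite sin0 !subr0 => ->; rewrite normrM (ger0_norm y0).
by rewrite ler_piMl // cos_max.
Qed.

Lemma cos_quadratic x : `|cos x - 1| <= x ^+ 2 / 2.
Proof.
have -> : cos x - 1 = - (sin (x / 2) ^+ 2 *+ 2).
  have E : x = x / 2 *+ 2 by rewrite mulr2n -splitr.
  by have := cos_mulr2n (x / 2); rewrite -E sin2cos2 => ->; rewrite !mulr2n; move: (_ ^+ 2) => c; ring.
rewrite normrN ger0_norm; last by rewrite mulrn_wge0 // sqr_ge0.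
have h : sin (x / 2) ^+ 2 <= (x / 2) ^+ 2.
  rewrite -(real_normK (num_real (sin _))) -[leRHS](real_normK (num_real _)).
  by rewrite ler_sqr ?nnegrE // abs_sin_le.
by rewrite -mulr_natr; move: h; rewrite expr_div_n; lra.
Qed.

Lemma sin_quadratic x : `|sin x - x| <= x ^+ 2.
Proof.
suff pos y : 0 <= y -> `|sin y - y| <= y ^+ 2.
  have [x0|x0] := leP 0 x; first exact: pos.
  have := pos (- x); rewrite sinN -opprD normrN sqrrN; apply.
  by rewrite oppr_ge0 ltW.
move=> y0; have [y2|y2] := leP y 2; last first.
  apply: (le_trans (ler_normB _ _)); have := abs_sin_le y; rewrite (ger0_norm y0) => h.
  by rewrite expr2; nra.
have df z : z \in `]0, y[%R -> is_derive z 1 (fun z => sin z - z) (cos z - 1).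
  by move=> _; apply: is_deriveB.
have cf : {within `[0, y], continuous (fun z : R => sin z - z)}.
  apply: continuous_subspaceT => z; apply: cvgB; [exact: continuous_sin|exact: cvg_id].
have [c cI E] := @MVT_segment R _ _ 0 y y0 df cf.
move: E; rewrite sin0 !subr0 => ->; rewrite normrM (ger0_norm y0).
move: cI; rewrite in_itv /= => /andP [c0 cy].
have h : `|cos c - 1| <= y.
  apply: (le_trans (cos_quadratic c)); rewrite expr2.
  by clear -c0 cy y2; nra.
by rewrite expr2; apply: ler_wpM2r.
Qed.

Lemma cis_quadratic x : cn (cis x - 1 - iC R * cR x) <= 2 * x ^+ 2.
Proof.
rewrite /cn /cis /= !mul0r !mul1r subrr !subr0 add0r.
have := cos_quadratic x; have := sin_quadratic x; have := sqr_ge0 x.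
by move: (x ^+ 2) `|sin x - x| `|cos x - 1| => a b c; lra.
Qed.
End Cis.

(** * Exponentials of skew-Hermitian matrices *)

Section Spectral.
Variable R : realType.
Variable n : nat.
Local Notation C := (complex R).
Implicit Types (W A : 'M[C]_n) (d e : 'I_n -> C) (r : 'I_n -> R).

Definition conj_diag W d : 'M[C]_n := W *m diag_mx (\row_k d k) *m adj W.
Local Notation dg := conj_diag.

Lemma conj_diagM W d e : adj W *m W = 1%:M -> dg W d *m dg W e = dg W (fun k => d k * e k).
Proof.
move=> W1; rewrite /dg !mulmxA -[_ *m adj W *m W]mulmxA W1 mulmx1 -[W *m _ *m diag_mx _]mulmxA.
congr (_ *m _ *m _); apply/matrixP => i j; rewrite mul_diag_mx !mxE.
by case: eqP => [->|_]; rewrite ?mulr1n ?mulr0n ?mulr0.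
Qed.
Lemma conj_diag1 W : adj W *m W = 1%:M -> dg W (fun _ => 1) = 1%:M.
Proof.
move=> W1; rewrite /dg; have -> : diag_mx (\row_(k < n) (1 : C)) = 1%:M.
  by apply/matrixP => i j; rewrite !mxE; case: eqP.
by rewrite mulmx1; exact: mulmx1C.
Qed.
Lemma adj_conj_diag W d : adj (dg W d) = dg W (fun k => conjc (d k)).
Proof.
rewrite /dg !adjM adjK adj_diag mulmxA; congr (_ *m diag_mx _ *m _).
by apply/rowP => k; rewrite !mxE.
Qed.
Lemma conj_diagD W d e : dg W (fun k => d k + e k) = dg W d + dg W e.
Proof.
rewrite /dg -mulmxDl -mulmxDr; congr (_ *m _ *m _); apply/matrixP => i j.
by rewrite !mxE mulrnDl.
Qed.
Lemma conj_diagZ W z d : dg W (fun k => z * d k) = z *: dg W d.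
Proof.
rewrite /dg scalemxAl scalemxAr; congr (_ *m _ *m _); apply/matrixP => i j.
by rewrite !mxE mulrnAr.
Qed.
Lemma mn_conj_diag W d : adj W *m W = 1%:M -> mn (dg W d) <= (2 * n * n)%:R ^+ 2 * \sum_k cn (d k).
Proof.
move=> W1; have mW := mn_isometry W1.
have mW' : mn (adj W) <= (2 * n * n)%:R by rewrite mn_adj.
have md : mn (diag_mx (\row_k d k)) = \sum_k cn (d k).
  apply: eq_bigr => i _; rewrite (bigD1 i) //= !mxE eqxx mulr1n big1 ?addr0 // => j ji.
  by rewrite !mxE eq_sym (negPf ji) mulr0n cn0.
apply: (le_trans (mnM _ _)); apply: (le_trans (ler_wpM2r (mn_ge0 _) (mnM _ _))); rewrite md.
have s0 : 0 <= \sum_k cn (d k) by apply: sumr_ge0 => k _; exact: cn_ge0.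
rewrite mulrAC expr2; apply: ler_wpM2r => //.
by apply: ler_pM; rewrite ?mn_ge0.
Qed.
Lemma det_conj_diag W d : adj W *m W = 1%:M -> \det (dg W d) = \prod_k d k.
Proof.
move=> W1; rewrite /dg !det_mulmx mulrAC -det_mulmx (mulmx1C W1) det1 mul1r det_diag.
by apply: eq_bigr => k _; rewrite mxE.
Qed.
Lemma tr_conj_diag W d : adj W *m W = 1%:M -> \tr (dg W d) = \sum_k d k.
Proof.
move=> W1; rewrite /dg mxtrace_mulC mulmxA W1 mul1mx mxtrace_diag.
by apply: eq_bigr => k _; rewrite mxE.
Qed.

Lemma eigbasis_conj_diag A : is_hermitian A -> A = dg (eigbasis A) (fun k => cR (lam A k)).
Proof. by move=> hA; have [_ E] := eigbasisP hA. Qed.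

Lemma lam_bound A (k : 'I_n) : is_hermitian A -> `|lam A k| <= (2 * n * n)%:R ^+ 2 * mn A.
Proof.
move=> hA; have [W1 E] := eigbasisP hA.
have W2 := mulmx1C W1.
have D : adj (eigbasis A) *m A *m eigbasis A = diag_mx (\row_k cR (lam A k)).
  by rewrite {2}E !mulmxA W1 mul1mx -mulmxA W1 mulmx1.
rewrite -cn_cR; have -> : cR (lam A k) = (adj (eigbasis A) *m A *m eigbasis A) k k.
  by rewrite D !mxE eqxx mulr1n.
apply: (le_trans (mn_entry _ _ _)); apply: (le_trans (mnM _ _)).
apply: (le_trans (ler_wpM2r (mn_ge0 _) (mnM _ _))); rewrite mn_adj mulrAC expr2.
by rewrite ler_wpM2r ?mn_ge0 // ler_pM ?mn_ge0 // mn_isometry.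
Qed.

Lemma lam_tr A : is_hermitian A -> \tr A = cR (\sum_(k < n) lam A k).
Proof.
move=> hA; have [W1 _] := eigbasisP hA.
by rewrite {1}(eigbasis_conj_diag hA) tr_conj_diag // cR_sum.
Qed.

Definition uexp W r : 'M[C]_n := dg W (fun k => cis (r k)).

Lemma uexp_unitary W r : adj W *m W = 1%:M -> adj (uexp W r) *m uexp W r = 1%:M.
Proof.
move=> W1; rewrite /uexp adj_conj_diag conj_diagM // -[RHS](conj_diag1 W1); congr dg.
by apply/funext => k; rewrite mulrC cis_conj.
Qed.
Lemma uexpD W r1 r2 : adj W *m W = 1%:M -> uexp W (fun k => r1 k + r2 k) = uexp W r1 *m uexp W r2.
Proof. by move=> W1; rewrite /uexp conj_diagM //; congr dg; apply/funext => k; rewrite cisD. Qed.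
Lemma uexp_det W r : adj W *m W = 1%:M -> \det (uexp W r) = cis (\sum_k r k).
Proof. by move=> W1; rewrite det_conj_diag // cis_sum. Qed.

Lemma uexp_quadratic W r : adj W *m W = 1%:M ->
  mn (uexp W r - 1%:M - iC R *: dg W (fun k => cR (r k))) <= (2 * n * n)%:R ^+ 2 * (2 * \sum_k r k ^+ 2).
Proof.
move=> W1; have -> : uexp W r - 1%:M - iC R *: dg W (fun k => cR (r k)) =
    dg W (fun k => cis (r k) - 1 - iC R * cR (r k)).
  have -> : (fun k => cis (r k) - 1 - iC R * cR (r k)) = (fun k => cis (r k) + -1 * 1 + - iC R * cR (r k)).
    by apply/funext => k; rewrite mulN1r mulNr.
  rewrite (conj_diagD W (fun k => cis (r k) + -1 * 1) (fun k => - iC R * cR (r k))).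
  rewrite (conj_diagD W (fun k => cis (r k)) (fun _ => -1 * 1)).
  by rewrite (conj_diagZ W (-1) (fun _ => 1)) conj_diag1 // scaleN1r conj_diagZ scaleNr.
apply: (le_trans (mn_conj_diag _ W1)); apply: ler_wpM2l; first exact: sqr_ge0.
by rewrite mulr_sumr; apply: ler_sum => k _; exact: cis_quadratic.
Qed.

(** [E] is the exponential of [K], obtained by diagonalizing the Hermitian matrix -i K and applying
    [cis] to its eigenvalues. *)
Lemma skew_exp : exists2 c : R, 0 <= c & forall K : 'M[C]_n, adj K = - K -> exists E : 'M[C]_n,
  [/\ adj E *m E = 1%:M, \det E = cis (complex.Im (\tr K)) & mn (E - 1%:M - K) <= c * mn K ^+ 2].
Proof.
pose b : R := (2 * n * n)%:R ^+ 2; have b0 : 0 <= b by exact: sqr_ge0.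
exists (b * (2 * (n%:R * b ^+ 2))); first by rewrite !mulr_ge0 // sqr_ge0.
move=> K hK; pose A := - iC R *: K.
have KE : K = iC R *: A by rewrite scalerA mulrN iC2 opprK scale1r.
have hA : is_hermitian A.
  by rewrite /is_hermitian adjZ hK conj_NiC scalerN -scaleNr.
have mA : mn A = mn K by rewrite KE mn_iC.
have [W1 _] := eigbasisP hA.
exists (uexp (eigbasis A) (lam A)); split.
- exact: uexp_unitary.
- rewrite uexp_det // {1}KE mxtraceZ lam_tr //=.
  by congr cis; rewrite mul0r mul1r add0r.
have := uexp_quadratic (lam A) W1; rewrite -eigbasis_conj_diag // -KE => h.
apply: (le_trans h); rewrite -(mulrA b) -(mulrA 2) -(mulrA n%:R); apply: ler_wpM2l => //; apply: ler_wpM2l => //.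
have -> : n%:R * (b ^+ 2 * mn K ^+ 2) = \sum_(k < n) (b * mn A) ^+ 2.
  by rewrite sumr_const card_ord mulr_natl mA -exprMn.
apply: ler_sum => k _.
rewrite -(real_normK (num_real (lam A k))) ler_sqr ?nnegrE ?mulr_ge0 ?mn_ge0 //.
exact: lam_bound.
Qed.
End Spectral.

(** * Lipschitz dependence of the determinant *)

Section Determinant.
Variable R : realType.
Local Notation C := (complex R).

Lemma cn_prod_le (I : Type) (s : seq I) (a : I -> C) (M : R) : 1 <= M -> (forall i, cn (a i) <= M) ->
  cn (\prod_(i <- s) a i) <= M ^+ size s.
Proof.
move=> M1 ha; elim: s => [|i s IH]; first by rewrite big_nil cn1.
by rewrite big_cons exprS; apply: (le_trans (cnM _ _)); apply: ler_pM; rewrite ?cn_ge0.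
Qed.

Lemma cn_prod_lip (I : Type) (s : seq I) (a b : I -> C) (M : R) : 1 <= M ->
  (forall i, cn (a i) <= M) -> (forall i, cn (b i) <= M) ->
  cn (\prod_(i <- s) a i - \prod_(i <- s) b i) <= M ^+ size s * \sum_(i <- s) cn (a i - b i).
Proof.
move=> M1 ha hb; elim: s => [|i s IH]; first by rewrite !big_nil subrr cn0 mulr0.
rewrite !big_cons; set p := \prod_(j <- s) a j; set p' := \prod_(j <- s) b j.
have -> : a i * p - b i * p' = (a i - b i) * p + b i * (p - p') by ring.
apply: (le_trans (cnD _ _)); rewrite [X in _ <= X]mulrDr; have M0 : 0 <= M by exact: le_trans M1.
apply: lerD.
  apply: (le_trans (cnM _ _)); rewrite mulrC; apply: ler_wpM2r; first exact: cn_ge0.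
  apply: (le_trans (cn_prod_le s M1 ha)); rewrite exprS ler_peMl // exprn_ge0 //.
apply: (le_trans (cnM _ _)); rewrite exprS -mulrA; apply: ler_pM; rewrite ?cn_ge0 //.
Qed.

Lemma det_lip n (M : R) : 1 <= M -> exists2 c : R, 0 <= c & forall A B : 'M[C]_n, mn A <= M -> mn B <= M ->
  cn (\det A - \det B) <= c * mn (A - B).
Proof.
move=> M1; have M0 : 0 <= M by exact: le_trans M1.
exists (\sum_(s : 'S_n) M ^+ size (index_enum 'I_n)).
  by apply: sumr_ge0 => s _; exact: exprn_ge0.
move=> A B hA hB; rewrite /determinant -sumrB; apply: (le_trans (cn_sum _ _ _)).
rewrite mulr_suml; apply: ler_sum => s _; rewrite -mulrBr.
have -> z : cn ((-1) ^+ s * z) = cn z :> R by case: (odd_perm s); rewrite ?expr1 ?mulN1r ?cnN ?mul1r.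
apply: (le_trans (cn_prod_lip _ M1 _ _)).
- by move=> i; apply: le_trans hA; exact: mn_entry.
- by move=> i; apply: le_trans hB; exact: mn_entry.
apply: ler_wpM2l; first exact: exprn_ge0.
apply: ler_sum => i _; rewrite -mxNE -mxDE (bigD1 (s i)) //= lerDl.
by apply: sumr_ge0 => j _; exact: cn_ge0.
Qed.
End Determinant.

Section SolutionDeterminant.
Variable R : realType.
Local Notation C := (complex R).
Variables n m : nat.
Variables (H0 : 'M[C]_n) (Hs : 'I_m -> 'M[C]_n).
Hypothesis hH0 : is_hermitian H0.
Hypothesis hHs : forall k, is_hermitian (Hs k).
Local Notation H := (Hu H0 Hs).
Variables (U : set 'rV[R]_m) (T : R) (u : R -> 'rV[R]_m) (X : R -> 'M[C]_n).
Hypothesis T0 : 0 <= T.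
Hypothesis adm : admissible U T u.
Hypothesis sol : is_sol H T u X.
Hypothesis trH0 : \tr H0 = 0.
Hypothesis trHs : forall k, \tr (Hs k) = 0.

Local Notation K := (generator H0 Hs).

(** In place of Liouville's formula, [X t] is compared with [E *m X s], where [E] is the exponential
    of the traceless skew increment [W] and has determinant 1; their difference is quadratic. *)
Lemma sol_det : \det (X T) = \det (X 0).
Proof.
have [c c0 hc] := sol_increment T0 adm sol.
have [b b0 hexp] := skew_exp R n.
pose M := 1 + c + (2 * n * n)%:R * c; have M1 : 1 <= M by rewrite /M -addrA lerDl addr_ge0 // mulr_ge0.
have [d d0 hdet] := det_lip n M1.
pose k := \sum_i mn (K i); have k0 : 0 <= k by apply: sumr_ge0 => i _; exact: mn_ge0.
pose q := d * (c + b * (c * k) ^+ 2 * c).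
have q0 : 0 <= q by rewrite mulr_ge0 // addr_ge0 // !mulr_ge0 // sqr_ge0.
have key s t : 0 <= s -> s <= t -> t <= T -> cn (\det (X t) - \det (X s)) <= q * (t - s) ^+ 2.
  move=> s0 st tT; have [Xs dX [w hw hD]] := hc s t s0 st tT; have ts : 0 <= t - s by rewrite subr_ge0.
  pose W := \sum_i cR (w i) *: K i.
  have WE : \sum_i cR (w i) *: (K i *m X s) = W *m X s.
    by rewrite mulmx_suml; apply: eq_bigr => i _; rewrite scalemxAl.
  have Ws : adj W = - W.
    by rewrite adj_sum -sumrN; apply: eq_bigr => i _; rewrite adjZ conj_cR (generator_skew hH0 hHs) scalerN.
  have trW : \tr W = 0.
    rewrite raddf_sum big1 // => i _; rewrite /= !mxtraceZ.
    by case: (unlift ord0 i) => [j|]; rewrite ?trHs ?trH0 !mulr0.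
  have mW : mn W <= c * k * (t - s).
    apply: (le_trans (mn_sum _ _ _)); rewrite mulrAC mulr_sumr; apply: ler_sum => i _.
    by rewrite mn_cR; apply: ler_wpM2r; rewrite ?mn_ge0.
  have [E [E1 Ed Eq]] := hexp W Ws.
  have -> : \det (X s) = \det (E *m X s) by rewrite det_mulmx Ed trW cis0 mul1r.
  have Xt : mn (X t) <= M.
    have [Xt _ _] := hc t t (le_trans s0 st) (lexx t) tT.
    apply: (le_trans Xt); rewrite /M addrAC lerDr addr_ge0 //.
    by rewrite mulr_ge0.
  have EX : mn (E *m X s) <= M.
    apply: (le_trans (mnM _ _)); apply: (@le_trans _ _ ((2 * n * n)%:R * c)).
      by apply: ler_pM; rewrite ?mn_ge0 // mn_isometry.
    by rewrite /M lerDr addr_ge0.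
  apply: (le_trans (hdet _ _ Xt EX)); rewrite /q -mulrA; apply: ler_wpM2l => //.
  have -> : X t - E *m X s = (X t - X s - W *m X s) - (E - 1%:M - W) *m X s.
    rewrite !mulmxBl mul1mx; move: (X t) (X s) (W *m X s) (E *m X s) => a1 a2 a3 a4; mxadd.
  apply: (le_trans (mnB _ _)); rewrite mulrDl; apply: lerD; first by rewrite -WE.
  have -> : b * (c * k) ^+ 2 * c * (t - s) ^+ 2 = b * (c * k * (t - s)) ^+ 2 * c by ring.
  apply: (le_trans (mnM _ _)); apply: ler_pM; rewrite ?mn_ge0 //.
  apply: (le_trans Eq); apply: ler_wpM2l => //.
  by rewrite ler_sqr ?nnegrE ?mn_ge0 // !mulr_ge0.
apply/eqP; rewrite eq_complex; apply/andP; split; apply/eqP.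
  apply: (@quadratic_cst _ T (fun t => complex.Re (\det (X t))) _ T0 q0) => s t s0 st tT.
  rewrite -ReB; exact: le_trans (Re_le_cn _) (key s t s0 st tT).
apply: (@quadratic_cst _ T (fun t => complex.Im (\det (X t))) _ T0 q0) => s t s0 st tT.
rewrite -ImB; exact: le_trans (Im_le_cn _) (key s t s0 st tT).
Qed.
End SolutionDeterminant.

(** * Concatenation of solutions *)

Section Glue.
Variable R : realType.
Notation mu := (@lebesgue_measure R).

Lemma integrable_union d (T : measurableType d) (nu : {measure set T -> \bar R}) (A B : set T) (f : T -> \bar R) :
  measurable A -> measurable B -> [disjoint A & B] ->
  nu.-integrable A f -> nu.-integrable B f -> nu.-integrable (A `|` B) f.
Proof.
move=> mA mB AB /integrableP [mfA fA] /integrableP [mfB fB]; apply/integrableP.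
have mf : measurable_fun (A `|` B) f by apply/measurable_funU.
split=> //; rewrite ge0_integral_setU //; last exact: measurableT_comp.
exact: lte_add_pinfty.
Qed.

(** The added piece is integrated over the half-open interval from T, disjoint from [0, T], and
    evaluated by the fundamental theorem of calculus. *)
Lemma glue_primitive (T T' : R) (x f y g : R -> R) : 0 <= T -> T < T' -> primitive_of T x f ->
  (forall s : R, is_derive s (1 : R) y (g s)) -> continuous g -> y T = x T ->
  primitive_of T' (fun t => if t <= T then x t else y t) (fun s => if s <= T then f s else g s).
Proof.
move=> T0 TT' [intf xE] dy cg yT.
pose h s := if s <= T then f s else g s.
have IT : I0 T T by rewrite /I0 /= in_itv /= T0 lexx.
have mI (s t : R) (b1 b2 : bool) : measurable ([set` Interval (BSide b1 s) (BSide b2 t)] : set (measurableTypeR R)).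
  exact: measurable_itv.
have split_itv t : T <= t -> I0 t = I0 T `|` `]T, t]%classic.
  by move=> Tt; apply: itv_bndbnd_setU; rewrite bnd_simp.
have disj t : [disjoint I0 T & `]T, t]%classic].
  apply/disj_setPS => s []; rewrite /I0 /= !in_itv /= => /andP [_ a] /andP [b _].
  by move: (lt_le_trans b a); rewrite ltxx.
have hL : {in I0 T, h =1 f}.
  by move=> s /set_mem; rewrite /I0 /= in_itv /= /h => /andP [_ ->].
have hR t : {in `]T, t]%classic, h =1 g}.
  by move=> s /set_mem; rewrite /= in_itv /= /h => /andP [a _]; rewrite leNgt a.
have ih1 : mu.-integrable (I0 T) (EFin \o h).
  by move: intf; apply: eq_integrable => [|s sI]; [exact: (mI 0 T true false)|rewrite /= hL].
have ig t : T <= t -> mu.-integrable `]T, t]%classic (EFin \o g).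
  move=> Tt; have : mu.-integrable `[T, t]%classic (EFin \o g).
    apply: continuous_compact_integrable; first exact: segment_compact.
    exact: continuous_subspaceT.
  by apply: (integrableS (mI T t true false) (mI T t false false)); apply: subset_itvr; rewrite bnd_simp.
have ih2 t : T <= t -> mu.-integrable `]T, t]%classic (EFin \o h).
  by move=> /ig; apply: eq_integrable => [|s sI]; [exact: (mI T t false false)|rewrite /= (hR t)].
have ih t : T <= t -> mu.-integrable (I0 t) (EFin \o h).
  move=> Tt; rewrite split_itv //.
  by apply: (integrable_union (mI 0 T true false) (mI T t false false) (disj t) ih1); exact: ih2.
split; first by apply: ih; exact: ltW.
move=> t tT'; rewrite T0; have [tT|Tt] := leP t T.
  rewrite xE; last by move: tT'; rewrite /I0 /= !in_itv /= => /andP [-> _].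
  congr (_ + _)%E; apply: eq_integral => s /set_mem sI; rewrite -/(h s) hL //.
  apply/mem_set; apply: I0_sub tT _ _ => //.
have Tt' := ltW Tt.
have -> : (\int[mu]_(s in I0 t) (if s <= T then f s else g s)%:E =
   \int[mu]_(s in I0 T) (h s)%:E + \int[mu]_(s in `]T, t]%classic) (h s)%:E)%E.
  rewrite split_itv // integral_setU_EFin //.
  - exact: (mI 0 T true false).
  - by apply/measurable_EFinP; rewrite -split_itv //; exact: measurable_int (ih t Tt').
have -> : (\int[mu]_(s in I0 T) (h s)%:E = \int[mu]_(s in I0 T) (f s)%:E)%E.
  by apply: eq_integral => s sI; rewrite hL.
have -> : (\int[mu]_(s in `]T, t]%classic) (h s)%:E = (y t)%:E - (y T)%:E)%E.
  have -> : (\int[mu]_(s in `]T, t]%classic) (h s)%:E = \int[mu]_(s in `]T, t]%classic) (g s)%:E)%E.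
    by apply: eq_integral => s sI; rewrite (hR t).
  rewrite integral_itv_obnd_cbnd; last exact: measurable_int (ig t Tt').
  have cy s : {for s, continuous y} by apply: differentiable_continuous; apply/derivable1_diffP; have := dy s; case.
  apply: continuous_FTC2 => //.
  - exact: continuous_subspaceT.
  - split.
    + by move=> s _; have := dy s; case.
    + by apply: cvg_at_right_filter; exact: cy.
    + by apply: cvg_at_left_filter; exact: cy.
  - by move=> s _; rewrite derive1E; have := dy s; case.
by rewrite addeA -xE // yT addeC subeK.
Qed.
End Glue.

(** * Flows of constant controls *)

Section Flow.
Variable R : realType.
Local Notation C := (complex R).
Variable n : nat.
Implicit Types A M : 'M[C]_n.

(** The unitary group exp(-i t A). *)
Definition flow A (t : R) : 'M[C]_n := uexp (eigbasis A) (fun k => - t * lam A k).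

Lemma flowD A s t : is_hermitian A -> flow A (s + t) = flow A s *m flow A t.
Proof.
move=> hA; have [W1 _] := eigbasisP hA; rewrite /flow -(uexpD _ _ W1).
have -> // : (fun k : 'I_n => - (s + t) * lam A k) = (fun k : 'I_n => - s * lam A k + - t * lam A k).
by apply/funext => k; rewrite opprD mulrDl.
Qed.

Lemma flow0 A : is_hermitian A -> flow A 0 = 1%:M.
Proof.
move=> hA; have [W1 _] := eigbasisP hA; rewrite /flow /uexp -[RHS](conj_diag1 W1); congr conj_diag.
by apply/funext => k; rewrite oppr0 mul0r cis0.
Qed.

Lemma flow_unitary A t : is_hermitian A -> adj (flow A t) *m flow A t = 1%:M.
Proof. by move=> hA; apply: uexp_unitary; have [] := eigbasisP hA. Qed.

Lemma flow_det A t : is_hermitian A -> \tr A = 0 -> \det (flow A t) = 1.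
Proof.
move=> hA tA; have [W1 _] := eigbasisP hA; rewrite uexp_det // -mulr_sumr.
have -> : \sum_(k < n) lam A k = 0 by apply: (@cR_inj R); rewrite -lam_tr.
by rewrite mulr0 cis0.
Qed.

Lemma flow_quadratic A : is_hermitian A -> exists2 c : R, 0 <= c &
  forall h, mn (flow A h - 1%:M - cR h *: (- iC R *: A)) <= c * h ^+ 2.
Proof.
move=> hA; have [W1 _] := eigbasisP hA.
exists ((2 * n * n)%:R ^+ 2 * (2 * \sum_(k < n) lam A k ^+ 2)).
  by rewrite !mulr_ge0 ?sqr_ge0 // sumr_ge0 // => k _; exact: sqr_ge0.
move=> h; have := uexp_quadratic (fun k => - h * lam A k) W1.
have -> : conj_diag (eigbasis A) (fun k => cR (- h * lam A k)) = - cR h *: A.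
  rewrite {3}(eigbasis_conj_diag hA) -conj_diagZ; congr conj_diag.
  by apply/funext => k; rewrite cRM cRN.
rewrite scalerA mulrN -mulNr mulrC -scalerA -/(flow A h) => hq; apply: (le_trans hq).
rewrite -[X in _ <= X]mulrA -[2 * _ * _]mulrA; apply: ler_wpM2l; first exact: sqr_ge0.
rewrite ler_pM2l // mulr_suml; apply: ler_sum => k _.
by rewrite exprMn sqrrN mulrC.
Qed.

(** The left factor [M] permits a second application with -i A in its place, which shows that the
    derivative is itself differentiable, hence continuous as [glue_primitive] requires. *)
Lemma flow_entry_derive A M q (X : 'M[C]_(n, q)) T a b : is_hermitian A ->
  (forall t : R, is_derive t (1 : R) (fun t : R => complex.Re ((M *m flow A (t - T) *m X) a b))
    (complex.Re ((M *m (- iC R *: A) *m flow A (t - T) *m X) a b))) /\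
  (forall t : R, is_derive t (1 : R) (fun t : R => complex.Im ((M *m flow A (t - T) *m X) a b))
    (complex.Im ((M *m (- iC R *: A) *m flow A (t - T) *m X) a b))).
Proof.
move=> hA; have [c c0 hc] := flow_quadratic hA.
have key t h : mn (M *m flow A (t + h - T) *m X - M *m flow A (t - T) *m X -
    cR h *: (M *m (- iC R *: A) *m flow A (t - T) *m X)) <= mn M * c * mn (flow A (t - T)) * mn X * h ^+ 2.
  have -> : t + h - T = h + (t - T) by ring.
  rewrite flowD //; set E := flow A (t - T); set K := - iC R *: A.
  have -> : M *m (flow A h *m E) *m X - M *m E *m X - cR h *: (M *m K *m E *m X) =
      M *m (flow A h - 1%:M - cR h *: K) *m E *m X.
    move: E K (flow A h) => E K F.
    by rewrite !mulmxBr !mulmxBl mulmx1 -scalemxAr -!scalemxAl !mulmxA.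
  rewrite mulrAC; apply: (le_trans (mnM _ _)); apply: ler_wpM2r; first exact: mn_ge0.
  rewrite mulrAC; apply: (le_trans (mnM _ _)); apply: ler_wpM2r; first exact: mn_ge0.
  by rewrite -mulrA; apply: (le_trans (mnM _ _)); apply: ler_wpM2l; rewrite ?mn_ge0.
by split=> t; apply: (@quadratic_is_derive R _ t _ (mn M * c * mn (flow A (t - T)) * mn X) 1 ltr01) => h _;
  [have -> z : h * complex.Re z = complex.Re (cR h * z) by [case: z => x y /=; ring]|
   have -> z : h * complex.Im z = complex.Im (cR h * z) by [case: z => x y /=; ring]];
  rewrite -mxZE -?ReB -?ImB -!mxNE -!mxDE -?ReB -?ImB -?mxNE -?mxDE;
  [apply: le_trans (Re_le_cn _) _|apply: le_trans (Im_le_cn _) _]; apply: (le_trans (mn_entry _ _ _)).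
Qed.
End Flow.

(** * Piecewise constant controls *)

Section Words.
Variable R : realType.
Local Notation C := (complex R).
Variables n m : nat.
Variables (H0 : 'M[C]_n) (Hs : 'I_m -> 'M[C]_n).
Hypothesis hH0 : is_hermitian H0.
Hypothesis hHs : forall k, is_hermitian (Hs k).
Local Notation H := (Hu H0 Hs).
Variable U : set 'rV[R]_m.

Lemma reachable_refl q (X0 : 'M[C]_(n, q)) : U !=set0 -> reachable U H X0 X0.
Proof.
move=> [v Uv]; exists 0, (fun=> v), (fun=> X0); split => //.
  split=> //; split=> [k|]; first exact: measurable_cst.
  exists (n1 v) => k; apply: aeW => t _; exact: n1_entry.
have base (a b : R) : primitive_of 0 (fun=> a) (fun=> b).
  split.
    apply: continuous_compact_integrable; first exact: segment_compact.
    by apply: continuous_subspaceT => x; exact: cvg_cst.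
  move=> t; rewrite /I0 /= in_itv /= => t0; have -> : t = 0 by apply/le_anti; rewrite andbC.
  by rewrite set_itv1 integral_set1 adde0.
move=> a b; have [i1 h1] := base (complex.Re (X0 a b)) (complex.Re ((- iC R *: (H v *m X0)) a b)).
have [i2 h2] := base (complex.Im (X0 a b)) (complex.Im ((- iC R *: (H v *m X0)) a b)).
by split=> //; split=> // t It; split; [exact: h1|exact: h2].
Qed.

Lemma reachable_flow q (X0 Y : 'M[C]_(n, q)) v tau : U v -> 0 <= tau ->
  reachable U H X0 Y -> reachable U H X0 (flow (H v) tau *m Y).
Proof.
move=> Uv; rewrite le_eqVlt => /orP [/eqP <-|tau0].
  by rewrite flow0 ?mul1mx //; exact: Hu_hermitian.
move=> [T [u [X [T0 [adU [adm adb]] X00 sol <-]]]].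
have hv : is_hermitian (H v) by exact: Hu_hermitian.
pose u' t := if t <= T then u t else v.
pose X' t := if t <= T then X t else flow (H v) (t - T) *m X T.
have TT' : T < T + tau by rewrite ltrDl.
have split_itv : I0 (T + tau) = I0 T `|` `]T, T + tau]%classic.
  by apply: itv_bndbnd_setU; rewrite bnd_simp // ltW.
have IL t : I0 (T + tau) t -> t <= T -> I0 T t.
  by rewrite /I0 /= !in_itv /= => /andP [-> _] ->.
exists (T + tau), u', X'; split.
- by rewrite addr_ge0 // ltW.
- split=> [t It|]; first by rewrite /u'; case: leP => // tT; exact: adU (IL _ It tT).
  split=> [k|].
    rewrite split_itv; apply/measurable_funU; [exact: measurable_itv|exact: measurable_itv|split].
      apply: (eq_measurable_fun (fun t => u t 0 k)) => // t /set_mem.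
      by rewrite /I0 /= in_itv /= /u' => /andP [_ ->].
    apply: (eq_measurable_fun (fun t => v 0 k)) => // t /set_mem.
    by rewrite /= in_itv /= /u' => /andP [a _]; rewrite leNgt a.
  have [M hM] := adb; exists (Num.max M (n1 v)) => k.
  have Fae : Filter (nbhs (almost_everywhere (@lebesgue_measure R))) by exact: ae_filter_ringOfSetsType.
  apply: filterS (hM k) => t h It; rewrite /u' le_max; case: ifP => tT.
    by rewrite (h (IL _ It tT)).
  by rewrite n1_entry orbT.
- by rewrite /X' T0.
- have dR a b := (flow_entry_derive 1%:M (X T) T a b hv).
  have dR2 a b := (flow_entry_derive (1%:M *m (- iC R *: H v)) (X T) T a b hv).
  have cont (g dg : R -> R) : (forall t : R, is_derive t (1 : R) g (dg t)) -> continuous g.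
    by move=> hd t; apply: differentiable_continuous; apply/derivable1_diffP; have := hd t; case.
  have X'E (p : C -> R) a b : (fun t => p (X' t a b)) =
      (fun t => if t <= T then p (X t a b) else p ((1%:M *m flow (H v) (t - T) *m X T) a b)).
    by apply/funext => t; rewrite /X'; case: ifP; rewrite ?mul1mx.
  have F'E (p : C -> R) a b : (fun s => p (((- iC R) *: (H (u' s) *m X' s)) a b)) =
      (fun s => if s <= T then p (((- iC R) *: (H (u s) *m X s)) a b)
        else p ((1%:M *m (- iC R *: H v) *m flow (H v) (s - T) *m X T) a b)).
    apply/funext => s; rewrite /X' /u'; case: ifP => // _.
    by rewrite mul1mx -!scalemxAl mulmxA.
  have yT (p : C -> R) a b : p ((1%:M *m flow (H v) (T - T) *m X T) a b) = p (X T a b).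
    by rewrite subrr flow0 // !mul1mx.
  move=> a b.
  have glue (p : C -> R) : primitive_of T (fun t => p (X t a b)) (fun s => p (((- iC R) *: (H (u s) *m X s)) a b)) ->
      (forall t : R, is_derive t (1 : R) (fun t : R => p ((1%:M *m flow (H v) (t - T) *m X T) a b))
        (p ((1%:M *m (- iC R *: H v) *m flow (H v) (t - T) *m X T) a b))) ->
      continuous (fun t : R => p ((1%:M *m (- iC R *: H v) *m flow (H v) (t - T) *m X T) a b)) ->
      primitive_of (T + tau) (fun t => p (X' t a b)) (fun s => p (((- iC R) *: (H (u' s) *m X' s)) a b)).
    by move=> h1 h2 h3; rewrite (X'E p a b) (F'E p a b); exact: glue_primitive T0 TT' h1 h2 h3 (yT p a b).
  have := glue (@complex.Re R) (Re_primitive sol a b) (proj1 (dR a b)) (cont _ _ (proj1 (dR2 a b))).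
  have := glue (@complex.Im R) (Im_primitive sol a b) (proj2 (dR a b)) (cont _ _ (proj2 (dR2 a b))).
  move=> [i2 h2] [i1 h1]; split; first exact: i1.
  split; first exact: i2.
  by move=> t It; split; [exact: h1|exact: h2].
- by rewrite /X' leNgt TT' /= addrC addKr.
Qed.

(** The head of the list is the control applied last in time. *)
Fixpoint ev (w : seq (R * 'rV[R]_m)) : 'M[C]_n :=
  if w is p :: w' then flow (H p.2) p.1 *m ev w' else 1%:M.

Definition word (w : seq (R * 'rV[R]_m)) := forall p, p \in w -> 0 <= p.1 /\ U p.2.

Lemma word_cons p w : word (p :: w) <-> (0 <= p.1 /\ U p.2) /\ word w.
Proof.
split=> [h|[hp hw] x]; last by rewrite inE => /orP [/eqP ->|/hw].
by split=> [|x xw]; apply: h; rewrite inE ?eqxx // xw orbT.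
Qed.

Lemma word_cat w1 w2 : word w1 -> word w2 -> word (w1 ++ w2).
Proof. by move=> h1 h2 p; rewrite mem_cat => /orP [/h1|/h2]. Qed.

Lemma ev_cat w1 w2 : ev (w1 ++ w2) = ev w1 *m ev w2.
Proof. by elim: w1 => [|p w IH] /=; rewrite ?mul1mx // IH mulmxA. Qed.

Lemma ev_unitary w : adj (ev w) *m ev w = 1%:M.
Proof.
elim: w => [|p w IH] /=; first by rewrite adj1 mul1mx.
by rewrite adjM -mulmxA [adj (flow _ _) *m _]mulmxA flow_unitary ?mul1mx //; exact: Hu_hermitian.
Qed.

Lemma word_reachable q (X0 : 'M[C]_(n, q)) w : U !=set0 -> word w -> reachable U H X0 (ev w *m X0).
Proof.
move=> U0; elim: w => [|p w IH] /=; first by move=> _; rewrite mul1mx; exact: reachable_refl.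
move=> /word_cons [[p1 p2] hw]; rewrite -mulmxA; apply: reachable_flow => //; exact: IH.
Qed.
End Words.

(** * Products of flows and their velocities *)

Section Identities.
Variable R : realType.
Local Notation C := (complex R).
Variable n : nat.

Lemma mnM_le p q r (A : 'M[C]_(p, q)) (B : 'M[C]_(q, r)) a b : mn A <= a -> mn B <= b -> mn (A *m B) <= a * b.
Proof. by move=> hA hB; apply: (le_trans (mnM _ _)); apply: ler_pM; rewrite ?mn_ge0. Qed.

Lemma flow_increment_id (D F T K : 'M[C]_n) (z : C) :
  D *m (F *m T) - F *m T - z *: (K *m T) =
  (D - 1%:M - z *: K) *m (F *m T) + z *: (K *m (F - 1%:M) *m T).
Proof.
rewrite !mulmxBl mul1mx mulmxBr mulmxBl mulmx1 -!scalemxAl !mulmxA scalerBr.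
move: (D *m F *m T) (F *m T) (z *: (K *m T)) (z *: (K *m F *m T)) => a1 a2 a3 a4.
by mxadd.
Qed.

Lemma word_lip_id (D E S Q : 'M[C]_n) :
  D *m E *m S - E *m Q = (D - 1%:M) *m E *m S + E *m (S - Q).
Proof.
rewrite !mulmxBl mul1mx mulmxBr; move: (D *m E *m S) (E *m S) (E *m Q) => a1 a2 a3.
by mxadd.
Qed.

Lemma word_increment_id (F' F G P' P L Q K : 'M[C]_n) (z : C) : adj G *m G = 1%:M ->
  F' *m P' - F *m P - (z *: K + G *m L *m adj G) *m (G *m Q) =
  F' *m (P' - P - L *m Q) + (F' - G) *m L *m Q + (F' - F - z *: (K *m G)) *m P + z *: (K *m G *m (P - Q)).
Proof.
move=> GG; have E : G *m L *m adj G *m (G *m Q) = G *m L *m Q.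
  by rewrite -mulmxA (mulmxA (adj G)) GG mul1mx.
rewrite mulmxDl E !mulmxBl !mulmxBr -!scalemxAl !mulmxA scalerBr.
move: (F' *m P') (F *m P) (z *: (K *m G *m Q)) (G *m L *m Q) (F' *m P) (F' *m L *m Q) (z *: (K *m G *m P)) => a1 a2 a3 a4 a5 a6 a7.
by mxadd.
Qed.
End Identities.

Section FlowStrict.
Variable R : realType.
Local Notation C := (complex R).
Variable n : nat.
Implicit Types A : 'M[C]_n.

Lemma cn_cis1 (x : R) : cn (cis x - 1) <= 2 * `|x|.
Proof.
rewrite /cn /cis /= subr0 mulr_natl mulr2n; apply: lerD; last exact: abs_sin_le.
have [x2|x2] := leP `|x| 2.
  apply: (le_trans (cos_quadratic x)); rewrite -(real_normK (num_real x)) expr2.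
  have := normr_ge0 x; move: `|x| x2 => y y2 y0; clear -y0 y2; nra.
by apply: (le_trans (ler_normB _ _)); rewrite normr1; have := cos_max x; lra.
Qed.

Lemma flow_lip A : is_hermitian A -> exists2 c : R, 0 <= c & forall t, mn (flow A t - 1%:M) <= c * `|t|.
Proof.
move=> hA; have [W1 _] := eigbasisP hA.
exists ((2 * n * n)%:R ^+ 2 * (2 * \sum_(k < n) `|lam A k|)).
  by rewrite !mulr_ge0 ?sqr_ge0 // sumr_ge0.
move=> t; have -> : flow A t - 1%:M = conj_diag (eigbasis A) (fun k => cis (- t * lam A k) + -1 * 1).
  rewrite (conj_diagD _ (fun k => cis (- t * lam A k)) (fun _ => -1 * 1)) (conj_diagZ _ (-1) (fun _ => 1)).
  by rewrite conj_diag1 // scaleN1r.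
apply: (le_trans (mn_conj_diag _ W1)); rewrite -[X in _ <= X]mulrA; apply: ler_wpM2l; first exact: sqr_ge0.
rewrite -mulrA mulr_suml mulr_sumr; apply: ler_sum => k _.
by rewrite mulN1r; apply: (le_trans (cn_cis1 _)); rewrite normrM normrN mulrC [`|t| * _]mulrC mulrC.
Qed.

Lemma mn_unitary (E : 'M[C]_n) : adj E *m E = 1%:M -> mn E <= (2 * n * n)%:R.
Proof. exact: mn_isometry. Qed.

(** Strict differentiability at [tau]: the bound compares two nearby times, because the Newton step
    corrects durations that are already shifted. *)
Lemma flow_strict A tau : is_hermitian A -> exists2 c : R, 0 <= c & forall t t',
  mn (flow A (tau + t') - flow A (tau + t) - cR (t' - t) *: ((- iC R *: A) *m flow A tau)) <=
    c * (`|t| + `|t'|) * `|t' - t|.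
Proof.
move=> hA; have [c c0 hc] := flow_quadratic hA; have [c' c0' hc'] := flow_lip hA.
pose b : R := (2 * n * n)%:R; have b0 : 0 <= b by rewrite ler0n.
exists (c * b + mn (- iC R *: A) * c' * b); first by rewrite addr_ge0 // !mulr_ge0 // mn_ge0.
move=> t t'.
have EE : flow A (tau + t) = flow A t *m flow A tau by rewrite addrC (flowD _ _ hA).
have EE' : flow A (tau + t') = flow A (t' - t) *m (flow A t *m flow A tau).
  have e : tau + t' = (t' - t) + (tau + t) by ring.
  by rewrite -EE e (flowD _ _ hA).
rewrite EE' EE flow_increment_id -EE.
set E := flow A (tau + t); set K := - iC R *: A; set d := t' - t.
have dle : `|d| <= `|t| + `|t'| by rewrite addrC; exact: ler_normB.
have mE : mn E <= b by apply: mn_unitary; exact: flow_unitary.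
have mF : mn (flow A tau) <= b by apply: mn_unitary; exact: flow_unitary.
have t1 : mn ((flow A d - 1%:M - cR d *: K) *m E) <= c * d ^+ 2 * b by exact: mnM_le (hc d) mE.
have t2 : mn (cR d *: (K *m (flow A t - 1%:M) *m flow A tau)) <= `|d| * (mn K * (c' * `|t|) * b).
  by rewrite mn_cR; apply: ler_wpM2l => //; exact: mnM_le (mnM_le (lexx _) (hc' t)) mF.
apply: (le_trans (mnD _ _)); apply: (le_trans (lerD t1 t2)).
have d0 := normr_ge0 d; have x0 := normr_ge0 t; have x0' := normr_ge0 t'.
have k0 : 0 <= mn K by exact: mn_ge0.
move: dle; rewrite -(real_normK (num_real d)); clear -c0 b0 c0' d0 x0 x0' k0.
move: (mn K) `|d| `|t| `|t'| k0 d0 x0 x0' => k D x x' k0 D0 x0 x0' dle.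
have h1 : c * b * (D * D) <= c * b * ((x + x') * D).
  by apply: ler_wpM2l; [rewrite mulr_ge0|apply: ler_wpM2r].
have h2 : k * c' * b * (x * D) <= k * c' * b * ((x + x') * D).
  by apply: ler_wpM2l; [rewrite !mulr_ge0|apply: ler_wpM2r => //; rewrite lerDl].
have -> : c * D ^+ 2 * b + D * (k * (c' * x) * b) = c * b * (D * D) + k * c' * b * (x * D) by ring.
have -> : (c * b + k * c' * b) * (x + x') * D = c * b * ((x + x') * D) + k * c' * b * ((x + x') * D) by ring.
exact: lerD.
Qed.
End FlowStrict.

Section PerturbedWords.
Variable R : realType.
Local Notation C := (complex R).
Variables n m : nat.
Variables (H0 : 'M[C]_n) (Hs : 'I_m -> 'M[C]_n).
Hypothesis hH0 : is_hermitian H0.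
Hypothesis hHs : forall k, is_hermitian (Hs k).
Local Notation H := (Hu H0 Hs).
Implicit Types (w : seq (R * 'rV[R]_m)) (s : nat -> R).

Definition Ad (E X : 'M[C]_n) : 'M[C]_n := E *m X *m adj E.

(** The shifts are indexed by all of nat, so that the recursion merely drops the first one. *)
Fixpoint evs w s : 'M[C]_n :=
  if w is p :: w' then flow (H p.2) (p.1 + s 0%N) *m evs w' (fun k => s k.+1) else 1%:M.

(** Velocities translated back to the identity: at s = 0 the derivative of [evs w s] in the k-th
    duration is the k-th entry times [ev w]. *)
Fixpoint dirs w : seq 'M[C]_n :=
  if w is p :: w' then (- iC R *: H p.2) :: [seq Ad (flow (H p.2) p.1) X | X <- dirs w'] else [::].

Definition dlin w s : 'M[C]_n := \sum_(k < size w) cR (s k) *: (dirs w)`_k.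
Definition nrm N s : R := \sum_(k < N) `|s k|.

Lemma size_dirs w : size (dirs w) = size w.
Proof. by elim: w => //= p w IH; rewrite size_map IH. Qed.

Lemma nrm_ge0 N s : 0 <= nrm N s.
Proof. exact: sumr_ge0. Qed.

Lemma nrmS N s : nrm N.+1 s = `|s 0%N| + nrm N (fun k => s k.+1).
Proof. by rewrite /nrm big_ord_recl. Qed.

Lemma dlinS p w s : dlin (p :: w) s = cR (s 0%N) *: (- iC R *: H p.2) + Ad (flow (H p.2) p.1) (dlin w (fun k => s k.+1)).
Proof.
rewrite /dlin big_ord_recl /=; congr (_ + _).
rewrite /Ad mulmx_sumr mulmx_suml; apply: eq_bigr => k _.
rewrite -scalemxAr -scalemxAl; congr (_ *: _).
have kw : (k < size (dirs w))%N by rewrite size_dirs; exact: ltn_ord.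
by rewrite (nth_map 0 _ _ kw).
Qed.

Lemma dlin_bound w : exists2 c : R, 0 <= c & forall s, mn (dlin w s) <= c * nrm (size w) s.
Proof.
exists (\sum_(k < size w) mn (dirs w)`_k); first by apply: sumr_ge0 => k _; exact: mn_ge0.
move=> s; apply: (le_trans (mn_sum _ _ _)); rewrite mulr_sumr; apply: ler_sum => k _.
rewrite mn_cR mulrC; apply: ler_wpM2r => //.
by rewrite (bigD1 k) //= lerDl; apply: sumr_ge0 => i _; exact: mn_ge0.
Qed.

Lemma evs0 w : evs w (fun=> 0) = ev H0 Hs w.
Proof. by elim: w => //= p w ->; rewrite addr0. Qed.

Lemma evs_unitary w s : adj (evs w s) *m evs w s = 1%:M.
Proof.
elim: w s => [|p w IH] s /=; first by rewrite adj1 mul1mx.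
by rewrite adjM -mulmxA [adj (flow _ _) *m _]mulmxA flow_unitary ?mul1mx //; exact: Hu_hermitian.
Qed.

Lemma mn_evs w s : mn (evs w s) <= (2 * n * n)%:R.
Proof. exact/mn_unitary/evs_unitary. Qed.

Lemma evs_lipschitz w : exists2 c : R, 0 <= c & forall s s',
  mn (evs w s' - evs w s) <= c * nrm (size w) (fun k => s' k - s k).
Proof.
elim: w => [|p w [c c0 IH]].
  by exists 0 => // s s'; rewrite /= subrr mn0 mul0r.
have hA : is_hermitian (H p.2) by exact: Hu_hermitian.
have [d d0 hd] := flow_lip hA.
pose b : R := (2 * n * n)%:R; have b0 : 0 <= b by rewrite ler0n.
exists (d * b * b + b * c); first by rewrite addr_ge0 // !mulr_ge0.
move=> s s'; rewrite /= nrmS.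
have -> : flow (H p.2) (p.1 + s' 0%N) = flow (H p.2) (s' 0%N - s 0%N) *m flow (H p.2) (p.1 + s 0%N).
  have e : p.1 + s' 0%N = (s' 0%N - s 0%N) + (p.1 + s 0%N) by ring.
  by rewrite e (flowD _ _ hA).
have := IH (fun k => s k.+1) (fun k => s' k.+1).
have := hd (s' 0%N - s 0%N).
have : mn (flow (H p.2) (p.1 + s 0%N)) <= b by apply: mn_unitary; exact: flow_unitary.
have : mn (evs w (fun k => s' k.+1)) <= b by exact: mn_evs.
have := nrm_ge0 (size w) (fun k => s' k.+1 - s k.+1).
have := normr_ge0 (s' 0%N - s 0%N).
rewrite word_lip_id.
move: (flow _ (_ + _)) (flow _ _ - 1%:M) (evs w _) (evs w _ - evs w _) (nrm _ _) `|_| => E D S Z y x.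
clearbody b; clear -b0 d0 c0 => x0 y0 mS mE mD mZ.
have t1 := mnM_le (mnM_le mD mE) mS; have t2 := mnM_le mE mZ.
apply: (le_trans (mnD _ _)); apply: (le_trans (lerD t1 t2)).
have h1 : 0 <= d * b * b * y by rewrite !mulr_ge0.
have h2 : 0 <= b * c * x by rewrite !mulr_ge0.
have -> : (d * b * b + b * c) * (x + y) = d * x * b * b + b * (c * y) + (d * b * b * y + b * c * x) by ring.
by rewrite lerDl addr_ge0.
Qed.

Lemma evs_lip w : exists2 c : R, 0 <= c & forall s, mn (evs w s - ev H0 Hs w) <= c * nrm (size w) s.
Proof.
have [c c0 h] := evs_lipschitz w; exists c => // s; rewrite -evs0; apply: (le_trans (h (fun=> 0) s)).
by apply: ler_wpM2l => //; apply: ler_sum => k _; rewrite subr0.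
Qed.

Lemma evs_strict w : exists2 c : R, 0 <= c & forall s s',
  mn (evs w s' - evs w s - dlin w (fun k => s' k - s k) *m ev H0 Hs w) <=
    c * (nrm (size w) s + nrm (size w) s') * nrm (size w) (fun k => s' k - s k).
Proof.
elim: w => [|p w [c c0 IH]].
  by exists 0 => // s s'; rewrite /= /dlin big_ord0 mul0mx subrr subr0 mn0 !mul0r.
have hA : is_hermitian (H p.2) by exact: Hu_hermitian.
have [d d0 hd] := flow_lip hA; have [e e0 he] := flow_strict p.1 hA.
have [k k0 hk] := dlin_bound w; have [l l0 hl] := evs_lip w.
pose b : R := (2 * n * n)%:R; have b0 : 0 <= b by rewrite ler0n.
pose a := mn (- iC R *: H p.2); have a0 : 0 <= a by exact: mn_ge0.
exists (b * c + d * b * k * b + e * b + a * b * l); first by rewrite !addr_ge0 // !mulr_ge0.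
move=> s s'; rewrite dlinS /= !nrmS.
set sig := fun k => s k.+1; set sig' := fun k => s' k.+1.
have := IH sig sig'; have := hk (fun k => sig' k - sig k); have := hl sig.
have := he (s 0%N) (s' 0%N); have := hd (s' 0%N).
rewrite -/sig -/sig'.
set G := flow (H p.2) p.1; set F := flow (H p.2) (p.1 + s 0%N); set F' := flow (H p.2) (p.1 + s' 0%N).
have F'E : F' = flow (H p.2) (s' 0%N) *m G by rewrite /F' addrC flowD.
set P := evs w sig; set P' := evs w sig'; set L := dlin w _; set Q := ev H0 Hs w.
move=> h1 h2 h3 h4 h5.
have mG : mn G <= b by apply: mn_unitary; exact: flow_unitary.
have mF' : mn F' <= b by apply: mn_unitary; exact: flow_unitary.
have mP : mn P <= b by exact: mn_evs.
have mQ : mn Q <= b by rewrite /Q -evs0; exact: mn_evs.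
have GG : adj G *m G = 1%:M by exact: flow_unitary.
have F'G : F' - G = (flow (H p.2) (s' 0%N) - 1%:M) *m G by rewrite mulmxBl -F'E mul1mx.
rewrite (word_increment_id _ _ _ _ _ _ _ _ GG) F'G.
have x0 := normr_ge0 (s 0%N); have x0' := normr_ge0 (s' 0%N); have dx0 := normr_ge0 (s' 0%N - s 0%N).
have y0 := nrm_ge0 (size w) sig; have y0' := nrm_ge0 (size w) sig'.
have dy0 := nrm_ge0 (size w) (fun k => sig' k - sig k).
have -> : nrm (size w) (fun k => s' k.+1 - s k.+1) = nrm (size w) (fun k => sig' k - sig k) by [].
have t1 : mn (F' *m (P' - P - L *m Q)) <= b * (c * (nrm (size w) sig + nrm (size w) sig') * nrm (size w) (fun k => sig' k - sig k)).
  exact: mnM_le mF' h5.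
have t2 : mn ((flow (H p.2) (s' 0%N) - 1%:M) *m G *m L *m Q) <= d * `|s' 0%N| * b * (k * nrm (size w) (fun k => sig' k - sig k)) * b.
  exact: mnM_le (mnM_le (mnM_le h1 mG) h4) mQ.
have t3 : mn ((F' - F - cR (s' 0%N - s 0%N) *: ((- iC R *: H p.2) *m G)) *m P) <= e * (`|s 0%N| + `|s' 0%N|) * `|s' 0%N - s 0%N| * b.
  exact: mnM_le h2 mP.
have t4 : mn (cR (s' 0%N - s 0%N) *: ((- iC R *: H p.2) *m G *m (P - Q))) <= `|s' 0%N - s 0%N| * (a * b * (l * nrm (size w) sig)).
  rewrite mn_cR; apply: ler_wpM2l; first exact: dx0.
  exact: mnM_le (mnM_le (lexx a) mG) h3.
have := le_trans (mnD _ _) (lerD (le_trans (mnD _ _) (lerD (le_trans (mnD _ _) (lerD t1 t2)) t3)) t4).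
move=> h; apply: (le_trans h); clear -b0 c0 d0 e0 k0 l0 a0 x0 x0' dx0 y0 y0' dy0.
move: y0 y0' dy0 x0 x0' dx0.
move: (nrm (size w) sig) (nrm (size w) sig') (nrm (size w) (fun k => sig' k - sig k)) `|s 0%N| `|s' 0%N| `|s' 0%N - s 0%N|.
move=> y y' dy x x' dx y0 y0' dy0 x0 x0' dx0; clearbody b a; clear -b0 c0 d0 e0 k0 l0 a0 y0 y0' dy0 x0 x0' dx0.
have yy : y + y' <= x + y + (x' + y') by rewrite addrACA lerDr addr_ge0.
have xx : x + x' <= x + y + (x' + y') by rewrite addrACA lerDl addr_ge0.
have x1 : x' <= x + y + (x' + y') by rewrite addrCA lerDl !addr_ge0.
have y1 : y <= x + y + (x' + y') by rewrite [x + y]addrC -addrA lerDl !addr_ge0.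
have dy1 : dy <= dx + dy by rewrite lerDr.
have dx1 : dx <= dx + dy by rewrite lerDl.
have z1 : (y + y') * dy <= (x + y + (x' + y')) * (dx + dy) by apply: ler_pM; rewrite ?addr_ge0.
have z2 : x' * dy <= (x + y + (x' + y')) * (dx + dy) by apply: ler_pM.
have z3 : (x + x') * dx <= (x + y + (x' + y')) * (dx + dy) by apply: ler_pM; rewrite ?addr_ge0.
have z4 : y * dx <= (x + y + (x' + y')) * (dx + dy) by apply: ler_pM.
have bc : 0 <= b * c by rewrite mulr_ge0.
have dk : 0 <= d * b * k * b by rewrite !mulr_ge0.
have eb : 0 <= e * b by rewrite mulr_ge0.
have ab : 0 <= a * b * l by rewrite !mulr_ge0.
have := lerD (lerD (lerD (ler_wpM2l bc z1) (ler_wpM2l dk z2)) (ler_wpM2l eb z3)) (ler_wpM2l ab z4).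
move=> h.
have -> : b * (c * (y + y') * dy) + d * x' * b * (k * dy) * b + e * (x + x') * dx * b + dx * (a * b * (l * y)) =
  b * c * ((y + y') * dy) + d * b * k * b * (x' * dy) + e * b * ((x + x') * dx) + a * b * l * (y * dx) by ring.
rewrite -!mulrDl in h.
have -> : (b * c + d * b * k * b + e * b + a * b * l) * (x + y + (x' + y')) * (dx + dy) =
  (b * c + d * b * k * b + e * b + a * b * l) * ((x + y + (x' + y')) * (dx + dy)) by ring.
exact: h.
Qed.
End PerturbedWords.

Section Conjugation.
Variable R : realType.
Local Notation C := (complex R).
Variable n : nat.
Implicit Types E X Y : 'M[C]_n.

Lemma AdM E F X : Ad E (Ad F X) = Ad (E *m F) X.
Proof. by rewrite /Ad adjM !mulmxA. Qed.
Lemma Ad1 X : Ad 1%:M X = X.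
Proof. by rewrite /Ad adj1 mul1mx mulmx1. Qed.
Lemma AdD E X Y : Ad E (X + Y) = Ad E X + Ad E Y.
Proof. by rewrite /Ad mulmxDr mulmxDl. Qed.
Lemma AdZ E z X : Ad E (z *: X) = z *: Ad E X.
Proof. by rewrite /Ad -scalemxAr -scalemxAl. Qed.
Lemma Ad0 E : Ad E 0 = 0.
Proof. by rewrite /Ad mulmx0 mul0mx. Qed.
Lemma AdB E X Y : Ad E (X - Y) = Ad E X - Ad E Y.
Proof. by rewrite /Ad mulmxBr mulmxBl. Qed.

Lemma Ad_u_alg E X : u_alg X -> u_alg (Ad E X).
Proof. by rewrite /u_alg /= => hX; rewrite /Ad !adjM adjK hX mulNmx mulmxN mulmxA. Qed.
Lemma Ad_su_alg E X : adj E *m E = 1%:M -> su_alg X -> su_alg (Ad E X).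
Proof.
move=> E1 [hX tX]; split; first exact: Ad_u_alg.
by rewrite /Ad mxtrace_mulC mulmxA E1 mul1mx.
Qed.
End Conjugation.

(** * Real spans of matrices *)

Section Span.
Variable R : realType.
Local Notation C := (complex R).
Variables n N : nat.
Variable B : 'I_N -> 'M[C]_n.
Implicit Types X Y : 'M[C]_n.

Definition in_span X : Prop := (realify X <= realbasis B)%MS.

Lemma realifyD X Y : realify (X + Y) = realify X + realify Y.
Proof.
by rewrite /realify linearD !map_mxD -add_row_mx.
Qed.
Lemma realifyZ (r : R) X : realify (cR r *: X) = r *: realify X.
Proof.
rewrite /realify linearZ /= scale_row_mx; congr row_mx; apply/rowP => k; rewrite !mxE.
  by case: (mxvec X 0 k) => a b /=; rewrite mul0r subr0.
by case: (mxvec X 0 k) => a b /=; rewrite mul0r addr0.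
Qed.

Lemma in_spanD X Y : in_span X -> in_span Y -> in_span (X + Y).
Proof. by rewrite /in_span realifyD; exact: addmx_sub. Qed.
Lemma in_spanZ (r : R) X : in_span X -> in_span (cR r *: X).
Proof. by rewrite /in_span realifyZ; exact: scalemx_sub. Qed.
Lemma in_spanB X Y : in_span X -> in_span Y -> in_span (X - Y).
Proof. by move=> hX hY; apply: in_spanD => //; rewrite -scaleN1r -(cR1 R) -cRN; exact: in_spanZ. Qed.
Lemma in_span_basis i : in_span (B i).
Proof. by rewrite /in_span; have <- : row i (realbasis B) = realify (B i) by [apply: rowK]; exact: row_sub. Qed.

Lemma in_span0 : in_span 0.
Proof. by rewrite /in_span -(scale0r 0) -cR0 realifyZ scale0r sub0mx. Qed.

(* A real subspace is closed, so it contains the velocity of any curve in it. *)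
Lemma in_span_velocity X c : 0 <= c ->
  (forall t : R, 0 < t -> exists2 Y, in_span Y & mn (Y - cR t *: X) <= c * t ^+ 2) -> in_span X.
Proof.
move=> c0 h; rewrite /in_span submxE; apply/eqP/n1_eq0/eqP.
set K := cokermx _; pose k := \sum_i \sum_j `|K i j|.
have k0 : 0 <= k by apply: sumr_ge0 => i _; exact: sumr_ge0.
rewrite eq_le n1_ge0 andbT leNgt; apply/negP => e0; set e := n1 _ in e0.
pose t := e / (c * k + 1); have ck : 0 < c * k + 1 by rewrite ltr_wpDl // mulr_ge0.
have t0 : 0 < t by rewrite divr_gt0.
have [Y hY Yt] := h t t0.
have E : t *: (realify X *m K) = - (realify (Y - cR t *: X) *m K).
  have YK : realify Y *m K = 0 by apply/eqP; rewrite -submxE.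
  have -> : Y - cR t *: X = Y + cR (- t) *: X by rewrite cRN scaleNr.
  by rewrite realifyD realifyZ mulmxDl YK add0r -scalemxAl scaleNr opprK.
have := n1_mulmx (Y - cR t *: X) K; rewrite -n1N -E n1Z (gtr0_norm t0) -/k -/e => h1.
have h2 : t * e <= c * t ^+ 2 * k by apply: (le_trans h1); apply: ler_wpM2r.
have h3 : e <= c * k * t.
  by rewrite -(ler_pM2l t0); apply: (le_trans h2); rewrite le_eqVlt; apply/orP; left; apply/eqP; ring.
have : (c * k + 1) * t <= c * k * t by rewrite [X in X <= _]mulrC /t divfK ?gt_eqF.
by rewrite mulrDl mul1r; move: (c * k * t) => z; move: t0; lra.
Qed.
End Span.

(** * A product of flows whose velocities span the Lie algebra *)

Section Rank.
Variable R : realType.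
Local Notation C := (complex R).
Variables n m : nat.
Variables (H0 : 'M[C]_n) (Hs : 'I_m -> 'M[C]_n).
Hypothesis hH0 : is_hermitian H0.
Hypothesis hHs : forall k, is_hermitian (Hs k).
Local Notation H := (Hu H0 Hs).
Variable U : set 'rV[R]_m.
Implicit Types (w : seq (R * 'rV[R]_m)).
Local Notation ev := (ev H0 Hs).
Local Notation dirs := (dirs H0 Hs).

(** Durations are strictly positive so that they can be perturbed in both directions. *)
Definition pword w := forall p, p \in w -> 0 < p.1 /\ U p.2.
Definition wordbasis w (i : 'I_(size w)) : 'M[C]_n := (dirs w)`_i.
Arguments wordbasis : clear implicits.

Lemma pword_cat w1 w2 : pword w1 -> pword w2 -> pword (w1 ++ w2).
Proof. by move=> h1 h2 p; rewrite mem_cat => /orP [/h1|/h2]. Qed.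
Lemma pword1 t u : 0 < t -> U u -> pword [:: (t, u)].
Proof. by move=> t0 Uu p; rewrite inE => /eqP ->. Qed.

Lemma dirs_cat w1 w2 : dirs (w1 ++ w2) = dirs w1 ++ [seq Ad (ev w1) X | X <- dirs w2].
Proof.
elim: w1 => [|p w IH] /=; first by rewrite map_id_in // => X _; rewrite Ad1.
rewrite IH map_cat -map_comp; congr (_ :: _ ++ _).
by apply: eq_map => X /=; rewrite AdM.
Qed.

Lemma in_span_dirs w X : X \in dirs w -> in_span (wordbasis w) X.
Proof.
move=> Xw; have [i iw <-] := elimT (nthP (0 : 'M[C]_n)) Xw; rewrite size_dirs in iw.
exact: (in_span_basis (wordbasis w) (Ordinal iw)).
Qed.

Lemma max_rank_word : exists2 w, pword w & forall w', pword w' ->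
  (\rank (realbasis (wordbasis w')) <= \rank (realbasis (wordbasis w)))%N.
Proof.
pose P r := `[< exists2 w, pword w & \rank (realbasis (wordbasis w)) = r >].
have exP : exists r, P r.
  by exists (\rank (realbasis (wordbasis [::]))); apply/asboolP; exists [::].
have bound r : P r -> (r <= n * n + n * n)%N by move=> /asboolP [w _ <-]; exact: rank_leq_col.
case: (ex_maxnP exP bound) => r /asboolP [w hw <-] hmax; exists w => // w' hw'.
by apply: hmax; apply/asboolP; exists w'.
Qed.

(** Appending [w'] to [w] adds the velocities of [w'] conjugated by [ev w]; by maximality these
    cannot enlarge the span. *)
Lemma max_rank_dirs w : pword w ->
  (forall w', pword w' -> (\rank (realbasis (wordbasis w')) <= \rank (realbasis (wordbasis w)))%N) ->
  forall w' X, pword w' -> X \in dirs w' -> in_span (wordbasis w) (Ad (ev w) X).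
Proof.
move=> hw hmax w' X hw' Xw'.
have sub : (realbasis (wordbasis w) <= realbasis (wordbasis (w ++ w')))%MS.
  apply/row_subP => i; rewrite rowK; apply: in_span_dirs; rewrite dirs_cat mem_cat.
  by rewrite mem_nth // size_dirs.
have := (mxrank_leqif_sup sub).2; rewrite eqn_leq (mxrankS sub) hmax; last exact: pword_cat.
move=> /esym back; apply: submx_trans back; apply: in_span_dirs.
by rewrite dirs_cat mem_cat map_f ?orbT.
Qed.

Lemma flow_Ad_quadratic A (X : 'M[C]_n) : is_hermitian A -> exists2 c : R, 0 <= c & forall t : R, 0 <= t ->
  mn (Ad (flow A t) X - X - cR t *: ((- iC R *: A) *m X - X *m (- iC R *: A))) <= c * t ^+ 2.
Proof.
move=> hA; have [c c0 hc] := flow_quadratic hA; have [d d0 hd] := flow_lip hA.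
set K := - iC R *: A in hc *; have KE : adj K = - K.
  rewrite /K adjZ hA; rewrite conj_NiC.
  by rewrite scaleNr opprK.
pose b : R := (2 * n * n)%:R; have b0 : 0 <= b by rewrite ler0n.
have x0 := mn_ge0 X; have k0 := mn_ge0 K.
exists (c * mn X * b + mn K * mn X * d + mn X * c); first by rewrite !addr_ge0 // !mulr_ge0.
move=> t t0; have h3 := hc t; have h2 := hd t.
have h1 : mn (adj (flow A t) - 1%:M + cR t *: K) <= c * t ^+ 2.
  apply: le_trans h3; rewrite -(mn_adj (flow A t - _ - _)) !adjB adj1 adjZ conj_cR KE scalerN opprK.
  exact: lexx.
have mF : mn (adj (flow A t)) <= b by rewrite mn_adj; apply: mn_unitary; exact: flow_unitary.
have h2' : mn (adj (flow A t) - 1%:M) <= d * `|t|.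
  by rewrite -(adj1 R n) -adjB mn_adj.
have tn := ger0_norm t0; clearbody K; rewrite /Ad; move: mF h1 h2' {h2 hd hc}; move: (adj (flow A t)) => F'; move: h3; move: (flow A t) => F h3 mF h1 h2'.
have -> : F *m X *m F' - X - cR t *: (K *m X - X *m K) =
    (F - 1%:M - cR t *: K) *m X *m F' + cR t *: (K *m X *m (F' - 1%:M)) + X *m (F' - 1%:M + cR t *: K).
  move: (cR t) => z; rewrite !mxdistr !mulmx1 mul1mx -!scalemxAl -!scalemxAr !(scalerDr, scalerN).
  move: (F *m X *m F') (X *m F') (z *: (K *m X *m F')) (z *: (K *m X)) (z *: (X *m K)) => a1 a2 a3 a4 a5.
  by mxadd.
have t1 := mnM_le (mnM_le h3 (lexx (mn X))) mF.
have t2 : mn (cR t *: (K *m X *m (F' - 1%:M))) <= `|t| * (mn K * mn X * (d * `|t|)).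
  by rewrite mn_cR; apply: ler_wpM2l => //; exact: mnM_le (mnM_le (lexx _) (lexx _)) h2'.
have t3 := mnM_le (lexx (mn X)) h1.
apply: (le_trans (mnD _ _)); apply: (le_trans (lerD (mnD _ _) (lexx _))).
apply: (le_trans (lerD (lerD t1 t2) t3)); rewrite tn le_eqVlt; apply/orP; left; apply/eqP.
by move: (mn X) (mn K) => x k; ring.
Qed.

Variable L : set 'M[C]_n.
Hypothesis LE : L = lie_gen [set iC R *: H u | u in U].
Hypothesis LAd : forall E X, adj E *m E = 1%:M -> L X -> L (Ad E X).

(** [M] collects the matrices whose conjugates along every word, followed by [ev w], remain in the
    span of the velocities of [w]. It contains the generators by maximality of the rank. Conjugating
    along one more short flow and differentiating shows that it is stable under brackets with
    generators. *)
Lemma spanning_word : exists2 w, pword w & forall X, L X -> in_span (wordbasis w) X.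
Proof.
have [w hw hmax] := max_rank_word; exists w => //.
have hd := max_rank_dirs hw hmax.
pose M := [set X | forall w', pword w' -> in_span (wordbasis w) (Ad (ev w) (Ad (ev w') X))].
have MD X Y : M X -> M Y -> M (X + Y).
  by move=> hX hY w' hw'; rewrite !AdD; apply: in_spanD; [exact: hX|exact: hY].
have MZ r X : M X -> M (cR r *: X).
  by move=> hX w' hw'; rewrite !AdZ; apply: in_spanZ; exact: hX.
have M0 : M 0 by move=> w' _; rewrite !Ad0; exact: in_span0.
have MK u : U u -> M (- iC R *: H u).
  move=> Uu w' hw'; apply: (hd (w' ++ [:: (1, u)])).
    by apply: pword_cat => //; exact: pword1.
  by rewrite dirs_cat mem_cat /= inE eqxx orbT.
have Mbr u X : U u -> M X -> M ((- iC R *: H u) *m X - X *m (- iC R *: H u)).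
  move=> Uu hX w' hw'.
  have [c c0 hc] := flow_Ad_quadratic X (Hu_hermitian hH0 hHs u).
  pose b := mn (ev w *m ev w'); pose b' := mn (adj (ev w *m ev w')).
  apply: (@in_span_velocity _ _ _ _ _ (b * c * b')); first by rewrite !mulr_ge0 ?mn_ge0.
  move=> t t0; exists (Ad (ev w) (Ad (ev w') (Ad (flow (H u) t) X)) - Ad (ev w) (Ad (ev w') X)).
    apply: in_spanB; last exact: hX.
    have -> : Ad (ev w') (Ad (flow (H u) t) X) = Ad (ev (w' ++ [:: (t, u)])) X.
      by rewrite AdM ev_cat /= mulmx1.
    by apply: hX; apply: pword_cat => //; exact: pword1.
  rewrite -!AdB -!AdZ -!AdB AdM {1}/Ad.
  have := mnM_le (mnM_le (lexx b) (hc t (ltW t0))) (lexx b').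
  move=> h; apply: (le_trans h); rewrite le_eqVlt; apply/orP; left; apply/eqP; ring.
(* It is not evident that [M] is closed under brackets; by the Jacobi identity, its elements that
   preserve [M] under bracket do form a Lie algebra. *)
pose P := [set A | M A /\ forall X, M X -> M (A *m X - X *m A)].
have PL : lie_closed P.
  split.
  - split; first exact: M0.
    by move=> X _; rewrite mul0mx mulmx0 subrr; exact: M0.
  - move=> A B [hA hA'] [hB hB']; split; first exact: MD.
    move=> X hX; rewrite mulmxDl mulmxDr opprD addrACA.
    by apply: MD; [exact: hA'|exact: hB'].
  - move=> r A [hA hA']; split; first exact: MZ.
    by move=> X hX; rewrite -scalemxAl -scalemxAr -scalerBr; apply: MZ; exact: hA'.
  - move=> A B [hA hA'] [hB hB']; split; first exact: hA'.
    move=> X hX.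
    have -> : (A *m B - B *m A) *m X - X *m (A *m B - B *m A) =
        (A *m (B *m X - X *m B) - (B *m X - X *m B) *m A) +
        cR (-1) *: (B *m (A *m X - X *m A) - (A *m X - X *m A) *m B).
      rewrite cRN cR1 scaleN1r !mulmxBl !mulmxBr !mulmxA.
      move: (A *m B *m X) (B *m A *m X) (X *m A *m B) (X *m B *m A) (A *m X *m B) (B *m X *m A) => a1 a2 a3 a4 a5 a6.
      by mxadd.
    by apply: MD; [apply: hA'; exact: hB'|apply: MZ; apply: hB'; exact: hA'].
have SP : [set iC R *: H u | u in U] `<=` P.
  move=> _ [u Uu <-]; have E : iC R *: H u = cR (-1) *: (- iC R *: H u).
    by rewrite cRN cR1 scaleN1r scaleNr opprK.
  split; first by rewrite E; apply: MZ; exact: MK.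
  move=> X hX; rewrite E -scalemxAl -scalemxAr -scalerBr; apply: MZ; exact: Mbr.
move=> X LX; have E1 := ev_unitary hH0 hHs w.
have E2 := mulmx1C E1.
(* The conjugation by [ev w] in the definition of [M] is undone beforehand, which is possible since
   [L] is invariant under unitary conjugation. *)
have LY : L (Ad (adj (ev w)) X) by apply: LAd => //; rewrite adjK.
move: LY; rewrite LE => /(_ P PL SP) [hM _].
have := hM [::]; rewrite /= Ad1 AdM E2 Ad1; apply.
by move=> p; rewrite in_nil.
Qed.
End Rank.

(** * Local surjectivity *)

Section Topology.
Variable R : realType.

Lemma lipschitz_continuous N (f : 'rV[R]_N -> R) (K : R) : 0 <= K ->
  (forall x x', `|f x' - f x| <= K * n1 (x' - x)) -> continuous f.
Proof.
move=> K0 hf x S /nbhs_ballP [e /= e0 be]; change (nbhs x (f @^-1` S)).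
have K1 : 0 < K + 1 by rewrite ltr_wpDl.
pose A := [set x' | n1 (x' - x) < e / (K + 1)].
have oA : open A.
  apply: n1_open => u Au; exists (e / (K + 1) - n1 (u - x)); first by rewrite subr_gt0.
  move=> w wu; rewrite /A /=; have := n1D (w - u) (u - x); rewrite addrA subrK => h.
  by apply: (le_lt_trans h); rewrite -ltrBrDr.
have Ax : A x by rewrite /A /= subrr n10 divr_gt0.
have xA : nbhs x A by apply: open_nbhs_nbhs.
apply: filterS xA => x' /= hx'; apply: be.
rewrite /ball /= distrC; apply: (le_lt_trans (hf x x')).
apply: (@le_lt_trans _ _ ((K + 1) * n1 (x' - x))).
  by apply: ler_wpM2r; [exact: n1_ge0|rewrite lerDl].
by rewrite mulrC -ltr_pdivlMr.
Qed.

Lemma n1_dist N (x x' : 'rV[R]_N) : `|n1 x' - n1 x| <= n1 (x' - x).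
Proof.
have := n1D (x' - x) x; have := n1D (x - x') x'; rewrite !subrK.
have -> : n1 (x - x') = n1 (x' - x) by rewrite -n1N opprB.
move: (n1 _) (n1 _) (n1 _) => a b c h1 h2; rewrite ler_norml; apply/andP; split; lra.
Qed.

Lemma mn_dist p q (y A A' : 'M[complex R]_(p, q)) : `|mn (y - A') - mn (y - A)| <= mn (A' - A).
Proof.
have := mn_tri A y A'; have := mn_tri A' y A; rewrite [mn (A - A')]mnBC.
move: (mn _) (mn _) (mn _) => a b c h1 h2; rewrite ler_norml; apply/andP; split; lra.
Qed.

Lemma box_minimum N (f : 'rV[R]_N -> R) (r : R) : 0 <= r -> continuous f ->
  exists2 x : 'rV[R]_N, (forall i, `|x 0 i| <= r) & forall x' : 'rV[R]_N, (forall i, `|x' 0 i| <= r) -> f x <= f x'.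
Proof.
move=> r0 cf; pose A := [set v : 'rV[R]_N | forall i, v ord0 i \in `[(- r), r]].
have cA : compact A.
  apply: (@rV_compact _ _ (fun=> `[(- r), r]%classic)).
  by move=> _; apply: segment_compact.
have inA (x : 'rV[R]_N) : (forall i, `|x 0 i| <= r) <-> A x.
  by split=> h i; have := h i; rewrite in_itv /= ler_norml.
have A0 : A !=set0 by exists 0; apply/inA => i; rewrite mxE normr0.
have [x /set_mem xA hx] := EVT_min_rV A0 cA (continuous_subspaceT cf).
by exists x; [exact/inA|move=> x' hx'; apply: hx; apply/mem_set/inA].
Qed.

Lemma le_sum4 (a1 a2 a3 a4 : R) : 0 <= a1 -> 0 <= a2 -> 0 <= a3 -> 0 <= a4 ->
  [/\ a1 <= a1 + a2 + a3 + a4, a2 <= a1 + a2 + a3 + a4, a3 <= a1 + a2 + a3 + a4 & a4 <= a1 + a2 + a3 + a4].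
Proof. by move=> *; split; lra. Qed.

(** Bookkeeping of a Newton step, with E the residual, a the size of the current shift and na that
    of the correction. The first three terms on the left are together less than E / 2 by the
    smallness of rho, and the penalty grows by eta na, at most E / 2. *)
Lemma newton_arith (k b c l d eta rho E a na : R) : 0 <= k -> 0 <= b -> 0 <= c -> 0 <= l -> 0 <= d -> 0 < eta ->
  eta * (2 * k * b) <= 2^-1 -> 0 < E -> E <= rho -> 0 <= a -> eta * a <= rho -> 0 <= na -> na <= 2 * k * b * E ->
  rho * (d * b ^+ 3 + 2 * b * l / eta + c * (2 / eta + 2 * k * b) * (2 * k * b)) < 2^-1 ->
  d * (E * b) ^+ 2 * b + 2 * b * E * (l * a) + c * (2 * a + na) * na + eta * (a + na) < E + eta * a.
Proof.
move=> k0 b0 c0 l0 d0 eta0 heta E0 Er a0 ha na0 hna hZ.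
have ar : a <= rho / eta by rewrite ler_pdivlMr // mulrC.
have rho0 : 0 <= rho by apply: ltW; exact: lt_le_trans Er.
have kb0 : 0 <= 2 * k * b by rewrite !mulr_ge0.
have t1 : d * (E * b) ^+ 2 * b <= E * (rho * (d * b ^+ 3)).
  have -> : d * (E * b) ^+ 2 * b = E * (E * (d * b ^+ 3)) by ring.
  by apply: ler_wpM2l; [exact: ltW|apply: ler_wpM2r => //; rewrite mulr_ge0 // exprn_ge0].
have t2 : 2 * b * E * (l * a) <= E * (rho * (2 * b * l / eta)).
  have -> : 2 * b * E * (l * a) = E * (2 * b * l * a) by ring.
  have -> : rho * (2 * b * l / eta) = 2 * b * l * (rho / eta) by ring.
  by apply: ler_wpM2l; [exact: ltW|apply: ler_wpM2l => //; rewrite !mulr_ge0].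
have t3 : c * (2 * a + na) * na <= E * (rho * (c * (2 / eta + 2 * k * b) * (2 * k * b))).
  have -> : E * (rho * (c * (2 / eta + 2 * k * b) * (2 * k * b))) =
     c * (2 * (rho / eta) + 2 * k * b * rho) * (2 * k * b * E) by ring.
  apply: ler_pM => //; first by rewrite mulr_ge0 // addr_ge0 // mulr_ge0.
  apply: ler_wpM2l => //; apply: lerD; first by rewrite ler_wpM2l.
  by apply: (le_trans hna); apply: ler_wpM2l.
have t4 : eta * na <= E * 2^-1.
  apply: (@le_trans _ _ (eta * (2 * k * b * E))); first by rewrite ler_pM2l.
  by rewrite mulrA mulrC; apply: ler_wpM2l => //; exact: ltW.
have t5 := hZ; rewrite -(ltr_pM2l E0) in t5.
have e : E * (rho * (d * b ^+ 3)) + E * (rho * (2 * b * l / eta)) +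
   E * (rho * (c * (2 / eta + 2 * k * b) * (2 * k * b))) =
   E * (rho * (d * b ^+ 3 + 2 * b * l / eta + c * (2 / eta + 2 * k * b) * (2 * k * b))) by ring.
have := lerD (lerD t1 t2) t3; rewrite e => t123.
have t := ltr_leD (le_lt_trans t123 t5) t4.
by rewrite (mulrDr eta) [eta * a + _]addrC addrA ltrD2r; apply: (lt_le_trans t); rewrite -splitr.
Qed.
End Topology.

Section Extension.
Variable R : realType.
Variable N : nat.
Implicit Types x y : 'rV[R]_N.

Definition ext x (k : nat) : R := oapp (fun i : 'I_N => x 0 i) 0 (insub k).

Lemma extE x (k : 'I_N) : ext x k = x 0 k.
Proof. by rewrite /ext valK. Qed.
Lemma extB x y : (fun k => ext x k - ext y k) = ext (x - y).
Proof. by apply/funext => k; rewrite /ext; case: insub => [i|] /=; rewrite ?subr0 // !mxE. Qed.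
Lemma ext0 : ext 0 = fun=> 0.
Proof. by apply/funext => k; rewrite /ext; case: insub => [i|] //=; rewrite mxE. Qed.
Lemma ext_bound x r : 0 <= r -> (forall i, `|x 0 i| <= r) -> forall k, `|ext x k| <= r.
Proof. by move=> r0 h k; rewrite /ext; case: insub => [i|] /=; rewrite ?normr0. Qed.
Lemma nrm_ext x : nrm N (ext x) = n1 x.
Proof. by apply: eq_bigr => k _; rewrite extE. Qed.
End Extension.

(** * Newton step in a group of unitary matrices *)

Section Newton.
Variable R : realType.
Local Notation C := (complex R).
Variables n m : nat.
Variables (H0 : 'M[C]_n) (Hs : 'I_m -> 'M[C]_n).
Hypothesis hH0 : is_hermitian H0.
Hypothesis hHs : forall k, is_hermitian (Hs k).
Local Notation H := (Hu H0 Hs).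
Variable U : set 'rV[R]_m.
Implicit Types (w : seq (R * 'rV[R]_m)) (s : nat -> R).
Local Notation ev := (ev H0 Hs).
Local Notation evs := (evs H0 Hs).

Fixpoint shift w s := if w is p :: w' then (p.1 + s 0%N, p.2) :: shift w' (fun k => s k.+1) else [::].

Lemma ev_shift w s : ev (shift w s) = evs w s.
Proof. by elim: w s => //= p w IH s; rewrite IH. Qed.

Lemma shift_word w : pword U w -> exists2 r : R, 0 < r & forall s, (forall k, `|s k| <= r) -> word U (shift w s).
Proof.
elim: w => [|p w IH] hw; first by exists 1 => // s _ p; rewrite in_nil.
have [p0 Up] := hw p (mem_head _ _).
have [r r0 hr] := IH (fun q qw => hw q (mem_behead (s := p :: w) qw)).
exists (Num.min r p.1); first by rewrite lt_min r0 p0.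
move=> s hs; have h k := hs k; apply/word_cons; split.
  split=> //=; have := h 0%N; rewrite le_min => /andP [_]; rewrite ler_norml => /andP [a _].
  by rewrite -lerBlDl sub0r.
by apply: hr => k; have := h k.+1; rewrite le_min => /andP [].
Qed.

Lemma dlin_ext w (x : 'rV[R]_(size w)) : dlin H0 Hs w (ext x) = lincomb (@wordbasis R n m H0 Hs w) x.
Proof. by apply: eq_bigr => k _; rewrite extE. Qed.

Variables (G L : set 'M[C]_n).
Hypothesis GU : forall g, G g -> adj g *m g = 1%:M.
Hypothesis GM : forall g h, G g -> G h -> G (g *m h).
Hypothesis GV : forall g, G g -> G (adj g).
Hypothesis Gev : forall w s, pword U w -> G (evs w s).
Hypothesis Gnear : exists c e : R, [/\ 0 <= c, 0 < e & forall g, G g -> mn (g - 1%:M) <= e ->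
  exists2 X, L X & mn (g - 1%:M - X) <= c * mn (g - 1%:M) ^+ 2].

(* One Newton step at a minimizer of [mn (y - evs w s) + eta * |s|] would decrease the functional
   unless [y = evs w s]. *)
Lemma local_surjectivity w : pword U w -> (forall X, L X -> in_span (@wordbasis R n m H0 Hs w) X) ->
  exists2 rho : R, 0 < rho & forall y, G y -> mn (y - ev w) <= rho -> exists2 w', word U w' & ev w' = y.
Proof.
move=> hw hL.
have [k k0 hk] := lincomb_coords (@wordbasis R n m H0 Hs w).
have [c c0 hc] := evs_strict hH0 hHs w; have [l l0 hl] := evs_lipschitz hH0 hHs w.
have [d [e [d0 e0 hG]]] := Gnear; have [r r0 hr] := shift_word hw.
pose b : R := (2 * n * n)%:R + 1; have b0 : 0 < b by rewrite ltr_wpDl // ler0n.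
have mb g : G g -> mn g <= b by move=> /GU /mn_isometry h; apply: (le_trans h); rewrite lerDl.
(* The correction will have size at most 2 k b times the residual; with this weight its penalty is
   at most half the residual. *)
pose eta := (4 * k * b)^-1; have eta0 : 0 < eta by rewrite invr_gt0 !mulr_gt0.
have heta : eta * (2 * k * b) <= 2^-1.
  have -> : 2 * k * b = (4 * k * b) * 2^-1 by field.
  by rewrite mulrA mulVf ?mul1r // gt_eqF // !mulr_gt0.
pose Z := d * b ^+ 3 + 2 * b * l / eta + c * (2 / eta + 2 * k * b) * (2 * k * b).
have b0' := ltW b0; have k0' := ltW k0; have eta0' : 0 <= eta^-1 by rewrite invr_ge0 ltW.
have Z0 : 0 <= Z.
  by rewrite !addr_ge0 // !mulr_ge0 ?exprn_ge0 // addr_ge0 // !mulr_ge0.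
(* The radius is 1 / q, and each summand of q secures one condition: [Gnear] applies, the direction
   is at most 2 b times the residual, [newton_arith] applies, the step stays in the box. *)
pose q := b / e + d * b + (2 * Z + 2) + (eta^-1 + 2 * k * b) / r.
have q1 : 0 <= b / e by rewrite divr_ge0 // ltW.
have q2 : 0 <= d * b by rewrite mulr_ge0.
have q3 : 0 < 2 * Z + 2 by rewrite ltr_wpDl // mulr_ge0.
have q4 : 0 <= (eta^-1 + 2 * k * b) / r by rewrite divr_ge0 ?(ltW r0) // addr_ge0 // !mulr_ge0.
have [le1 le2 le3 le4] := le_sum4 q1 q2 (ltW q3) q4.
have q0 : 0 < q by rewrite ltr_wpDr // ltr_wpDl // addr_ge0.
have le_q z : z <= q -> q^-1 * z <= 1 by move=> zq; rewrite mulrC ler_pdivrMr // mul1r.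
have rho_e : q^-1 * b <= e.
  by have := le_q _ le1; rewrite mulrA ler_pdivrMr // mul1r.
have rho_d : q^-1 * (d * b) <= 1 by exact: le_q le2.
have rho_Z : q^-1 * Z < 2^-1.
  have := le_q _ le3.
  have : 0 < q^-1 by rewrite invr_gt0.
  rewrite mulrDr mulrCA; move: (q^-1 * Z) q^-1 => z p; lra.
have rho_r : q^-1 * (eta^-1 + 2 * k * b) <= r.
  by have := le_q _ le4; rewrite mulrA ler_pdivrMr // mul1r.
exists q^-1; first by rewrite invr_gt0.
move: (q^-1) rho_e rho_d rho_Z rho_r => rho rho_e rho_d rho_Z rho_r {q q0 q1 q2 q3 q4 le_q} y Gy yw.
pose f x := mn (y - evs w (ext x)) + eta * n1 (x : 'rV[R]_(size w)).
have cf : continuous f.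
  apply: (@lipschitz_continuous _ _ _ (l + eta)); first by rewrite addr_ge0 // ltW.
  move=> x x'; rewrite /f.
  have h1 : `|mn (y - evs w (ext x')) - mn (y - evs w (ext x))| <= l * n1 (x' - x).
    by have := hl (ext x) (ext x'); rewrite extB nrm_ext; apply: le_trans; exact: mn_dist.
  have h2 := n1_dist x x'.
  have -> : mn (y - evs w (ext x')) + eta * n1 x' - (mn (y - evs w (ext x)) + eta * n1 x) =
    (mn (y - evs w (ext x')) - mn (y - evs w (ext x))) + eta * (n1 x' - n1 x) by ring.
  apply: (le_trans (ler_normD _ _)); rewrite mulrDl normrM (gtr0_norm eta0).
  by apply: lerD => //; rewrite ler_pM2l.
have [x hx hmin] := box_minimum (ltW r0) cf.
have hwx := hr _ (ext_bound (ltW r0) hx).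
have [yE|yne] := eqVneq y (evs w (ext x)).
  by exists (shift w (ext x)); rewrite // ev_shift.
exfalso.
have GP : G (evs w (ext x)) by exact: Gev.
have f0 : f x <= rho.
  apply: (le_trans (hmin 0 _)) => [i|]; first by rewrite mxE normr0 ltW.
  by rewrite /f ext0 n10 mulr0 addr0 evs0.
set P := evs w (ext x) in yne GP f0 *.
have P1 := GU GP; have P2 := mulmx1C P1.
have E0 : 0 < mn (y - P).
  rewrite lt_neqAle mn_ge0 andbT eq_sym; apply: contra yne => /eqP /mn_eq0 /eqP.
  by rewrite subr_eq0.
have Er : mn (y - P) <= rho.
  by apply: le_trans f0; rewrite /f -/P lerDl mulr_ge0 ?n1_ge0 // ltW.
have nr : eta * n1 x <= rho by apply: le_trans f0; rewrite /f -/P lerDr mn_ge0.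
(* The residual is written multiplicatively as g P = y, so that [Gnear] yields a direction in [L],
   which the velocities of [w] span. *)
pose g := y *m adj P; have Gg : G g by apply: GM => //; exact: GV.
have gP : g *m P = y by rewrite /g -mulmxA P1 mulmx1.
have ge : mn (g - 1%:M) <= mn (y - P) * b.
  have -> : g - 1%:M = (y - P) *m adj P by rewrite mulmxBl P2.
  by apply: mnM_le => //; rewrite mn_adj; exact: mb.
have ge' : mn (g - 1%:M) <= e.
  by apply: (le_trans ge); apply: le_trans rho_e; rewrite ler_pM2r.
have [X LX hX] := hG g Gg ge'.
have hX2 : d * mn (g - 1%:M) ^+ 2 <= d * (mn (y - P) * b) ^+ 2.
  by apply: ler_wpM2l => //; rewrite ler_sqr ?nnegrE ?mn_ge0 // mulr_ge0 // mn_ge0.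
have mX : mn X <= 2 * b * mn (y - P).
  have -> : X = (g - 1%:M) - (g - 1%:M - X) by rewrite opprB addrC subrK.
  apply: (le_trans (mnB _ _)); apply: (le_trans (lerD ge (le_trans hX hX2))).
  have : d * (mn (y - P) * b) ^+ 2 <= mn (y - P) * b.
    have -> : d * (mn (y - P) * b) ^+ 2 = mn (y - P) * (d * b) * (mn (y - P) * b) by ring.
    rewrite ler_piMl ?mulr_ge0 ?mn_ge0 //; apply: le_trans rho_d; apply: ler_wpM2r => //.
    exact: mulr_ge0.
  move: (mn (y - P)) => z h; have -> : 2 * b * z = z * b + z * b by ring.
  by rewrite lerD2l.
have [a aX ha] := hk X (hL X LX).
have na : n1 a <= 2 * k * b * mn (y - P).
  apply: (le_trans ha); have -> : 2 * k * b * mn (y - P) = k * (2 * b * mn (y - P)) by ring.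
  by rewrite ler_pM2l.
(* The penalty keeps the minimizer far enough from the boundary of the box for the corrected shift
   to remain inside. *)
have nxa : n1 x + n1 a <= r.
  apply: le_trans rho_r; rewrite mulrDr; apply: lerD; first by rewrite ler_pdivlMr // mulrC.
  apply: (le_trans na); rewrite mulrC; apply: ler_wpM2r => //; by rewrite !mulr_ge0.
have hxa i : `|(x + a) 0 i| <= r.
  by apply: (le_trans (n1_entry _ _)); apply: (le_trans (n1D _ _)).
have := hmin _ hxa; apply/negP; rewrite -ltNge /f -/P.
have st := hc (ext x) (ext (x + a)); have xax : x + a - x = a by rewrite addrC addKr.
rewrite extB xax dlin_ext aX !nrm_ext in st.
set P' := evs w (ext (x + a)) in st *; rewrite -/P in st.
have lw : mn (P - ev w) <= l * n1 x.
  by have := hl (ext (0 : 'rV[R]_(size w))) (ext x); rewrite extB subr0 nrm_ext ext0 evs0.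
have yP' : y - P' = (g - 1%:M - X) *m P + X *m (P - ev w) - (P' - P - X *m ev w).
  rewrite !mulmxBl gP mul1mx mulmxBr; move: (X *m P) (X *m ev w) => a1 a2; clear; mxadd.
have b1 : mn (y - P') <= d * (mn (y - P) * b) ^+ 2 * b + 2 * b * mn (y - P) * (l * n1 x) + c * (2 * n1 x + n1 a) * n1 a.
  rewrite yP'; apply: (le_trans (mnB _ _)); apply: lerD.
    apply: (le_trans (mnD _ _)); apply: lerD; first exact: mnM_le (le_trans hX hX2) (mb _ GP).
    exact: mnM_le mX lw.
  apply: (le_trans st); apply: ler_wpM2r; first exact: n1_ge0.
  by apply: ler_wpM2l => //; rewrite mulr_natl mulr2n -addrA lerD2l n1D.
apply: (le_lt_trans (lerD b1 (ler_wpM2l (ltW eta0) (n1D x a)))).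
exact: (newton_arith k0' b0' c0 l0 d0 eta0 heta E0 Er (n1_ge0 x) nr (n1_ge0 a) na rho_Z).
Qed.
End Newton.

(** * Unitary groups *)

Section Recurrence.
Variable R : realType.
Local Notation C := (complex R).

Lemma pigeonhole_close (I : finType) (v : nat -> I -> R) (b d : R) : 0 <= b -> 0 < d ->
  (forall k l, `|v k l| <= b) -> exists i j, (i < j)%N /\ forall l, `|v i l - v j l| <= d.
Proof.
move=> b0 d0 hv; pose x k l := (v k l + b) / d.
have x0 k l : 0 <= x k l.
  rewrite divr_ge0 ?(ltW d0) //; have := hv k l; rewrite ler_norml => /andP [h _].
  by rewrite -lerBlDr sub0r.
pose M := Num.truncn (2 * b / d).
have xM k l : (Num.truncn (x k l) < M.+1)%N.
  rewrite ltnS /M; apply: Num.Theory.le_truncn.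
  rewrite ler_pdivrMr ?divfK ?gt_eqF //.
  by have := hv k l; rewrite ler_norml => /andP [_ h]; rewrite mulr_natl mulr2n lerD2r.
pose cell k : {ffun I -> 'I_M.+1} := [ffun l => inord (Num.truncn (x k l))].
pose N := #|{ffun I -> 'I_M.+1}|.
have /injectivePn [i [j ij cij]] : ~~ injectiveb (fun k : 'I_N.+1 => cell k).
  apply/negP => /injectiveP inj; have := leq_card _ inj; by rewrite card_ord ltnn.
have close (p q : nat) : cell p = cell q -> forall l, `|v p l - v q l| <= d.
  move=> /ffunP e l; have := e l; rewrite !ffunE => /(congr1 val) /=; rewrite !inordK // => et.
  have := truncn_itv (x0 p l); have := truncn_itv (x0 q l); rewrite et.
  move: (Num.truncn _) => k; rewrite -addn1 natrD.
  have -> : v p l - v q l = (x p l - x q l) * d by rewrite /x -mulrBl divfK ?gt_eqF //; ring.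
  move=> /andP [a1 a2] /andP [a3 a4]; rewrite normrM (gtr0_norm d0) ler_piMl ?(ltW d0) //.
  by move: a1 a2 a3 a4; clear; move: (x p l) (x q l) k%:R => y z t a1 a2 a3 a4; rewrite ler_norml; apply/andP; split; lra.
move: ij; rewrite neq_ltn => /orP [ij|ij].
  by exists i, j; split => // l; exact: close.
by exists j, i; split => // l; apply: close.
Qed.

Definition mpow n (g : 'M[C]_n) k := iter k (mulmx g) 1%:M.

Lemma mpowD n (g : 'M[C]_n) j k : mpow g (j + k) = mpow g j *m mpow g k.
Proof. by elim: j => [|j IH]; rewrite ?mul1mx // addSn /mpow !iterS -/(mpow g _) IH mulmxA. Qed.

(** The pigeonhole principle gives two close powers, whose quotient is close to 1. The positive
    exponent matters: [mpow g k] is then an approximate inverse of [g]. *)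
Lemma unitary_recurrence n (g : 'M[C]_n) (d : R) : 0 < d -> adj g *m g = 1%:M ->
  exists k, mn (mpow g k.+1 - 1%:M) <= d.
Proof.
move=> d0 g1; have pU k : adj (mpow g k) *m mpow g k = 1%:M.
  elim: k => [|k IH]; first by rewrite adj1 mul1mx.
  by rewrite /mpow iterS -/(mpow g k) adjM -mulmxA [adj g *m _]mulmxA g1 mul1mx.
pose b : R := (2 * n * n)%:R + 1; have b0 : 0 < b by rewrite ltr_wpDl // ler0n.
have mp k : mn (mpow g k) <= b by apply: (le_trans (mn_isometry (pU k))); rewrite lerDl.
pose part (X : 'M[C]_n) (p : 'I_n * 'I_n * bool) := if p.2 then complex.Re (X p.1.1 p.1.2) else complex.Im (X p.1.1 p.1.2).
have hv k l : `|part (mpow g k) l| <= b.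
  apply: le_trans (mp k); rewrite /part; case: l.2.
    exact: le_trans (Re_le_cn _) (mn_entry _ _ _).
  exact: le_trans (Im_le_cn _) (mn_entry _ _ _).
have e0 : 0 < d / (b * b) by rewrite divr_gt0 // mulr_gt0.
have [i [j [ij close]]] := pigeonhole_close (ltW b0) e0 hv.
exists (j - i).-1; have ji : (j - i).-1.+1 = (j - i)%N by rewrite prednK // subn_gt0.
rewrite ji; have jE : j = (i + (j - i))%N by rewrite subnKC // ltnW.
have -> : mpow g (j - i) - 1%:M = adj (mpow g i) *m (mpow g j - mpow g i).
  by rewrite mulmxBr pU {2}jE mpowD mulmxA pU mul1mx.
have hd : mn (mpow g j - mpow g i) <= (2 * n * n)%:R * (d / (b * b)).
  rewrite mnBC; apply: mn_le_parts => a c; rewrite mxDE mxNE.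
    by rewrite ReB; exact: (close (a, c, true)).
  by rewrite ImB; exact: (close (a, c, false)).
have hi : mn (adj (mpow g i)) <= b by rewrite mn_adj.
apply: (le_trans (mnM_le hi hd)).
apply: (@le_trans _ _ (b * (b * (d / (b * b))))).
  by apply: ler_wpM2l; [exact: ltW|apply: ler_wpM2r; [exact: ltW|rewrite lerDl]].
by rewrite mulrA mulrC divfK // gt_eqF // mulr_gt0.
Qed.
End Recurrence.

(** * Roots near the identity in U(n) and SU(n) *)

Section Roots.
Variable R : realType.
Local Notation C := (complex R).

Lemma cis_surjective (z : C) : conjc z * z = 1 -> exists t, z = cis t.
Proof.
case: z => a b /eqP; rewrite eq_complex /= => /andP [/eqP h _].
have h' : a ^+ 2 + b ^+ 2 = 1 by rewrite -h; ring.
have a1 : -1 <= a <= 1.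
  have := sqr_ge0 b; have : a ^+ 2 <= 1 by rewrite -h' lerDl sqr_ge0.
  by move=> h1 _; rewrite -ler_norml -(ler_pXn2r (ltn0Sn 1)) ?nnegrE // real_normK ?num_real // expr1n.
have ca : cos (acos a) = a by apply: acosK; rewrite in_itv.
have : (sin (acos a) - b) * (sin (acos a) + b) = 0.
  have -> : (sin (acos a) - b) * (sin (acos a) + b) = sin (acos a) ^+ 2 - b ^+ 2 by ring.
  by rewrite sin2cos2 ca -h'; ring.
move/eqP; rewrite mulf_eq0 subr_eq0 addr_eq0 => /orP [/eqP sb|/eqP sb].
  by exists (acos a); rewrite /cis ca sb.
by exists (- acos a); rewrite /cis cosN sinN ca sb opprK.
Qed.

Variable n : nat.
Implicit Types g W : 'M[C]_n.

Lemma unitary_uexp g : adj g *m g = 1%:M -> exists W r, adj W *m W = 1%:M /\ g = uexp W r.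
Proof.
move=> g1; have [W [d [W1 gE]]] := normal_diag (etrans (mulmx1C g1) (esym g1)).
have dE k : exists t, d k = cis t.
  apply: cis_surjective.
  have D : adj W *m (adj g *m g) *m W = diag_mx (\row_k (conjc (d k) * d k)).
    have gE' : g = conj_diag W d by exact: gE.
    by rewrite gE' adj_conj_diag conj_diagM // /conj_diag !mulmxA W1 mul1mx -mulmxA W1 mulmx1.
  have := congr1 (fun M : 'M[C]_n => M k k) D.
  by rewrite /= g1 mulmx1 W1 !mxE eqxx !mulr1n => <-.
exists W, (fun k => projT1 (cid (dE k))); split=> //.
rewrite gE /uexp /conj_diag; congr (_ *m diag_mx _ *m _); apply/rowP => k; rewrite !mxE.
by case: cid.
Qed.

Lemma uexp_mpow W r N : adj W *m W = 1%:M -> mpow (uexp W r) N = uexp W (fun k => N%:R * r k).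
Proof.
move=> W1; elim: N => [|N IH].
  rewrite /mpow /= -(conj_diag1 W1); congr conj_diag.
  by apply/funext => k; rewrite mul0r cis0.
rewrite /mpow iterS -/(mpow _ N) IH -(uexpD _ _ W1); congr uexp.
by apply/funext => k; rewrite -addn1 natrD mulrDl mul1r addrC.
Qed.

Lemma uexp_near1 W r : adj W *m W = 1%:M ->
  mn (uexp W r - 1%:M) <= (2 * n * n)%:R ^+ 2 * (2 * \sum_k `|r k|).
Proof.
move=> W1; have -> : uexp W r - 1%:M = conj_diag W (fun k => cis (r k) + -1 * 1).
  rewrite (conj_diagD _ (fun k => cis (r k)) (fun _ => -1 * 1)) (conj_diagZ _ (-1) (fun _ => 1)).
  by rewrite (conj_diag1 W1) scaleN1r.
apply: (le_trans (mn_conj_diag _ W1)); apply: ler_wpM2l; first exact: sqr_ge0.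
by rewrite mulr_sumr; apply: ler_sum => k _; rewrite mulN1r; exact: cn_cis1.
Qed.

Lemma uexp_root W r (e : R) : 0 < e -> adj W *m W = 1%:M -> exists N : nat,
  [/\ mpow (uexp W (fun k => N.+1%:R^-1 * r k)) N.+1 = uexp W r & mn (uexp W (fun k => N.+1%:R^-1 * r k) - 1%:M) <= e].
Proof.
move=> e0 W1; pose c := (2 * n * n)%:R ^+ 2 * (2 * \sum_k `|r k|).
exists (Num.truncn (c / e)); set N := _.+1; have N0 : 0 < N%:R :> R by rewrite ltr0n.
split.
  rewrite uexp_mpow //; congr uexp; apply/funext => k.
  by rewrite mulrA mulfV ?mul1r // gt_eqF.
apply: (le_trans (uexp_near1 _ W1)).
have -> : \sum_k `|N%:R^-1 * r k| = N%:R^-1 * \sum_k `|r k|.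
  by rewrite mulr_sumr; apply: eq_bigr => k _; rewrite normrM gtr0_norm // invr_gt0.
have -> : (2 * n * n)%:R ^+ 2 * (2 * (N%:R^-1 * \sum_k `|r k|)) = N%:R^-1 * c by rewrite /c; ring.
rewrite mulrC ler_pdivrMr // -ler_pdivrMl // mulrC.
have c0 : 0 <= c / e.
  by rewrite divr_ge0 ?(ltW e0) // !mulr_ge0 ?sqr_ge0 // sumr_ge0.
by have /andP [_ h] := truncn_itv c0; exact: ltW.
Qed.

Lemma U_root g (e : R) : 0 < e -> U_grp g -> exists h N, [/\ U_grp h, mpow h N = g & mn (h - 1%:M) <= e].
Proof.
move=> e0 g1; have [W [r [W1 ->]]] := unitary_uexp g1.
have [N [h1 h2]] := uexp_root r e0 W1.
by exists (uexp W (fun k => N.+1%:R^-1 * r k)), N.+1; split=> //; exact: uexp_unitary.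
Qed.

Lemma SU_root g (e : R) : (0 < n)%N -> 0 < e -> SU_grp g ->
  exists h N, [/\ SU_grp h, mpow h N = g & mn (h - 1%:M) <= e].
Proof.
move=> n0 e0 [g1 dg]; have [W [r [W1 gE]]] := unitary_uexp g1.
pose k0 : 'I_n := Ordinal n0; pose s := \sum_k r k.
have cs : cis s = 1 by rewrite /s -(uexp_det r W1) -gE.
(* Since [cis s] is 1, removing the whole sum of the angles from one of them leaves [g] unchanged;
   with angles of sum zero, all fractional powers have determinant 1. *)
pose r' k := if k == k0 then r k - s else r k.
have sr' : \sum_k r' k = 0.
  rewrite (bigD1 k0) //= /r' eqxx (eq_bigr r) => [|k /negPf -> //].
  have -> : s = r k0 + \sum_(i | i != k0) r i by rewrite /s (bigD1 k0).
  by rewrite opprD addrA subrr sub0r addNr.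
have gE' : g = uexp W r'.
  rewrite gE /uexp; congr conj_diag; apply/funext => k; rewrite /r'; case: eqP => // _.
  by rewrite cisD -conj_cis cs /= oppr0 mulr1.
have [N [h1 h2]] := uexp_root r' e0 W1.
exists (uexp W (fun k => N.+1%:R^-1 * r' k)), N.+1; split=> //; last by rewrite gE'.
split; first exact: uexp_unitary.
by rewrite uexp_det // -mulr_sumr sr' mulr0 cis0.
Qed.
End Roots.

(** * First-order tangent directions at the identity *)

Section NearIdentity.
Variable R : realType.
Local Notation C := (complex R).
Variable n : nat.
Implicit Types g : 'M[C]_n.

Definition skew_part g : 'M[C]_n := cR 2^-1 *: (g - adj g).

Lemma skew_part_skew g : adj (skew_part g) = - skew_part g.
Proof. by rewrite /skew_part adjZ conj_cR adjB adjK -scalerN opprB. Qed.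

(** For unitary [g] the Hermitian part of g - 1 is minus half of [adj (g - 1%:M) *m (g - 1%:M)],
    hence quadratic; the skew part can thus stand in for a logarithm. *)
Lemma skew_part_near g : adj g *m g = 1%:M -> mn (g - 1%:M - skew_part g) <= mn (g - 1%:M) ^+ 2.
Proof.
move=> g1; have -> : g - 1%:M - skew_part g = cR (- 2^-1) *: (adj (g - 1%:M) *m (g - 1%:M)).
  rewrite adjB adj1 mulmxBl mulmxBr g1 !mul1mx mulmx1 /skew_part.
  have half (Z : 'M[C]_n) : Z = cR 2^-1 *: Z + cR 2^-1 *: Z.
    by rewrite -scalerDl -cRD; have -> : 2^-1 + 2^-1 = 1 :> R by [lra]; rewrite cR1 scale1r.
  rewrite {1}(half (g - 1%:M)).
  rewrite cRN scaleNr; move: (cR _) => z.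
  have -> : 1%:M - adj g - (g - 1%:M) = - (g - 1%:M + (adj g - 1%:M)).
    by move: (adj g) => a1; clear; move: g (1%:M : 'M[C]_n) => a2 a3; mxadd.
  rewrite scalerN opprK !(scalerDr, scalerN).
  by move: (z *: g) (z *: 1%:M) (z *: adj g) => a1 a2 a3; mxadd.
rewrite mn_cR normrN ger0_norm ?invr_ge0 // expr2.
have h := mnM (adj (g - 1%:M)) (g - 1%:M); rewrite mn_adj in h.
apply: (@le_trans _ _ (1 * mn (adj (g - 1%:M) *m (g - 1%:M)))); last by rewrite mul1r.
by apply: ler_wpM2r; [exact: mn_ge0|rewrite invf_le1 // ler1n].
Qed.

Lemma U_near : exists c e : R, [/\ 0 <= c, 0 < e & forall g, U_grp g -> mn (g - 1%:M) <= e ->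
  exists2 X, u_alg X & mn (g - 1%:M - X) <= c * mn (g - 1%:M) ^+ 2].
Proof.
exists 1, 1; split => // g g1 _; exists (skew_part g); first exact: skew_part_skew.
by rewrite mul1r; exact: skew_part_near.
Qed.

Lemma small_angle (t : R) : `|t| <= 2^-1 -> `|t| <= 2 * cn (cis t - 1).
Proof.
move=> t2; have h1 := sin_quadratic t.
have h2 : `|sin t| <= cn (cis t - 1) by rewrite /cn /= subr0 lerDr.
have h3 : `|t| <= `|sin t| + `|sin t - t|.
  by have := ler_normB (sin t) (sin t - t); rewrite opprB addrC subrK.
have h4 : t ^+ 2 <= 2^-1 * `|t|.
  by rewrite -(real_normK (num_real t)) expr2; apply: ler_wpM2r.
by move: h1 h2 h3 h4; move: (cn _) (t ^+ 2) `|sin t| `|sin t - t| `|t| => z1 z2 z3 z4 z5; clear; lra.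
Qed.

(** The skew part of [g] need not be traceless. Its exponential [E] differs from [g] at second
    order, has determinant [cis] of the trace angle t, and [g] has determinant 1; so t is of second
    order, and a scalar matrix absorbs it. *)
Lemma SU_near : (0 < n)%N -> exists c e : R, [/\ 0 <= c, 0 < e & forall g, SU_grp g -> mn (g - 1%:M) <= e ->
  exists2 X, su_alg X & mn (g - 1%:M - X) <= c * mn (g - 1%:M) ^+ 2].
Proof.
move=> n0; have [c c0 hc] := skew_exp R n.
pose b : R := (2 * n * n)%:R + 1; have b1 : 1 <= b by rewrite lerDr ler0n.
have [d d0 hd] := det_lip n b1.
pose D := 2 * (d * (4 * c + 1)); have D0 : 0 <= D by rewrite !mulr_ge0 // addr_ge0 // mulr_ge0.
(* The radius 1 / 4 keeps the trace angle within 1 / 2, where [small_angle] applies. *)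
exists (1 + D * mn (1%:M : 'M[C]_n)), 4^-1; split.
- by rewrite addr_ge0 // mulr_ge0 // mn_ge0.
- by rewrite invr_gt0.
move=> g [g1 dg] he; have hs := skew_part_skew g; have hn := skew_part_near g1.
set Y := skew_part g in hs hn *; set e := mn (g - 1%:M) in he hn *.
have e0 : 0 <= e by exact: mn_ge0.
have mY : mn Y <= 2 * e.
  have -> : Y = (g - 1%:M) - (g - 1%:M - Y) by rewrite opprB addrC subrK.
  apply: (le_trans (mnB _ _)); rewrite mulr_natl mulr2n; apply: lerD => //.
  by apply: (le_trans hn); rewrite expr2 ler_piMl //; apply: (le_trans he); rewrite invf_le1 // ler1n.
pose t := complex.Im (\tr Y); have tY := skew_trace hs; rewrite -/t in tY.
have tm : `|t| <= mn Y.
  by have := mn_tr Y; rewrite tY cn_iCM cn_cR.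
have [E [E1 dE hE]] := hc Y hs.
have mE : mn E <= b by apply: (le_trans (mn_isometry E1)); rewrite lerDl.
have mg : mn g <= b by apply: (le_trans (mn_isometry g1)); rewrite lerDl.
have hEg : mn (E - g) <= (4 * c + 1) * e ^+ 2.
  have -> : E - g = (E - 1%:M - Y) - (g - 1%:M - Y).
    by clear; move: E g (1%:M : 'M[C]_n) Y => a1 a2 a3 a4; mxadd.
  apply: (le_trans (mnB _ _)); rewrite mulrDl mul1r; apply: lerD => //.
  apply: (le_trans hE); have -> : 4 * c * e ^+ 2 = c * (2 * e) ^+ 2 by ring.
  apply: ler_wpM2l => //.
  by rewrite ler_sqr ?nnegrE ?mn_ge0 // mulr_ge0.
have ht : `|t| <= D * e ^+ 2.
  have t2 : `|t| <= 2^-1.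
    by apply: (le_trans tm); apply: (le_trans mY); move: he; clear; lra.
  apply: (le_trans (small_angle t2)); rewrite /D -[X in _ <= X]mulrA ler_pM2l //.
  have := hd _ _ mE mg; rewrite dE dg => h; apply: (le_trans h).
  by rewrite -mulrA; apply: ler_wpM2l.
exists (Y - (iC R * cR (t / n%:R))%:M).
  split.
    rewrite /su_alg /= adjB hs opprB addrC; congr (_ - _).
    rewrite -scalemx1 adjZ adj1; have -> : conjc (iC R * cR (t / n%:R)) = - (iC R * cR (t / n%:R)).
      by apply/eqP; rewrite eq_complex /=; apply/andP; split; apply/eqP; ring.
    by rewrite scaleNr opprK.
  rewrite raddfB /= mxtrace_scalar tY; apply/eqP; rewrite subr_eq0 -[_ *+ n]mulr_natr -mulrA -cR_nat -cRM divfK //.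
  by rewrite pnatr_eq0 -lt0n.
have -> : g - 1%:M - (Y - (iC R * cR (t / n%:R))%:M) = (g - 1%:M - Y) + (iC R * cR (t / n%:R))%:M.
  by rewrite opprB addrA addrAC.
apply: (le_trans (mnD _ _)); rewrite mulrDl mul1r; apply: lerD => //.
rewrite -scalemx1 -scalerA mn_iC mn_cR mulrAC; apply: ler_wpM2r; first exact: mn_ge0.
apply: le_trans ht; rewrite normrM normfV (ger0_norm (ler0n R n)) ler_pdivrMr ?ltr0n //.
by rewrite ler_peMr // ler1n.
Qed.
End NearIdentity.

(** * Transitivity of SU(n) on the unit sphere *)

Section SphereTransitive.
Variable R : realType.
Local Notation C := (complex R).

Lemma trmx_unitary n (S : 'M[C]_n) : adj S *m S = 1%:M -> adj S^T *m S^T = 1%:M.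
Proof.
move=> /mulmx1C S1; have -> : adj S^T = (adj S)^T by apply/matrixP => i j; rewrite /adj !mxE.
by rewrite -trmx_mul S1 trmx1.
Qed.

Lemma sphereE n (psi : 'cV[C]_n) : sphere psi <-> adj psi *m psi = 1%:M.
Proof.
have E : (adj psi *m psi) 0 0 = cR (\sum_(i < n) (complex.Re (psi i 0) ^+ 2 + complex.Im (psi i 0) ^+ 2)).
  rewrite mxE cR_sum; apply: eq_bigr => i _; rewrite !mxE mulrC.
  by apply/eqP; rewrite eq_complex Rez_cn_sq Imz_cn_sq /= !eqxx.
split=> [h|h].
  by apply/matrixP => i j; rewrite !ord1 E h !mxE.
by apply: (@cR_inj R); rewrite -E h !mxE.
Qed.

(** Gram-Schmidt is applied to the matrix all of whose rows are the transpose of [psi]: the result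
    is unitary whatever the rank, and its first row is proportional to that transpose. *)
Lemma first_column n (psi : 'cV[C]_n.+1) : adj psi *m psi = 1%:M ->
  exists W : 'M[C]_n.+1, exists z, [/\ adj W *m W = 1%:M, conjc z * z = 1 & psi = z *: (W *m delta_mx 0 0)].
Proof.
move=> psi1; pose A : 'M[C]_n.+1 := \matrix_i psi^T.
have SU : schmidt A \is unitarymx by exact: schmidt_unitarymx.
have S1 : adj (schmidt A) *m schmidt A = 1%:M by apply/eqP; rewrite -unitarymx_adj.
have := row_schmidt_sub A 0; rewrite (big_pred1 0) => [|k]; last by rewrite /= leqn0.
rewrite genmxE rowK => /sub_rVP [z E].
have psiE : psi = z *: ((schmidt A)^T *m delta_mx 0 0).
  by rewrite -[psi]trmxK E linearZ /= rowE trmx_mul trmx_delta.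
exists (schmidt A)^T, z; split => //; first exact: trmx_unitary.
have W1 := trmx_unitary S1; move: psi1; rewrite psiE adjZ adjM -scalemxAl -scalemxAr scalerA.
rewrite mulmxA -[adj _ *m adj _ *m _]mulmxA W1 mulmx1.
rewrite adj_delta mul_delta_mx => /(congr1 (fun M : 'M[C]_1 => M 0 0)).
by rewrite /= !mxE !eqxx mulr1.
Qed.

(** The first axis carries the required phase; in dimension at least two a second axis is free to
    bring the determinant back to 1. *)
Lemma SU_transitive n (psi phi : 'cV[C]_n.+2) : sphere psi -> sphere phi -> exists2 g, SU_grp g & g *m psi = phi.
Proof.
move=> /sphereE /first_column [W1 [z1 [U1 h1 ->]]] /sphereE /first_column [W2 [z2 [U2 h2 ->]]].
pose d := \det W2 * conjc (\det W1) * (z2 * conjc z1).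
have uc (z : C) : conjc z * z = 1 -> z * conjc z = 1 by rewrite mulrC.
have det1' (W : 'M[C]_n.+2) : adj W *m W = 1%:M -> conjc (\det W) * \det W = 1.
  by move=> /(congr1 determinant); rewrite det_mulmx det_adj det1.
have d1 : conjc d * d = 1.
  have e1 := det1' _ U1; have e2 := det1' _ U2.
  rewrite /d !rmorphM /= !conjcK.
  have -> : conjc (\det W2) * \det W1 * (conjc z2 * z1) * (\det W2 * conjc (\det W1) * (z2 * conjc z1)) =
    (conjc (\det W2) * \det W2) * (conjc (\det W1) * \det W1) * (conjc z2 * z2) * (conjc z1 * z1) by ring.
  by rewrite e1 e2 h1 h2 !mulr1.
pose del := \row_(k < n.+2) (if k == 0 then z2 * conjc z1 else if k == 1 then conjc d else 1 : C).
pose g := W2 *m diag_mx del *m adj W1.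
exists g.
  split.
    rewrite /g !adjM adjK adj_diag !mulmxA -[W1 *m _ *m adj W2 *m W2]mulmxA U2 mulmx1 -[W1 *m _ *m _]mulmxA.
    have -> : diag_mx (map_mx (@conjc R) del) *m diag_mx del = 1%:M.
      apply/matrixP => i j; rewrite mul_diag_mx !mxE; case: (altP (i =P j)) => [_|_]; last by rewrite !mulr0n mulr0.
      rewrite !mulr1n; case: ifP => _; first by rewrite rmorphM /= conjcK mulrACA h2 mul1r mulrC h1.
      case: ifP => _; first by rewrite conjcK mulrC.
      by rewrite conjc1 mulr1.
    by rewrite mulmx1; exact: mulmx1C.
  rewrite /g !det_mulmx det_diag det_adj !big_ord_recl big1 => [|k _]; last by rewrite mxE.
  rewrite !mxE /= mulr1 -[RHS]d1 /d; ring.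
rewrite /g -scalemxAr -!mulmxA [adj W1 *m (_ *m _)]mulmxA U1 mul1mx scalemxAr; rewrite -scalemxAr.
have -> : diag_mx del *m delta_mx 0 0 = (z2 * conjc z1) *: (delta_mx 0 0 : 'cV_n.+2).
  apply/matrixP => i j; rewrite mul_diag_mx !mxE (ord1 j) eqxx andbT.
  by case: (i == 0); rewrite ?mulr0 ?mulr1.
by rewrite -scalemxAr scalerA mulrCA [z1 * _]mulrC h1 mulr1.
Qed.
End SphereTransitive.

(** * Controllability *)

Section GroupReached.
Variable R : realType.
Local Notation C := (complex R).
Variables n m : nat.
Variables (H0 : 'M[C]_n) (Hs : 'I_m -> 'M[C]_n).
Hypothesis hH0 : is_hermitian H0.
Hypothesis hHs : forall k, is_hermitian (Hs k).
Local Notation H := (Hu H0 Hs).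
Variable U : set 'rV[R]_m.
Local Notation ev := (ev H0 Hs).
Local Notation evs := (evs H0 Hs).
Variables (G L : set 'M[C]_n).
Hypothesis GU : forall g, G g -> adj g *m g = 1%:M.
Hypothesis GM : forall g h, G g -> G h -> G (g *m h).
Hypothesis GV : forall g, G g -> G (adj g).
Hypothesis Gev : forall w s, pword U w -> G (evs w s).
Hypothesis Gnear : exists c e : R, [/\ 0 <= c, 0 < e & forall g, G g -> mn (g - 1%:M) <= e ->
  exists2 X, L X & mn (g - 1%:M - X) <= c * mn (g - 1%:M) ^+ 2].
Hypothesis Groot : forall g (e : R), 0 < e -> G g -> exists h N, [/\ G h, mpow h N = g & mn (h - 1%:M) <= e].
Hypothesis LE : L = lie_gen [set iC R *: H u | u in U].
Hypothesis LAd : forall E X, adj E *m E = 1%:M -> L X -> L (Ad E X).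

Lemma word_mpow w k : word U w -> exists2 w', word U w' & ev w' = mpow (ev w) k.
Proof.
move=> hw; elim: k => [|k [w' hw' E]]; first by exists [::] => // p; rewrite in_nil.
by exists (w ++ w'); [exact: word_cat|rewrite ev_cat E].
Qed.

Lemma group_reached g : G g -> exists2 w, word U w & ev w = g.
Proof.
have [w hw span] := spanning_word hH0 hHs LE LAd.
have [rho rho0 hrho] := local_surjectivity hH0 hHs GU GM GV Gev Gnear hw span.
have ww : word U w by move=> p /hw [p0 Up]; split=> //; exact: ltW.
pose y := ev w; have Gy : G y by rewrite /y -evs0; exact: Gev.
pose b : R := (2 * n * n)%:R + 1; have b0 : 0 < b by rewrite ltr_wpDl // ler0n.
have mb h : G h -> mn h <= b by move=> /GU /mn_isometry hh; apply: (le_trans hh); rewrite lerDl.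
pose d := rho / (2 * b); have d0 : 0 < d by rewrite divr_gt0 // mulr_gt0.
have [k hk] := unitary_recurrence d0 (GU Gy).
have Gpow j : G (mpow y j.+1).
  by elim: j => [|j IH]; [rewrite /mpow /= mulmx1|exact: GM].
have G1 : G 1%:M by rewrite -(GU Gy); apply: GM => //; exact: GV.
have Gpow' j : G (mpow y j) by case: j => [|j]; [exact: G1|exact: Gpow].
(* The power y^(k+1) is close to 1, so y^k is nearly the inverse of y. For h near 1, the element z =
   y^-k h is near y, hence reached, and h = y^k z is reached by concatenation. *)
have near h : G h -> mn (h - 1%:M) <= d -> exists2 w', word U w' & ev w' = h.
  move=> Gh hd; pose z := adj (mpow y k) *m h.
  have Gz : G z by apply: GM => //; exact: GV.
  have pk : mpow y k *m z = h by rewrite mulmxA (mulmx1C (GU (Gpow' k))) mul1mx.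
  have zy : mn (z - y) <= rho.
    have -> : z - y = adj (mpow y k) *m ((h - 1%:M) - (mpow y k.+1 - 1%:M)).
      have -> : (h - 1%:M) - (mpow y k.+1 - 1%:M) = h - mpow y k *m y.
        have -> : mpow y k.+1 = mpow y k *m y by rewrite -addn1 mpowD /mpow /= mulmx1.
        by rewrite opprB addrA subrK.
      by rewrite mulmxBr mulmxA (GU (Gpow' k)) mul1mx.
    have m1 : mn (adj (mpow y k)) <= b by rewrite mn_adj; exact: mb.
    have m2 : mn ((h - 1%:M) - (mpow y k.+1 - 1%:M)) <= d + d by apply: (le_trans (mnB _ _)); exact: lerD.
    apply: (le_trans (mnM_le m1 m2)); rewrite le_eqVlt; apply/orP; left; apply/eqP.
    by rewrite /d; field; rewrite gt_eqF.
  have [w1 hw1 E1] := hrho z Gz zy; have [w2 hw2 E2] := word_mpow k ww.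
  by exists (w2 ++ w1); [exact: word_cat|rewrite ev_cat E1 E2].
move=> Gg; have [h [N [Gh hN hd]]] := Groot d0 Gg.
have [w' hw' E'] := near h Gh hd.
by rewrite -hN -E'; exact: word_mpow.
Qed.
End GroupReached.

Section Controllability.
Variable R : realType.
Local Notation C := (complex R).
Variables n m : nat.
Variables (H0 : 'M[C]_n) (Hs : 'I_m -> 'M[C]_n).
Hypothesis hH0 : is_hermitian H0.
Hypothesis hHs : forall k, is_hermitian (Hs k).
Local Notation H := (Hu H0 Hs).
Variable U : set 'rV[R]_m.
Hypothesis U0 : U !=set0.
Local Notation ev := (ev H0 Hs).

(** Traceless matrices form a complex Lie algebra, so [direction_in] and [parameter_in] carry the
    hypothesis from the points of [U] to the coefficients of [H]. *)
Lemma trace_zero : open U -> (forall u, U u -> \tr (H u) = 0) -> \tr H0 = 0 /\ forall k, \tr (Hs k) = 0.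
Proof.
move=> oU t0; pose g := [set X : 'M[C]_n | \tr X = 0].
have gL : complex_lie g.
  split=> [|X Y hX hY|a X hX|X Y _ _]; rewrite /g /=.
  - by rewrite mxtrace0.
  - by rewrite mxtraceD hX hY addr0.
  - by rewrite mxtraceZ hX mulr0.
  - by rewrite raddfB /= mxtrace_mulC subrr.
have [u Uu] := U0.
split; last by move=> k; exact: (direction_in oU gL t0 k Uu).
have := parameter_in oU gL t0 0 Uu; rewrite /g /= /Hu big1 ?addr0 // => k _.
by rewrite mxE cR0 scale0r.
Qed.

Lemma controllable_U : lie_gen [set iC R *: H u | u in U] = @u_alg R n ->
  forall g, U_grp g -> exists2 w, word U w & ev w = g.
Proof.
move=> LE; apply: (group_reached hH0 hHs _ _ _ _ (U_near R n) _ (esym LE)).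
- by [].
- by move=> g h hg hh; rewrite /U_grp /= adjM -mulmxA [adj g *m _]mulmxA hg mul1mx.
- by move=> g /mulmx1C hg; rewrite /U_grp /= adjK.
- by move=> w s _; exact: evs_unitary.
- by move=> g e e0; exact: U_root.
- by move=> E X _; exact: Ad_u_alg.
Qed.

Lemma controllable_SU : (0 < n)%N -> (forall u, U u -> \tr (H u) = 0) ->
  lie_gen [set iC R *: H u | u in U] = @su_alg R n ->
  forall g, SU_grp g -> exists2 w, word U w & ev w = g.
Proof.
move=> n0 t0 LE; apply: (group_reached hH0 hHs _ _ _ _ (SU_near R n0) _ (esym LE)).
- by move=> g [].
- move=> g h [hg dg] [hh dh]; split; last by rewrite det_mulmx dg dh mulr1.
  by rewrite adjM -mulmxA [adj g *m _]mulmxA hg mul1mx.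
- move=> g [/mulmx1C hg dg]; split; first by rewrite adjK.
  by rewrite det_adj dg conjc1.
- move=> w s hw; split; first exact: evs_unitary.
  elim: w s hw => [|p w IH] s hw /=; first by rewrite det1.
  have [_ Up] := hw p (mem_head _ _).
  rewrite det_mulmx flow_det ?mul1r; first by apply: IH => q qw; apply: hw; rewrite inE qw orbT.
    exact: Hu_hermitian.
  exact: t0.
- by move=> g e e0; exact: SU_root.
- by move=> E X; exact: Ad_su_alg.
Qed.

Lemma exactly_controllable_U : (forall g, U_grp g -> exists2 w, word U w & ev w = g) ->
  exactly_controllable U H (@U_grp R n).
Proof.
move=> reach X0 hX0; apply/seteqP; split=> [Y [T [u [X [T0 adm X00 sol <-]]]]|Y hY].
  by rewrite /U_grp /= (sol_gram hH0 hHs T0 adm sol) X00.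
have [w hw E] : exists2 w, word U w & ev w = Y *m adj X0.
  apply: reach; rewrite /U_grp /= adjM adjK -mulmxA [adj Y *m _]mulmxA hY mul1mx.
  exact: mulmx1C.
have -> : Y = ev w *m X0 by rewrite E -mulmxA hX0 mulmx1.
exact: word_reachable.
Qed.

Lemma exactly_controllable_SU : open U -> (forall u, U u -> \tr (H u) = 0) ->
  (forall g, SU_grp g -> exists2 w, word U w & ev w = g) -> exactly_controllable U H (@SU_grp R n).
Proof.
move=> oU t0 reach X0 [hX0 dX0]; have [tH0 tHs] := trace_zero oU t0.
apply/seteqP; split=> [Y [T [u [X [T0 adm X00 sol <-]]]]|Y [hY dY]].
  split; first by rewrite (sol_gram hH0 hHs T0 adm sol) X00.
  by rewrite (sol_det hH0 hHs T0 adm sol tH0 tHs) X00.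
have [w hw E] : exists2 w, word U w & ev w = Y *m adj X0.
  apply: reach; split; last by rewrite det_mulmx det_adj dX0 dY conjc1 mulr1.
  by rewrite adjM adjK -mulmxA [adj Y *m _]mulmxA hY mul1mx; exact: mulmx1C.
have -> : Y = ev w *m X0 by rewrite E -mulmxA hX0 mulmx1.
exact: word_reachable.
Qed.

(** The hypothesis asks for the elements of SU(n) only, so that both trace cases can provide it. *)
Lemma exactly_controllable_sphere : (1 < n)%N ->
  (forall g, SU_grp g -> exists2 w, word U w & ev w = g) -> exactly_controllable U H (@sphere R n).
Proof.
move=> n1 reach psi hpsi; apply/seteqP; split=> [Y [T [u [X [T0 adm X00 sol <-]]]]|phi hphi].
  by apply/sphereE; rewrite (sol_gram hH0 hHs T0 adm sol) X00; apply/sphereE.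
have [g hg <-] : exists2 g, SU_grp g & g *m psi = phi.
  move: n1 psi phi hpsi hphi {reach}; clear; case: n => [|[|k]] // _ psi phi; exact: SU_transitive.
have [w hw <-] := reach g hg; exact: word_reachable.
Qed.
End Controllability.

Theorem theorem2p1 (R : realType) (n m : nat) (U : set 'rV[R]_m)
  (H0 : 'M[complex R]_n) (Hs : 'I_m -> 'M[complex R]_n) :
  (2 <= n)%N -> (2 <= m)%N -> open U -> connected U ->
  is_hermitian H0 -> (forall k, is_hermitian (Hs k)) ->
  conically_connected U (Hu H0 Hs) ->
  [/\ ((forall u, U u -> \tr (Hu H0 Hs u) = 0) ->
         lie_gen [set iC R *: Hu H0 Hs u | u in U] = (@su_alg R n) /\
         exactly_controllable U (Hu H0 Hs) (@SU_grp R n)),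
      (~ (forall u, U u -> \tr (Hu H0 Hs u) = 0) ->
         lie_gen [set iC R *: Hu H0 Hs u | u in U] = (@u_alg R n)/\
         exactly_controllable U (Hu H0 Hs) (@U_grp R n)) &
      exactly_controllable U (Hu H0 Hs) (@sphere R n)].
Proof.
move=> n2 m2 oU cU hH0 hHs con.
(* Nonemptiness of [U] comes from the prescribed intersection between the first two eigenvalues. *)
have U0 : U !=set0 by have [_ /(_ 0%N n2) [ub Uub _]] := con; exists ub.
have n0 : (0 < n)%N by exact: ltnW.
have lie1 := lie_gen_su hH0 hHs oU cU n2 m2 con.
have lie2 := lie_gen_u hH0 hHs oU cU n2 m2 con.
have reach1 t0 := controllable_SU hH0 hHs n0 t0 (lie1 t0).
have reach2 nt := controllable_U hH0 hHs (lie2 nt).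
split=> [t0|nt|].
- by split; [exact: lie1|exact: exactly_controllable_SU (reach1 t0)].
- by split; [exact: lie2|exact: exactly_controllable_U (reach2 nt)].
have [t0|nt] := pselect (forall u, U u -> \tr (Hu H0 Hs u) = 0).
  exact: exactly_controllable_sphere (reach1 t0).
apply: exactly_controllable_sphere => // g [hg _]; exact: reach2.
Qed.
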